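(* Define $$\mathcal{D}=\{f\in\mathcal{H}_t \mid Lf\in\mathcal{H}_t,\ f(0^-)=f(0^+),\ f'(0^-)=f'(0^+)\}\subset\mathcal{H}_t .$$ Then $(L,\mathcal{D})$ is self-adjoint, and the spectrum of $(L,\mathcal{D})$ is $$\sigma(L)=\{-ab\}\cup\{-ab(1-q^k):k\in\mathbb{N}\}\cup\{-ab(1+q^k/abt):k\in\mathbb{Z}\}=\{\mu(0)\}\cup\mu(-q^{\mathbb{N}})\cup\mu(q^{\mathbb{Z}}/abt),$$ where $\mu(\gamma)=-ab(1+\gamma)$. Moreover, $\mu(-q^{\mathbb{N}})\cup\mu(q^{\mathbb{Z}}/abt)$ is the point spectrum $\sigma_p(L)$, which is simple: for $\gamma\in -q^{\mathbb{N}}\cup q^{\mathbb{Z}}/abt$ the eigenvector is the function $\phi_\gamma(\cdot)=\phi_\gamma(\cdot;a,b;q)\in\mathcal{D}$, and $L\phi_\gamma=\mu(\gamma)\phi_\gamma$.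
   Context: Fix $0<q<1$; $\mathbb{N}=\{0,1,2,\dots\}$; $(x;q)_n=\prod_{k=0}^{n-1}(1-xq^k)$ for $n\in\mathbb{N}\cup\{\infty\}$, $(x_1,\dots,x_k;q)_n=\prod_j(x_j;q)_n$. Standing condition on the parameters: $t>0$ and one of the following holds: (i) $a=\bar b$ with $a\in\mathbb{C}\setminus\mathbb{R}$; (ii) $0<a<1$ and $0<b<1$; (iii) for some $k_0\in-\mathbb{N}$, $q^{k_0}<a<q^{k_0-1}$ and $q^{k_0}<b<q^{k_0-1}$; (iv) for some $k_0\in\mathbb{Z}$, $q^{k_0}<-at<q^{k_0-1}$ and $q^{k_0}<-bt<q^{k_0-1}$. Weight: $w(x)=\frac{(-qx;q)_\infty}{(-ax,-bx;q)_\infty}$ (positive on $-q^{\mathbb{N}}\cup tq^{\mathbb{Z}}$). $\mathcal{F}_q$ is the space of complex-valued functions on $-q^{\mathbb{N}}\cup tq^{\mathbb{Z}}$. With $\int_{-1}^{\infty(t)}f(x)\,d_qx=(1-q)\sum_{k\ge0}f(-q^k)q^k+(1-q)\sum_{k\in\mathbb{Z}}f(tq^k)tq^k$, $\mathcal{H}_t$ is the Hilbert space of $f\in\mathcal{F}_q$ with $\int_{-1}^{\infty(t)}|f(x)|^2w(x)\,d_qx<\infty$, with inner product $\langle f,g\rangle=\int_{-1}^{\infty(t)}f(x)\overline{g(x)}w(x)\,d_qx$. Operator on $\mathcal{F}_q$: $(Lf)(x)=A(x)[f(qx)-f(x)]+B(x)[f(x/q)-f(x)]$, $A(x)=(a+\frac1x)(b+\frac1x)$,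 $B(x)=\frac qx(1+\frac1x)$; since $B(-1)=0$ the second term is absent at $x=-1$. Limits at zero: $D_qf(x)=\frac{f(x)-f(qx)}{(1-q)x}$; $f(0^+)=\lim_{k\to\infty}f(tq^k)$, $f(0^-)=\lim_{k\to\infty}f(-q^k)$, $f'(0^+)=\lim_{k\to\infty}(D_qf)(tq^k)$, $f'(0^-)=\lim_{k\to\infty}(D_qf)(-q^k)$; membership in $\mathcal{D}$ includes existence of these limits. $q$-Meixner function: $\phi_\gamma(x)=\phi_\gamma(x;a,b;q)={}_2\varphi_2(-1/x,-1/\gamma;a,b;q,ab\gamma x)=\sum_{n\ge0}\frac{(-1/x,-1/\gamma;q)_n}{(q,a,b;q)_n}(-1)^nq^{n(n-1)/2}(ab\gamma x)^n$. *)

(* Defs.v *)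
From HB Require Import structures.
From mathcomp Require Import all_boot all_order all_algebra.
From mathcomp Require Import all_classical all_reals all_analysis.
From mathcomp Require Import complex.

Set Implicit Arguments.
Unset Strict Implicit.
Unset Printing Implicit Defensive.

Import Order.TTheory GRing.Theory Num.Theory numFieldNormedType.Exports.

Local Open Scope classical_set_scope.
Local Open Scope ring_scope.

(** * Unbounded operators *)

(* The Hilbert space is a subspace [H] of an ambient vector space [V],
   together with an inner product [ip], linear in its first argument, of which
   only the values on [H] matter.  An operator is a pair [(D, T)] where
   [T : V -> V] is only looked at on its LD [D]. *)
Section Operators.
Context {C : numClosedFieldType} {V : lmodType C}.
Variables (H : set V) (ip : V -> V -> C) (D : set V) (T : V -> V).

Definition ip_norm (f : V) : C := sqrtC (ip f f).

Definition dense_in : Prop :=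
  D `<=` H /\
  forall f, H f -> forall e : C, 0 < e -> exists2 g, D g & ip_norm (f - g) < e.

Definition linear_operator : Prop :=
  [/\ D 0,
      forall (c : C) f g, D f -> D g -> D (c *: f + g),
      forall f, D f -> H (T f) &
      forall (c : C) f g, D f -> D g -> T (c *: f + g) = c *: T f + T g].

Definition op_graph : set (V * V) := [set p | D p.1 /\ p.2 = T p.1].

Definition adjoint_graph : set (V * V) :=
  [set p | [/\ H p.1, H p.2 & forall f, D f -> ip (T f) p.1 = ip f p.2]].

Definition self_adjoint : Prop :=
  [/\ linear_operator, dense_in & adjoint_graph = op_graph].

(* [T - l] maps [D] bijectively onto [H], with a bounded inverse. *)
Definition resolvent_set : set C :=
  [set l | (forall g, H g -> exists! f, D f /\ T f - l *: f = g) /\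
           exists M : C,
             forall f, D f -> ip_norm f <= M * ip_norm (T f - l *: f)].

Definition spectrum : set C := ~` resolvent_set.

Definition op_eigenspace (l : C) : set V := [set f | D f /\ T f = l *: f].

Definition point_spectrum : set C :=
  [set l | exists2 f, op_eigenspace l f & f != 0].

End Operators.

(** * q-calculus *)

(* [C] is an abstract field of complex numbers, so that no embedding of the
   reals is needed; [<] on [C] is the partial order for which [x < y] forces
   [y - x] to be real.  In particular [0 < a < 1] says that [a] is real. *)
Section QMeixner.
Context {C : numClosedFieldType}.
Implicit Types (q t a b x z : C) (F : C -> C).

Definition qpoch x q (n : nat) : C := \prod_(k < n) (1 - x * q ^+ k).

Definition qpoch_inf x q : C := limn (qpoch x q).

Definition phi22 (a1 a2 b1 b2 q z : C) : C :=
  limn (series (fun n : nat =>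
    qpoch a1 q n * qpoch a2 q n /
      (qpoch q q n * qpoch b1 q n * qpoch b2 q n) *
    ((-1) ^+ n * q ^+ 'C(n, 2)) * z ^+ n)).

Definition qMeixner a b q (gamma x : C) : C :=
  phi22 (- x^-1) (- gamma^-1) a b q (a * b * gamma * x).

Definition negqN q : set C := [set - q ^+ k | k in [set: nat]].

Definition cqZ (c q : C) : set C := [set c * q ^ k | k in [set: int]].

Definition grid q t : set C := negqN q `|` cqZ t q.

(* Sums over [int] are split into the sums over [k >= 0] and [k < 0]. *)
Definition sumZ (u : int -> C) : C :=
  limn (series (fun n : nat => u (Posz n))) +
  limn (series (fun n : nat => u (Negz n))).

Definition cvg_sumZ (u : int -> C) : Prop :=
  cvgn (series (fun n : nat => u (Posz n))) /\
  cvgn (series (fun n : nat => u (Negz n))).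

Definition jackson q t F : C :=
  (1 - q) * limn (series (fun k : nat => F (- q ^+ k) * q ^+ k)) +
  (1 - q) * sumZ (fun k : int => F (t * q ^ k) * (t * q ^ k)).

(* For a nonnegative [F] this means that the integral is finite. *)
Definition jackson_cvg q t F : Prop :=
  cvgn (series (fun k : nat => F (- q ^+ k) * q ^+ k)) /\
  cvg_sumZ (fun k : int => F (t * q ^ k) * (t * q ^ k)).

Definition parameters q t a b : Prop :=
  0 < t /\
  [\/ a = b^* /\ a \isn't Num.real,
      0 < a < 1 /\ 0 < b < 1,
      exists k0 : int, [/\ k0 <= 0, q ^ k0 < a < q ^ (k0 - 1)
                         & q ^ k0 < b < q ^ (k0 - 1)] |
      exists k0 : int, q ^ k0 < - (a * t) < q ^ (k0 - 1) /\
                       q ^ k0 < - (b * t) < q ^ (k0 - 1)].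

Definition weight a b q x : C :=
  qpoch_inf (- (q * x)) q /
    (qpoch_inf (- (a * x)) q * qpoch_inf (- (b * x)) q).

Definition Fq q t : lmodType C := grid q t -> C.

(* [valL_ 0 f : C -> C] extends [f] by zero outside of the grid.  All formulas
   below evaluate it on the grid only, except for [L] at [x = -1], where the
   factor [coef_B] of the value at [x / q] vanishes. *)

Definition inner q t a b (f g : Fq q t) : C :=
  jackson q t (fun x => valL_ 0 f x * (valL_ 0 g x)^* * weight a b q x).

Definition Ht q t a b : set (Fq q t) :=
  [set f : Fq q t |
    jackson_cvg q t (fun x => `|valL_ 0 f x| ^+ 2 * weight a b q x)].

Definition coef_A a b x : C := (a + x^-1) * (b + x^-1).

Definition coef_B q x : C := q / x * (1 + x^-1).

Definition L q t a b (f : Fq q t) : Fq q t := fun x : grid q t =>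
  coef_A a b (val x) * (valL_ 0 f (q * val x) - f x) +
  coef_B q (val x) * (valL_ 0 f (val x / q) - f x).

Definition Dq q F x : C := (F x - F (q * x)) / ((1 - q) * x).

Definition along_pos q t F : nat -> C := fun k => F (t * q ^+ k).

Definition along_neg q F : nat -> C := fun k => F (- q ^+ k).

Definition same_limit_at0 q t F : Prop :=
  [/\ cvgn (along_neg q F), cvgn (along_pos q t F) &
      limn (along_neg q F) = limn (along_pos q t F)].

Definition domL q t a b : set (Fq q t) :=
  [set f : Fq q t | [/\ Ht a b f, Ht a b (L a b f),
               same_limit_at0 q t (valL_ 0 f) &
               same_limit_at0 q t (Dq q (valL_ 0 f))]].

Definition phi_fun q t a b (gamma : C) : Fq q t :=
  fun x : grid q t => qMeixner a b q gamma (val x).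

Definition mu a b (gamma : C) : C := - (a * b) * (1 + gamma).

End QMeixner.

Arguments inner {C} q t a b.
Arguments Ht {C} q t a b.
Arguments L {C} q t a b.
Arguments domL {C} q t a b.
Arguments phi_fun {C} q t a b.

(* Main.v *)
Require Import Defs.
From HB Require Import structures.
From mathcomp Require Import all_boot all_order all_algebra.
From mathcomp Require Import all_classical all_reals all_analysis.
From mathcomp Require Import complex ring.

Set Implicit Arguments.
Unset Strict Implicit.
Unset Printing Implicit Defensive.

Import Order.TTheory GRing.Theory Num.Theory numFieldNormedType.Exports.

Local Open Scope classical_set_scope.
Local Open Scope ring_scope.

(** A function is a sequence on the enumerated grid and the Hilbert space is a
    weighted [l2].  The operator is symmetric up to a Casorati determinant whose
    boundary term at infinity vanishes and whose boundary terms at [0-] and [0+]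
    cancel on the domain; the limits at [0] exist as soon as [f] and [L f] are
    square integrable, so testing an element of the adjoint domain against point
    masses and against the functions [1] and [x + 1] gives self-adjointness.

    The series [phi_gamma (x)] is symmetric in [gamma] and [x].  Hence the
    [phi_gamma], with [gamma] in the dual grid ([t] replaced by [1 / (a b t)]),
    are orthogonal in [x] and, for the dual weight, also orthogonal in [gamma].
    Dual equation and orthogonality give the ratios of the norms, so both Gram
    matrices are bounded diagonal matrices; computing [K^* K K^*] in two ways
    shows that they are one and the same scalar.  So [phi] is unitary up to that
    scalar, it diagonalizes [L], and the spectrum is the closure of the set of
    eigenvalues.

    That [phi_gamma] is square integrable at infinity rests on the vanishing, for [N >= 0], of
    [sum_n (-1)^n q^(n (n - 1) / 2) q^(-N n) / (q; q)_n = (q^(-N); q)_oo]. *)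

(** * Sequences and absolutely convergent series *)

(** The obstacle is completeness of the eigenfunctions: solving the eigenvalue equation does not
    exclude further spectrum. Duality removes it. The positivity condition on the parameters
    survives [t -> 1 / (a b t)], so whatever is proved for a row of the kernel (an eigenfunction in
    [x]) also holds for a column, and orthogonality of the columns is what makes the transform
    injective. No norm is evaluated: norm times dual mass takes at most two values a priori, and
    these are identified through row and column 0, which are constantly 1 because [phi_(-1) = 1] and
    [phi_gamma (-1) = 1]. The delicate estimate is growth at infinity, where the terms of the series
    are huge. The cancellation is exploited only for [gamma > 1], where [1 / (-q^n / gamma; q)_oo]
    has a power series expansion. The eigenvalue equation with the two variables exchanged is a
    three-term recurrence in [gamma]; it reaches the remaining positive [gamma], and starting from
    [phi_(-1) = 1] also the negative ones. Each step may cost a factor [x], which is harmless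
    because the masses at infinity decay faster than any geometric sequence. *)

Section Sequences.
Context {C : numClosedFieldType}.
Implicit Types (u v : nat -> C) (l m : C).

Lemma seq_cvgP u l : u @ \oo --> l <->
  forall e, 0 < e -> exists N, forall n, (N <= n)%N -> `|l - u n| <= e.
Proof.
split => [/cvgrPdist_le h e e0|h].
  by have [N _ hN] := h _ e0; exists N => n /hN.
apply/cvgrPdist_le => e e0; have [N hN] := h _ e0.
by exists N => // n /hN.
Qed.

Lemma seq_cvg_unique u l m : u @ \oo --> l -> u @ \oo --> m -> l = m.
Proof. by move=> ul um; apply: (cvg_unique (@norm_hausdorff _ C) ul um). Qed.

Lemma seq_limE u l : u @ \oo --> l -> limn u = l.
Proof. by move=> ul; apply: (cvg_lim (@norm_hausdorff _ C)). Qed.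

Lemma seq_cvg_norm u l : u @ \oo --> l -> (fun n => `|u n|) @ \oo --> `|l|.
Proof. by move=> ul; apply: (cvg_norm ul). Qed.

Lemma seq_cvgD u v l m : u @ \oo --> l -> v @ \oo --> m ->
  (fun n => u n + v n) @ \oo --> l + m.
Proof. by move=> ul vm; apply: (cvgD ul vm). Qed.

Lemma seq_cvgB u v l m : u @ \oo --> l -> v @ \oo --> m ->
  (fun n => u n - v n) @ \oo --> l - m.
Proof. by move=> ul vm; apply: (cvgB ul vm). Qed.

Lemma seq_cvgM u v l m : u @ \oo --> l -> v @ \oo --> m ->
  (fun n => u n * v n) @ \oo --> l * m.
Proof. by move=> ul vm; apply: (cvgM ul vm). Qed.

Lemma seq_cvg_cst l : (fun=> l) @ \oo --> l.
Proof. exact: cvg_cst. Qed.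
Arguments seq_cvg_cst : clear implicits.

Lemma seq_cvg_ge0 u l : (forall n, 0 <= u n) -> u @ \oo --> l -> 0 <= l.
Proof.
have := @seq_cvg_norm u l; move=> + u0 ul => /(_ ul).
rewrite (_ : (fun x => `|u x|) = u); last by apply/funext => n; rewrite ger0_norm.
by move=> h; rewrite (seq_cvg_unique ul h).
Qed.

Lemma seq_cvg_le u v l m : (forall n, u n <= v n) ->
  u @ \oo --> l -> v @ \oo --> m -> l <= m.
Proof.
move=> uv ul vm; rewrite -subr_ge0; apply: (@seq_cvg_ge0 (fun n => v n - u n)).
  by move=> n; rewrite subr_ge0.
exact: seq_cvgB.
Qed.

Lemma seq_cvg_le_cst u l m : (forall n, u n <= m) -> u @ \oo --> l -> l <= m.
Proof. by move=> um ul; apply: (seq_cvg_le um ul); apply: seq_cvg_cst. Qed.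

Lemma seq_squeeze0 u v : (forall n, `|u n| <= v n) -> v @ \oo --> (0 : C) ->
  u @ \oo --> (0 : C).
Proof.
move=> uv /seq_cvgP v0; apply/seq_cvgP => e /v0 [N hN]; exists N => n /hN.
rewrite !sub0r !normrN => h; apply: le_trans (uv n) _; apply: le_trans h.
by rewrite ger0_norm // (le_trans _ (uv n)).
Qed.

Lemma seq_cvg_shift N u l : (fun n => u (n + N)%N) @ \oo --> l <-> u @ \oo --> l.
Proof. by have := cvg_shiftn N u (nbhs l) => /= ->. Qed.

Lemma seq_cvg_subseq u l (k : nat -> nat) : (forall n, (n <= k n)%N) ->
  u @ \oo --> l -> u \o k @ \oo --> l.
Proof.
move=> nk /seq_cvgP h; apply/seq_cvgP => e /h [N hN]; exists N => n nN.
by apply: hN; apply: leq_trans (nk n).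
Qed.

Lemma seq_cvgV u l : l != 0 -> u @ \oo --> l -> (fun n => (u n)^-1) @ \oo --> l^-1.
Proof. by move=> l0 ul; apply: (cvgV l0 ul). Qed.

Lemma ev_bounded u N B : (forall n, (N <= n)%N -> `|u n| <= B) ->
  exists B', forall n, `|u n| <= B'.
Proof.
move=> h; exists (\sum_(k < N) `|u k| + `|B|) => n.
have [nN|nN] := leqP N n.
  by rewrite ler_wpDl ?sumr_ge0 // (le_trans (h _ nN)) // real_ler_norm //
             (ger0_real (le_trans _ (h _ nN))).
rewrite ler_wpDr // (bigD1 (Ordinal nN)) //= ler_wpDr // sumr_ge0 //.
Qed.

Lemma seq_cvg_bounded u l : u @ \oo --> l -> exists B, forall n, `|u n| <= B.
Proof.
move=> /seq_cvgP /(_ 1 ltr01) [N hN].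
apply: (@ev_bounded u N (`|l| + 1)) => n /hN h.
rewrite -[u n](subrK l) -normrN opprD opprB addrC.
by rewrite (le_trans (ler_normD _ _)) // addrC normrN addrC lerD //  distrC.
Qed.

Lemma seq_cvg_conj u l : u @ \oo --> l -> (fun n => (u n)^*) @ \oo --> l^*.
Proof.
move=> /seq_cvgP h; apply/seq_cvgP => e /h [N hN]; exists N => n /hN.
by rewrite -rmorphB norm_conjC.
Qed.

Lemma seq_cvgZ (c : C) u l : u @ \oo --> l -> (fun n => c * u n) @ \oo --> c * l.
Proof. by move=> ul; apply: (seq_cvgM (seq_cvg_cst c) ul). Qed.

Lemma seq_cvg_ext u v l : u =1 v -> u @ \oo --> l -> v @ \oo --> l.
Proof. by move=> /funext <-. Qed.

Lemma seq_cvg_near u v l N : (forall n, (N <= n)%N -> u n = v n) ->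
  u @ \oo --> l -> v @ \oo --> l.
Proof.
move=> uv /((seq_cvg_shift N u l).2) h; apply/(seq_cvg_shift N v l).1.
by apply: seq_cvg_ext h => n; rewrite uv // leq_addl.
Qed.

Lemma seq_cvg_sum (I : Type) (r : seq I) (F : I -> nat -> C) (l : I -> C) :
  (forall i, F i @ \oo --> l i) ->
  (fun n => \sum_(i <- r) F i n) @ \oo --> \sum_(i <- r) l i.
Proof.
move=> h; elim: r => [|i r ih].
  by rewrite big_nil; apply: (seq_cvg_ext _ (seq_cvg_cst 0)) => n; rewrite big_nil.
rewrite big_cons; apply: (seq_cvg_ext _ (seq_cvgD (h i) ih)) => n.
by rewrite big_cons.
Qed.

End Sequences.

Arguments seq_cvg_cst {C} l.
Arguments seq_cvgZ {C} c [u l].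

Section Sums.
Context {C : numClosedFieldType}.
Implicit Types (u v : nat -> C).

(** Stated through bounded partial sums of norms, so that comparison arguments involve no limit and
    do not depend on completeness. *)
Definition asum u := exists B, forall n, \sum_(0 <= k < n) `|u k| <= B.

Definition csum u : C := limn (series u).

Lemma asum_le u v : (forall n, `|u n| <= v n) -> asum v -> asum u.
Proof.
move=> uv [B hB]; exists B => n; apply: le_trans (hB n); apply: ler_sum => k _.
by rewrite (le_trans (uv k)) // real_ler_norm // ger0_real // (le_trans _ (uv k)).
Qed.

Lemma eq_asum u v : u =1 v -> asum u -> asum v.
Proof. by move=> /funext ->. Qed.

Lemma asum_norm u : asum u -> asum (fun n => `|u n|).
Proof. by move=> [B hB]; exists B => n; under eq_bigr do rewrite normr_id. Qed.

Lemma asum_leZ (c : C) u v : (forall n, `|u n| <= c * `|v n|) -> asum v -> asum u.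
Proof.
move=> uv [B hB]; exists (`|c| * B) => n.
apply: (@le_trans _ _ (`|c| * \sum_(0 <= k < n) `|v k|)); last by rewrite ler_wpM2l.
rewrite mulr_sumr; apply: ler_sum => k _.
by apply: (le_trans (real_ler_norm _)); [apply: ger0_real|
  rewrite normr_id -normrM (le_trans (uv k)) // normrM -[X in X <= _]ger0_norm
    ?normrM ?normr_id // (le_trans _ (uv k))].
Qed.

Lemma asumZ (c : C) u : asum u -> asum (fun n => c * u n).
Proof. by apply: (@asum_leZ `|c|) => n; rewrite normrM. Qed.

Lemma asumD u v : asum u -> asum v -> asum (fun n => u n + v n).
Proof.
move=> [B hB] [B' hB']; exists (B + B') => n.
apply: (@le_trans _ _ (\sum_(0 <= k < n) (`|u k| + `|v k|))).
  by apply: ler_sum => k _; apply: ler_normD.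
by rewrite big_split lerD.
Qed.

Lemma asumB u v : asum u -> asum v -> asum (fun n => u n - v n).
Proof.
move=> su sv; have := asumD su (asumZ (-1) sv).
by under [X in asum X]eq_fun do rewrite mulN1r.
Qed.

Lemma asum_fin u N : (forall n, (N <= n)%N -> u n = 0) -> asum u.
Proof.
move=> h; exists (\sum_(0 <= k < N) `|u k|) => n.
have [nN|/ltnW nN] := leqP n N.
  by rewrite [leRHS](@big_cat_nat _ _ _ n) //= ler_wpDr // sumr_ge0.
rewrite (@big_cat_nat _ _ _ N) //= [X in _ + X]big_nat [X in _ + X]big1 ?addr0 //.
by move=> k /andP[Nk _]; rewrite h // normr0.
Qed.

Lemma asum_shift N u : asum (fun n => u (n + N)%N) -> asum u.
Proof.
move=> [B hB]; exists (\sum_(0 <= k < N) `|u k| + B) => n.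
apply: (@le_trans _ _ (\sum_(0 <= k < n + N) `|u k|)).
  by rewrite [leRHS](@big_cat_nat _ _ _ n) ?leq_addr //= ler_wpDr // sumr_ge0.
rewrite (@big_cat_nat _ _ _ N) ?leq_addl //= lerD2l.
by rewrite -{1}[N]add0n big_addn addnK.
Qed.

Lemma asum_geometric (r : C) : 0 <= r < 1 -> asum (fun n => r ^+ n).
Proof.
move=> /andP[r0 r1]; exists (1 - r)^-1 => n.
have h : (1 - r) * \sum_(0 <= k < n) `|r ^+ k| = 1 - r ^+ n.
  elim: n => [|n ih]; first by rewrite big_nil mulr0 expr0 subrr.
  by rewrite big_nat_recr //= mulrDr ih ger0_norm ?exprn_ge0 // exprS; ring.
have r1' : 0 < 1 - r by rewrite subr_gt0.
by rewrite -(ler_pM2l r1') h mulfV ?gt_eqF // lerBlDr lerDl exprn_ge0.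
Qed.

(* d'Alembert's ratio test, with the ratios given as a sequence so that
   vanishing terms are harmless. *)
Lemma asum_ratio u (rho : nat -> C) (l : C) :
  (forall n, u n.+1 = rho n * u n) -> rho @ \oo --> l -> `|l| < 1 -> asum u.
Proof.
move=> hu hr l1; set r := (`|l| + 1) / 2.
have r0 : 0 <= r by rewrite divr_ge0 ?addr_ge0.
have lr : `|l| < r by rewrite ltr_pdivlMr // mulr_natr mulr2n ltrD2l.
have r1 : r < 1 by rewrite ltr_pdivrMr // mul1r -[2]/(1 + 1) ltrD2r.
have [|N hN] := (seq_cvgP _ _).1 hr (r - `|l|); first by rewrite subr_gt0.
have hrho n : (N <= n)%N -> `|rho n| <= r.
  move=> /hN h; rewrite -[rho n](subKr l) (le_trans (ler_normB _ _)) //.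
  by rewrite -lerBrDl.
apply: (@asum_shift N); apply: (@asum_leZ `|u N| _ (fun n => r ^+ n)); last first.
  by apply: asum_geometric; rewrite r0.
elim => [|n ih]; first by rewrite add0n expr0 normr1 mulr1.
rewrite addSn hu normrM exprS normrM mulrCA (ger0_norm r0) ler_pM //.
by rewrite hrho // leq_addl.
Qed.

Lemma asum_bound u v B : (forall n, `|v n| <= B) -> asum u -> asum (fun n => v n * u n).
Proof. by move=> vB; apply: (@asum_leZ B) => n; rewrite normrM ler_wpM2r. Qed.

Lemma sum_mul3 u n : \sum_(0 <= k < 3 * n) u k =
  \sum_(0 <= k < n) (u (3 * k)%N + u (3 * k).+1 + u (3 * k).+2).
Proof.
elim: n => [|n ih]; first by rewrite muln0 !big_nil.
by rewrite mulnS addnC !addnS addn0 !big_nat_recr //= ih !addrA.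
Qed.

Lemma asum_mul3 u : asum u <->
  [/\ asum (fun k => u (3 * k)%N), asum (fun k => u (3 * k).+1)
    & asum (fun k => u (3 * k).+2)].
Proof.
split=> [[B hB]|[[A hA] [B hB] [D hD]]].
  have h n : \sum_(0 <= k < n) (`|u (3 * k)%N| + `|u (3 * k).+1| + `|u (3 * k).+2|) <= B.
    by rewrite -(sum_mul3 (fun k => `|u k|)).
  split; exists B => n; apply: le_trans (h n); apply: ler_sum => k _.
  - by rewrite -addrA lerDl addr_ge0.
  - by rewrite addrAC lerDr addr_ge0.
  - by rewrite lerDr addr_ge0.
exists (A + B + D) => n; apply: (@le_trans _ _ (\sum_(0 <= k < 3 * n) `|u k|)).
  by rewrite [leRHS](@big_cat_nat _ _ _ n) ?leq_pmull //= ler_wpDr // sumr_ge0.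
by rewrite sum_mul3 !big_split !lerD.
Qed.

End Sums.

(** A [numClosedFieldType] need not be complete (the algebraic numbers form one), so convergence of
    absolutely convergent series is carried as a hypothesis; [sum_complete_complex] discharges it
    for [R[i]]. *)
Definition sum_complete (C : numClosedFieldType) : Prop :=
  forall u : nat -> C, asum u -> cvgn (series u).

Section CompleteSums.
Context {C : numClosedFieldType} (cplC : sum_complete C).
Implicit Types (u v : nat -> C).

Lemma csum_cvg u : asum u -> series u @ \oo --> csum u.
Proof. exact: cplC. Qed.

Lemma csumE u (l : C) : series u @ \oo --> l -> csum u = l.
Proof. exact: seq_limE. Qed.

Lemma asum_cvg0 u : asum u -> u @ \oo --> (0 : C).
Proof. by move=> /cplC /cvg_series_cvg_0. Qed.

Lemma csumD u v : asum u -> asum v -> csum (fun n => u n + v n) = csum u + csum v.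
Proof.
move=> su sv; apply: csumE; apply: (seq_cvg_ext _ (seq_cvgD (csum_cvg su) (csum_cvg sv))).
by move=> n; rewrite /series /= -big_split.
Qed.

Lemma csumZ (c : C) u : asum u -> csum (fun n => c * u n) = c * csum u.
Proof.
move=> su; apply: csumE; apply: (seq_cvg_ext _ (seq_cvgZ c (csum_cvg su))).
by move=> n; rewrite /series /= mulr_sumr.
Qed.

Lemma csumB u v : asum u -> asum v -> csum (fun n => u n - v n) = csum u - csum v.
Proof.
move=> su sv; apply: csumE; apply: (seq_cvg_ext _ (seq_cvgB (csum_cvg su) (csum_cvg sv))).
by move=> n; rewrite /series /= -sumrB.
Qed.

Lemma csum_sum (I : Type) (r : seq I) (F : I -> nat -> C) :
  (forall i, asum (F i)) ->
  csum (fun n => \sum_(i <- r) F i n) = \sum_(i <- r) csum (F i).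
Proof.
move=> h; apply: csumE.
apply: (seq_cvg_ext _ (seq_cvg_sum (fun i => csum_cvg (h i)))) => n.
by rewrite /series /= exchange_big.
Qed.

Lemma csum_conj u : asum u -> csum (fun n => (u n)^*) = (csum u)^*.
Proof.
move=> su; apply: csumE; apply: (seq_cvg_ext _ (seq_cvg_conj (csum_cvg su))).
by move=> n; rewrite /series /= rmorph_sum.
Qed.

Lemma csum_ge0 u : (forall n, 0 <= u n) -> asum u -> 0 <= csum u.
Proof.
by move=> u0 /csum_cvg; apply: seq_cvg_ge0 => n; apply: sumr_ge0.
Qed.

Lemma csum_le u v : (forall n, u n <= v n) -> asum u -> asum v -> csum u <= csum v.
Proof.
move=> uv /csum_cvg su /csum_cvg sv; apply: seq_cvg_le su sv => n.
by apply: ler_sum.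
Qed.

Lemma csum_le_bound u B : (forall n, \sum_(0 <= k < n) u k <= B) -> asum u ->
  csum u <= B.
Proof. by move=> uB /csum_cvg; apply: seq_cvg_le_cst. Qed.

Lemma csum_ge_partial u n : (forall n, 0 <= u n) -> asum u ->
  \sum_(0 <= k < n) u k <= csum u.
Proof.
move=> u0 /csum_cvg /((seq_cvg_shift n _ _).2) h.
apply: (seq_cvg_le _ (seq_cvg_cst _) h) => m /=.
by rewrite [leRHS](@big_cat_nat _ _ _ n) ?leq_addl //= lerDl sumr_ge0.
Qed.

Lemma csum_ge_term u n : (forall n, 0 <= u n) -> asum u -> u n <= csum u.
Proof.
move=> u0 su; apply: le_trans (csum_ge_partial n.+1 u0 su).
by rewrite big_nat_recr //= lerDr sumr_ge0.
Qed.

Lemma csum_norm_le u : asum u -> `|csum u| <= csum (fun n => `|u n|).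
Proof.
move=> su; have h := csum_cvg (asum_norm su).
by apply: (seq_cvg_le _ (seq_cvg_norm (csum_cvg su)) h) => n; apply: ler_norm_sum.
Qed.

Lemma csum_fin u N : (forall n, (N <= n)%N -> u n = 0) ->
  csum u = \sum_(0 <= k < N) u k.
Proof.
move=> h; apply: csumE; apply: (@seq_cvg_near _ (fun=> \sum_(0 <= k < N) u k) _ _ N).
  move=> n nN; rewrite /series /= [RHS](@big_cat_nat _ _ _ N) //=.
  by rewrite [X in _ + X]big_nat [X in _ + X]big1 ?addr0 // => k /andP[/h ->].
exact: seq_cvg_cst.
Qed.

Lemma csum1 u N : (forall n, n != N -> u n = 0) -> csum u = u N.
Proof.
move=> h; rewrite (@csum_fin _ N.+1) => [|n nN]; last by rewrite h // gtn_eqF.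
by rewrite big_nat_recr //= big_nat big1 ?add0r // => k kN; rewrite h // ltn_eqF.
Qed.

Lemma csumS u : asum u -> csum u = u 0%N + csum (fun n => u n.+1).
Proof.
move=> /csum_cvg su; rewrite -[LHS](subrK (u 0%N)) addrC; congr (_ + _).
apply/esym/csumE.
apply: (seq_cvg_ext _ (seq_cvgB ((seq_cvg_shift 1 _ _).2 su) (seq_cvg_cst (u 0%N)))) => n.
by rewrite /series /= addn1 big_nat_recl //= addrC addKr.
Qed.

Lemma asum_tail u : asum u -> forall e, 0 < e ->
  exists K, forall n, \sum_(K <= k < n) `|u k| <= e.
Proof.
move=> su e e0; have sn := asum_norm su.
have [K hK] := (seq_cvgP _ _).1 (csum_cvg sn) e e0; exists K => n.
have [nK|/ltnW Kn] := leqP n K; first by rewrite big_geq // ltW.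
apply: le_trans (hK _ (leqnn K)).
have -> : \sum_(K <= k < n) `|u k| = \sum_(0 <= k < n) `|u k| - \sum_(0 <= k < K) `|u k|.
  by rewrite [X in _ = X - _](@big_cat_nat _ _ _ K) //= addrAC subrr add0r.
rewrite [leRHS]ger0_norm ?subr_ge0 ?csum_ge_partial //.
by rewrite lerD2r csum_ge_partial.
Qed.

Lemma csum_split u K T : asum u -> (forall n, \sum_(K <= k < n) `|u k| <= T) ->
  `|csum u| <= `|\sum_(0 <= k < K) u k| + T.
Proof.
move=> su hT.
apply: (@seq_cvg_le_cst _ _ _ _ _ (seq_cvg_norm ((seq_cvg_shift K _ _).2 (csum_cvg su)))).
move=> n; rewrite /series /= (@big_cat_nat _ _ _ K) ?leq_addl //=.
by rewrite (le_trans (ler_normD _ _)) // lerD2l (le_trans (ler_norm_sum _ _ _)).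
Qed.

(** Tannery's theorem: beyond [K] the dominating series bounds both tails by [e / 3], and the
    finitely many terms below [K] converge one by one. *)
Lemma csum_dominated (u : nat -> nat -> C) v (b : nat -> C) :
  asum b -> (forall N k, `|u N k| <= b k) ->
  (forall k, u^~ k @ \oo --> v k) ->
  (fun N => csum (u N)) @ \oo --> csum v.
Proof.
move=> sb ub uv.
have vb k : `|v k| <= b k.
  by apply: (@seq_cvg_le_cst _ _ _ _ _ (seq_cvg_norm (uv k))) => N; apply: ub.
have su N : asum (u N) by apply: asum_le sb.
have sv : asum v by apply: asum_le sb.
apply/seq_cvgP => e e0; have e3 : 0 < e / 3 by rewrite divr_gt0.
have [K hK] := asum_tail sb e3.
have /seq_cvgP /(_ _ e3)[N0 hN0] :
    (fun N => \sum_(0 <= k < K) (v k - u N k)) @ \oo --> \sum_(0 <= k < K) (v k - v k).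
  by apply: seq_cvg_sum => k; apply: (seq_cvgB (seq_cvg_cst _) (uv k)).
exists N0 => N /hN0; rewrite [X in X - _]big1 ?sub0r ?normrN => [h|k _]; last exact: subrr.
rewrite -csumB //; apply: (@le_trans _ _ (e / 3 + (e / 3 + e / 3))).
  apply: le_trans (@csum_split _ K (e / 3 + e / 3) _ _) _; first exact: asumB.
    move=> n; apply: (@le_trans _ _ (\sum_(K <= k < n) (`|b k| + `|b k|))).
      apply: ler_sum => k _; rewrite (le_trans (ler_normB _ _)) //.
      by rewrite [`|b k|]ger0_norm ?lerD // (le_trans _ (vb k)).
    by rewrite big_split lerD.
  by rewrite lerD2r.
by rewrite le_eqVlt; apply/orP; left; apply/eqP; field.
Qed.

Lemma csum_mul3 u : asum u -> csum u =
  csum (fun k => u (3 * k)%N) + csum (fun k => u (3 * k).+1)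
  + csum (fun k => u (3 * k).+2).
Proof.
move=> su; have [s0 s1 s2] := (asum_mul3 _).1 su.
rewrite -!csumD //; last exact: asumD.
apply/esym/csumE.
apply: (seq_cvg_ext _ (@seq_cvg_subseq _ _ _ (fun n => 3 * n)%N _ (csum_cvg su))).
  by move=> n; rewrite /series /= sum_mul3.
by move=> n; rewrite leq_pmull.
Qed.

End CompleteSums.

(** * Weighted l2 spaces and diagonal operators *)

Section WeightedL2.
Context {C : numClosedFieldType}.
Implicit Types (f g h W : nat -> C).

Definition l2 W f := asum (fun n => `|f n| ^+ 2 * W n).

Definition wip W f g : C := csum (fun n => f n * (g n)^* * W n).

Definition truncate N f : nat -> C := fun n => if (n < N)%N then f n else 0.

(** The usual factor 1/2 is dropped, since comparison tests are insensitive to it. *)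
Lemma mul_le_sqrD (x y : C) : 0 <= x -> 0 <= y -> x * y <= x ^+ 2 + y ^+ 2.
Proof.
move=> x0 y0; rewrite -subr_ge0.
have -> : x ^+ 2 + y ^+ 2 - x * y = (x - y) ^+ 2 + x * y by ring.
by apply: addr_ge0; [rewrite real_exprn_even_ge0 // rpredB // ger0_real|rewrite mulr_ge0].
Qed.

Lemma sqr_normD_le (x y : C) : `|x + y| ^+ 2 <= 2 * (`|x| ^+ 2 + `|y| ^+ 2).
Proof.
apply: (@le_trans _ _ ((`|x| + `|y|) ^+ 2)).
  by rewrite lerXn2r ?nnegrE ?addr_ge0 // ler_normD.
rewrite -subr_ge0.
have -> : 2 * (`|x| ^+ 2 + `|y| ^+ 2) - (`|x| + `|y|) ^+ 2 = (`|x| - `|y|) ^+ 2 by ring.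
by rewrite real_exprn_even_ge0 // rpredB // normr_real.
Qed.

Variables (cplC : sum_complete C) (W : nat -> C).
Hypothesis W0 : forall n, 0 < W n.

Lemma wip_asum f g : l2 W f -> l2 W g -> asum (fun n => f n * (g n)^* * W n).
Proof.
move=> lf lg; apply: asum_le (asumD lf lg) => n.
rewrite -mulrDl !normrM norm_conjC (gtr0_norm (W0 n)) ler_wpM2r ?(ltW (W0 n)) //.
by apply: mul_le_sqrD.
Qed.

Lemma l2_lin (c : C) f g : l2 W f -> l2 W g -> l2 W (fun n => c * f n + g n).
Proof.
move=> lf lg; apply: asum_le (asumD (asumZ (2 * `|c| ^+ 2) lf) (asumZ 2 lg)) => n.
rewrite normrM (gtr0_norm (W0 n)) ger0_norm ?exprn_ge0 //.
apply: (@le_trans _ _ (2 * (`|c * f n| ^+ 2 + `|g n| ^+ 2) * W n)).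
  by rewrite ler_wpM2r ?(ltW (W0 n)) // sqr_normD_le.
by rewrite normrM le_eqVlt; apply/orP; left; apply/eqP; ring.
Qed.

Lemma l2Z (c : C) f : l2 W f -> l2 W (fun n => c * f n).
Proof.
move=> lf; apply: (@asum_leZ _ (`|c| ^+ 2) _ _ _ lf) => n.
by rewrite [`|c * f n|]normrM exprMn -mulrA [leLHS]normrM ger0_norm ?exprn_ge0.
Qed.

Lemma l2B f g : l2 W f -> l2 W g -> l2 W (fun n => f n - g n).
Proof.
move=> lf lg; have := l2_lin (-1) lg lf.
by under [X in l2 _ X]eq_fun do rewrite mulN1r addrC.
Qed.

Lemma l2_fin f N : (forall n, (N <= n)%N -> f n = 0) -> l2 W f.
Proof. by move=> h; apply: (@asum_fin _ _ N) => n /h ->; rewrite normr0 expr0n mul0r. Qed.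

Lemma l2_trunc N f : l2 W (truncate N f).
Proof. by apply: (@l2_fin _ N) => n; rewrite /truncate ltnNge => ->. Qed.

Lemma wipC f g : l2 W f -> l2 W g -> wip W g f = (wip W f g)^*.
Proof.
move=> lf lg; rewrite -csum_conj //; last exact: wip_asum.
congr csum; apply/funext => n.
by rewrite !rmorphM /= conjCK (CrealP (gtr0_real (W0 n))) (mulrC (g n)).
Qed.

Lemma wip_linl (c : C) f g h : l2 W f -> l2 W g -> l2 W h ->
  wip W (fun n => c * f n + g n) h = c * wip W f h + wip W g h.
Proof.
move=> lf lg lh; rewrite -csumZ //; last exact: wip_asum.
rewrite -csumD //; [|exact/asumZ/wip_asum|exact: wip_asum].
by congr csum; apply/funext => n; ring.
Qed.

Lemma wipZl (c : C) f h : l2 W f -> l2 W h ->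
  wip W (fun n => c * f n) h = c * wip W f h.
Proof.
move=> lf lh; rewrite -csumZ //; last exact: wip_asum.
by congr csum; apply/funext => n; ring.
Qed.

Lemma wip_linr (c : C) f g h : l2 W f -> l2 W g -> l2 W h ->
  wip W h (fun n => c * f n + g n) = c^* * wip W h f + wip W h g.
Proof.
move=> lf lg lh; rewrite wipC //; last exact: l2_lin.
by rewrite wip_linl // rmorphD rmorphM /= -!wipC.
Qed.

Lemma wipZr (c : C) f h : l2 W f -> l2 W h ->
  wip W f (fun n => c * h n) = c^* * wip W f h.
Proof.
move=> lf lh; rewrite wipC //; last exact: l2Z.
by rewrite wipZl // rmorphM /= -!wipC.
Qed.

Lemma wipBl f g h : l2 W f -> l2 W g -> l2 W h ->
  wip W (fun n => f n - g n) h = wip W f h - wip W g h.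
Proof.
move=> lf lg lh; rewrite addrC -mulN1r -wip_linl //.
by congr wip; apply/funext => n; rewrite mulN1r addrC.
Qed.

Lemma wip_selfE f : wip W f f = csum (fun n => `|f n| ^+ 2 * W n).
Proof. by congr csum; apply/funext => n; rewrite normCK. Qed.

Lemma wip_ge0 f : l2 W f -> 0 <= wip W f f.
Proof.
by move=> lf; rewrite wip_selfE csum_ge0 // => n; rewrite mulr_ge0 ?(ltW (W0 n)).
Qed.

Lemma wip_eq0 f : l2 W f -> wip W f f = 0 -> forall n, f n = 0.
Proof.
move=> lf e n; apply/eqP; rewrite -normr_eq0 -sqrf_eq0.
rewrite -(mulIr_eq0 _ (mulIf (lt0r_neq0 (W0 n)))) eq_le.
rewrite mulr_ge0 ?(ltW (W0 n)) // andbT -e wip_selfE.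
apply: (@csum_ge_term _ _ (fun n => `|f n| ^+ 2 * W n)) => // k.
by rewrite mulr_ge0 ?(ltW (W0 k)).
Qed.

Lemma wip_cauchy_schwarz f g : l2 W f -> l2 W g ->
  `|wip W f g| ^+ 2 <= wip W f f * wip W g g.
Proof.
move=> lf lg; have [B0|Bn0] := eqVneq (wip W g g) 0.
  rewrite B0 mulr0 (_ : wip W f g = 0) ?normr0 ?expr0n //.
  rewrite /wip (@csum_fin _ _ 0) ?big_nil // => n _.
  by rewrite (wip_eq0 lg B0) conjC0 mulr0 mul0r.
have B1 : 0 < wip W g g by rewrite lt_def Bn0 wip_ge0.
set c := wip W f g; set B := wip W g g in Bn0 B1 *.
(* The vector is [f - (c / B) g], the component of [f] orthogonal to [g]; nonnegativity of its
   squared norm, multiplied by [B], is the claim. *)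
have := wip_ge0 (l2_lin (- (c / B)) lg lf).
rewrite wip_linl ?(wip_linr (- (c / B)) lg lf lg) ?(wip_linr (- (c / B)) lg lf lf) //;
  last exact: l2_lin.
rewrite (wipC lf lg) -/c -/B => h.
rewrite -subr_ge0 normCK; apply: le_trans (mulr_ge0 h (ltW B1)) _.
rewrite le_eqVlt; apply/orP; left; apply/eqP.
rewrite rmorphN rmorphM /= fmorphV /= (CrealP (gtr0_real B1)).
by field.
Qed.

Lemma tail_cvg0 f : l2 W f ->
  (fun N => wip W (fun n => f n - truncate N f n) (fun n => f n - truncate N f n))
    @ \oo --> (0 : C).
Proof.
move=> lf; have h0 : csum (fun=> 0 : C) = 0 by rewrite (@csum_fin _ _ 0) // big_nil.
rewrite -[X in _ --> X]h0.
have h := @csum_dominated _ cplC (fun N n => `|f n - truncate N f n| ^+ 2 * W n)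
  (fun=> 0) (fun n => `|f n| ^+ 2 * W n) lf.
apply: (seq_cvg_ext _ (h _ _)) => [N|N k|k]; first by rewrite wip_selfE.
  rewrite ger0_norm ?mulr_ge0 ?(ltW (W0 k)) // ler_wpM2r ?(ltW (W0 k)) // /truncate.
  by case: ifP => _; rewrite ?subr0 // subrr normr0 expr0n mulr_ge0.
apply: (@seq_cvg_near _ (fun=> 0) _ _ k.+1); last exact: seq_cvg_cst.
by move=> n kn; rewrite /truncate kn subrr normr0 expr0n mul0r.
Qed.

Lemma wip_trunc_self_le N f : l2 W f -> wip W (truncate N f) (truncate N f) <= wip W f f.
Proof.
move=> lf; rewrite !wip_selfE; apply: csum_le => //; last exact: l2_trunc.
move=> n; rewrite ler_wpM2r ?(ltW (W0 n)) // /truncate; case: ifP => // _.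
by rewrite normr0 expr0n exprn_ge0.
Qed.

End WeightedL2.

(** * Kernel operators with orthogonal columns *)

Section Kernel.
Context {C : numClosedFieldType}.

(** The operator with kernel [Phi] from functions of [n], with masses [W], to functions of [m]. For
    a real kernel, exchanging the arguments of [Phi] and using the masses [V] gives the formal
    adjoint [K']. *)
Definition ktrans (Phi : nat -> nat -> C) (W f : nat -> C) (m : nat) : C :=
  csum (fun n => f n * Phi m n * W n).

Variables (cplC : sum_complete C) (W V : nat -> C) (Phi : nat -> nat -> C).
Hypotheses (W0 : forall n, 0 < W n) (V0 : forall n, 0 < V n).
Hypothesis Phi_real : forall m n, (Phi m n)^* = Phi m n.
Hypothesis rowl2 : forall m, l2 W (Phi m).
Hypothesis coll2 : forall n, l2 V (Phi^~ n).
Hypothesis col_orth : forall n n', n != n' -> wip V (Phi^~ n) (Phi^~ n') = 0.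
Variable kmax : C.

Let kap n := wip V (Phi^~ n) (Phi^~ n) * W n.

Hypothesis kap_le : forall n, kap n <= kmax.

Local Notation K := (ktrans Phi W).
Local Notation K' := (ktrans (fun n m => Phi m n) V).

Lemma kap_ge0 n : 0 <= kap n.
Proof. by rewrite mulr_ge0 ?wip_ge0 // ltW. Qed.

Lemma ktransE f m : K f m = wip W f (Phi m).
Proof. by congr csum; apply/funext => n; rewrite Phi_real. Qed.

Lemma ktransE' s n : K' s n = wip V s (Phi^~ n).
Proof. by congr csum; apply/funext => m; rewrite Phi_real. Qed.

Lemma ktrans_lin (c : C) f g m : l2 W f -> l2 W g ->
  K (fun n => c * f n + g n) m = c * K f m + K g m.
Proof. by move=> lf lg; rewrite !ktransE wip_linl. Qed.

Lemma ktrans_fin N f m : (forall n, (N <= n)%N -> f n = 0) ->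
  K f m = \sum_(0 <= n < N) f n * W n * Phi m n.
Proof.
move=> fN; rewrite /ktrans (@csum_fin _ _ N) => [|n /fN ->]; last by rewrite !mul0r.
by apply: eq_bigr => n _; rewrite mulrAC.
Qed.

Lemma ktrans_fin_l2 N f : (forall n, (N <= n)%N -> f n = 0) -> l2 V (K f).
Proof.
move=> fN; rewrite (_ : K f = fun m => \sum_(0 <= n < N) f n * W n * Phi m n).
  elim: N {fN} => [|N ih].
    by apply: (@l2_fin _ _ _ 0) => m _; rewrite big_nil.
  have := l2_lin V0 (f N * W N) (coll2 N) ih.
  by congr l2; apply/funext => m; rewrite big_nat_recr //= addrC.
by apply/funext => m; apply: ktrans_fin.
Qed.

(** [K f] is a finite combination of columns, and pairing it with column [n] keeps only the [n]-th
    one. *)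
Lemma ktransK_fin N f n : (forall n, (N <= n)%N -> f n = 0) -> K' (K f) n = kap n * f n.
Proof.
move=> fN; rewrite /ktrans -/(K f).
have := @csum_sum _ cplC nat (index_iota 0 N)
  (fun i m => (f i * W i) * (Phi m i * (Phi m n)^* * V m)).
rewrite (_ : (fun m => _) = (fun m => K f m * Phi m n * V m)); last first.
  apply/funext => m; rewrite (ktrans_fin m fN) !mulr_suml; apply: eq_bigr => i _.
  by rewrite Phi_real; ring.
move=> h; rewrite h => [|i]; last exact: asumZ (wip_asum V0 (coll2 i) (coll2 n)).
rewrite (eq_bigr (fun i => f i * W i * wip V (Phi^~ i) (Phi^~ n))); last first.
  by move=> i _; rewrite csumZ //; apply: (wip_asum V0 (coll2 i) (coll2 n)).
have [nN|Nn] := ltnP n N; last first.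
  rewrite fN // mulr0 big_nat big1 // => i /andP[_ iN].
  by rewrite col_orth ?mulr0 // ltn_eqF // (leq_trans iN).
rewrite (bigD1_seq n) ?mem_index_iota ?iota_uniq //= big1 ?addr0 => [|i ni].
  by rewrite /kap; ring.
by rewrite col_orth ?mulr0.
Qed.

(** Expanding one factor [K f] and applying [ktransK_fin] gives [sum_n kap_n |f_n|^2 W_n] for the
    squared norm. *)
Lemma ktrans_norm_fin N f : (forall n, (N <= n)%N -> f n = 0) ->
  wip V (K f) (K f) <= kmax * wip W f f.
Proof.
move=> fN; have lKf := ktrans_fin_l2 fN.
have -> : wip V (K f) (K f) = \sum_(0 <= n < N) kap n * (f n * (f n)^* * W n).
  have -> : wip V (K f) (K f) =
      csum (fun m => \sum_(0 <= n < N) ((f n)^* * W n) * (K f m * Phi m n * V m)).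
    congr csum; apply/funext => m; rewrite {2}(ktrans_fin m fN) rmorph_sum /=.
    rewrite mulr_sumr mulr_suml; apply: eq_bigr => i _.
    by rewrite !rmorphM /= Phi_real (CrealP (gtr0_real (W0 i))); ring.
  have h i : asum (fun m => K f m * Phi m i * V m).
    rewrite (_ : (fun m => _) = (fun m => K f m * (Phi m i)^* * V m)).
      exact: (wip_asum V0).
    by apply/funext => m; rewrite Phi_real.
  rewrite csum_sum // => [|i]; last exact: asumZ.
  apply: eq_bigr => i _; rewrite csumZ // -/(ktrans (fun n m => Phi m n) V (K f) i).
  by rewrite (ktransK_fin _ fN); ring.
rewrite /wip (@csum_fin _ _ N) => [|n /fN ->]; last by rewrite !mul0r.
rewrite mulr_sumr; apply: ler_sum => n _; rewrite ler_wpM2r //.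
by rewrite -normCK mulr_ge0 // ltW.
Qed.

Lemma ktrans_trunc_cvg f m : l2 W f -> (fun N => K (truncate N f) m) @ \oo --> K f m.
Proof.
move=> lf; have sf : asum (fun n => f n * Phi m n * W n).
  rewrite (_ : (fun m => _) = (fun n => f n * (Phi m n)^* * W n)).
    exact: (wip_asum W0).
  by apply/funext => n; rewrite Phi_real.
apply: (seq_cvg_ext _ (csum_cvg cplC sf)) => N.
rewrite (@ktrans_fin N) => [|n]; last by rewrite /truncate ltnNge => ->.
by apply: eq_big_nat => n /andP[_ nN]; rewrite /truncate nN mulrAC.
Qed.

(** A Fatou argument: each finite part of the norm of [K f] is the limit of the same part for
    truncations of [f], to which the finite case applies. *)
Lemma ktrans_bounded f : l2 W f ->
  l2 V (K f) /\ wip V (K f) (K f) <= kmax * wip W f f.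
Proof.
move=> lf; have kmax0 : 0 <= kmax by rewrite (le_trans (kap_ge0 0)).
have part M : \sum_(0 <= m < M) `|K f m| ^+ 2 * V m <= kmax * wip W f f.
  apply: (@seq_cvg_le_cst _ (fun N => \sum_(0 <= m < M) `|K (truncate N f) m| ^+ 2 * V m)).
    move=> N; have fN n : (N <= n)%N -> truncate N f n = 0 by rewrite /truncate ltnNge => ->.
    apply: (@le_trans _ _ (wip V (K (truncate N f)) (K (truncate N f)))).
      rewrite wip_selfE; apply: csum_ge_partial => //.
        by move=> n; rewrite mulr_ge0 // ltW.
      exact: (ktrans_fin_l2 fN).
    apply: le_trans (ktrans_norm_fin fN) _.
    by rewrite ler_wpM2l // wip_trunc_self_le.
  apply: seq_cvg_sum => m; apply: seq_cvgM (seq_cvg_cst _).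
  have h := seq_cvg_norm (@ktrans_trunc_cvg f m lf).
  exact: (seq_cvgM h h).
have lK : l2 V (K f).
  exists (kmax * wip W f f) => n; under eq_bigr => m _ do
    rewrite ger0_norm ?mulr_ge0 ?(ltW (V0 m)) //.
  exact: part.
by split=> //; rewrite wip_selfE; apply: csum_le_bound.
Qed.

(** Both sides are continuous in [f]: by Cauchy-Schwarz the squared error against the finite case is
    at most a constant times the squared norm of a tail of [f]. *)
Lemma ktransK f n : l2 W f -> K' (K f) n = kap n * f n.
Proof.
move=> lf; apply/eqP; rewrite -subr_eq0 -normr_eq0 -sqrf_eq0 eq_le exprn_ge0 // andbT.
have hb : (fun N => kmax * wip V (Phi^~ n) (Phi^~ n) *
    wip W (fun n => f n - truncate N f n) (fun n => f n - truncate N f n)) @ \oo --> (0 : C).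
  by rewrite -[X in _ --> X](mulr0 (kmax * wip V (Phi^~ n) (Phi^~ n)));
     apply: seq_cvgZ; apply: (tail_cvg0 cplC W0).
(* Truncating only past [n] keeps the entry [f n], so that the right-hand side carries no error. *)
move/(seq_cvg_shift n.+1 _ _).2 : hb => hb.
apply: (seq_cvg_le _ (seq_cvg_cst _) hb) => N /=.
set M := (N + n.+1)%N; set g := truncate M f.
have gM k : (M <= k)%N -> g k = 0 by rewrite /g /truncate ltnNge => ->.
have lg : l2 W g by apply: l2_trunc.
have lh : l2 W (fun k => f k - g k) by apply: l2B.
have [lKh Kh] := ktrans_bounded lh; have [lKf _] := ktrans_bounded lf.
have [lKg _] := ktrans_bounded lg.
have eKh : K (fun k => f k - g k) = fun m => K f m - K g m.
  by apply/funext => m; rewrite !ktransE wipBl.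
have -> : f n = g n by rewrite /g /truncate /M addnS ltnS leq_addl.
rewrite -(ktransK_fin n gM) !ktransE' -wipBl // -eKh.
apply: le_trans (wip_cauchy_schwarz cplC V0 lKh (coll2 n)) _.
by rewrite mulrAC ler_wpM2r // wip_ge0.
Qed.

End Kernel.

(** * Kernels with orthogonal rows and columns *)

Section UnitaryKernel.
Context {C : numClosedFieldType} (cplC : sum_complete C).
Variables (W V : nat -> C) (Phi : nat -> nat -> C).
Hypotheses (W0 : forall n, 0 < W n) (V0 : forall n, 0 < V n).
Hypothesis Phi_real : forall m n, (Phi m n)^* = Phi m n.
Hypothesis rowl2 : forall m, l2 W (Phi m).
Hypothesis coll2 : forall n, l2 V (Phi^~ n).
Hypothesis col_orth : forall n n', n != n' -> wip V (Phi^~ n) (Phi^~ n') = 0.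
Hypothesis row_orth : forall m m', m != m' -> wip W (Phi m) (Phi m') = 0.
Variables kW kV : C.
Hypothesis col_le : forall n, wip V (Phi^~ n) (Phi^~ n) * W n <= kW.
Hypothesis row_le : forall m, wip W (Phi m) (Phi m) * V m <= kV.
Hypotheses (row0 : forall n, Phi 0 n = 1) (col0 : forall m, Phi m 0 = 1).

Local Notation K := (ktrans Phi W).
Local Notation K' := (ktrans (fun n m => Phi m n) V).

(** Every row and column yields the same value ([row_const], [col_const]); row 0 is convenient
    because it is constantly 1. *)
Definition kernel_const : C := wip W (Phi 0) (Phi 0) * V 0%N.
Local Notation kappa := kernel_const.

(* Both sides of [K' (K f) = kappa_n f n] are computed for [f] a row of the
   kernel; as no entry of row and column 0 vanishes, all constants agree. *)
Lemma row_col_const m n : Phi m n != 0 ->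
  wip W (Phi m) (Phi m) * V m = wip V (Phi^~ n) (Phi^~ n) * W n.
Proof.
move=> mn0; have := ktransK cplC W0 V0 Phi_real rowl2 coll2 col_orth col_le n (rowl2 m).
rewrite {1}/ktrans (@csum1 _ _ m) => [|m' mm']; last first.
  by rewrite (ktransE _ Phi_real) row_orth 1?eq_sym // !mul0r.
rewrite (ktransE _ Phi_real) mulrAC => h.
by apply: (mulIf mn0).
Qed.

Lemma col_const n : wip V (Phi^~ n) (Phi^~ n) * W n = kappa.
Proof. by rewrite -(@row_col_const 0) // row0 oner_neq0. Qed.

Lemma row_const m : wip W (Phi m) (Phi m) * V m = kappa.
Proof. by rewrite (@row_col_const m 0) ?col_const // col0 oner_neq0. Qed.

Lemma kernel_const_gt0 : 0 < kappa.
Proof.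
rewrite mulr_gt0 // lt_def wip_ge0 // andbT; apply/eqP => h.
have := wip_eq0 cplC W0 (rowl2 0) h 0%N; rewrite row0 => /eqP; exact/negP/oner_neq0.
Qed.

Lemma ktrans_l2 f : l2 W f -> l2 V (K f).
Proof. by move=> lf; case: (ktrans_bounded cplC W0 V0 Phi_real rowl2 coll2 col_orth col_le lf). Qed.

Lemma ktrans_l2' s : l2 V s -> l2 W (K' s).
Proof.
move=> ls; apply: (ktrans_bounded cplC V0 W0 _ coll2 rowl2 row_orth row_le ls).1 => //.
Qed.

Lemma ktrans_invl f n : l2 W f -> K' (K f) n = kappa * f n.
Proof.
by move=> lf; rewrite (ktransK cplC W0 V0 Phi_real rowl2 coll2 col_orth col_le) // col_const.
Qed.

Lemma ktrans_invr s m : l2 V s -> K (K' s) m = kappa * s m.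
Proof.
move=> ls.
have h := @ktransK C cplC V W (fun n m => Phi m n) V0 W0 _ coll2 rowl2 row_orth _ row_le.
by rewrite h // row_const.
Qed.

(** The double sum is not known to converge absolutely, so the sums are exchanged only for
    truncations of [f]; boundedness of [K] then allows passing to the limit. *)
Lemma ktrans_adjoint f s : l2 W f -> l2 V s -> wip V (K f) s = wip W f (K' s).
Proof.
move=> lf ls; have lK's := ktrans_l2' ls; have lKf := ktrans_l2 lf.
have h1 := csum_cvg cplC (wip_asum W0 lf lK's).
apply: (@seq_cvg_unique _ (fun N => wip V (K (truncate N f)) s)).
  have h : (fun N => kW * wip V s s * wip W (fun n => f n - truncate N f n)
      (fun n => f n - truncate N f n)) @ \oo --> (0 : C).
    by rewrite -[X in _ --> X](mulr0 (kW * wip V s s));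
       apply: seq_cvgZ; apply: (tail_cvg0 cplC W0).
  have h2 : (fun N => `|wip V (K f) s - wip V (K (truncate N f)) s| ^+ 2) @ \oo --> (0 : C).
    apply: seq_squeeze0 h => N; have lg := @l2_trunc _ W N f.
    have lh : l2 W (fun k => f k - truncate N f k) by apply: l2B.
    have [lKh Kh] := ktrans_bounded cplC W0 V0 Phi_real rowl2 coll2 col_orth col_le lh.
    rewrite ger0_norm ?exprn_ge0 // -wipBl ?ktrans_l2 //.
    have -> : (fun m => K f m - K (truncate N f) m) = K (fun k => f k - truncate N f k).
      by apply/funext => m; rewrite !ktransE // wipBl.
    apply: le_trans (wip_cauchy_schwarz cplC V0 lKh ls) _.
    by rewrite mulrAC ler_wpM2r // wip_ge0.
    exact: ktrans_l2.
  apply/seq_cvgP => e e0.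
  have [N hN] := (seq_cvgP _ _).1 h2 (e ^+ 2) (exprn_gt0 _ e0).
  exists N => n /hN; rewrite sub0r normrN normrX normr_id.
  by rewrite ler_pXn2r // nnegrE // ltW.
apply: (seq_cvg_ext _ h1) => N.
have fN n : (N <= n)%N -> truncate N f n = 0 by rewrite /truncate ltnNge => ->.
rewrite /wip /series /=.
have sF i : asum (fun m => f i * W i * (Phi m i * (s m)^* * V m)).
  by apply: asumZ; apply: (wip_asum V0).
transitivity (csum (fun m => \sum_(0 <= i < N) f i * W i * (Phi m i * (s m)^* * V m))).
  rewrite csum_sum //; apply: eq_bigr => i _; rewrite csumZ //; last exact: (wip_asum V0).
  rewrite mulrAC; congr (_ * _); rewrite /ktrans -csum_conj //.
    congr csum; apply/funext => m; rewrite !rmorphM /= Phi_real.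
    by rewrite (CrealP (gtr0_real (V0 m))) (mulrC (Phi m i)).
  rewrite (_ : (fun n => _) = (fun n => s n * (Phi n i)^* * V n)).
    exact: (wip_asum V0).
  by apply/funext => m; rewrite Phi_real.
congr csum; apply/funext => m; rewrite (@ktrans_fin _ W Phi N (truncate N f) m fN) !mulr_suml.
apply: eq_big_nat => i /andP[_ iN].
by rewrite /truncate iN; ring.
Qed.

Lemma ktrans_parseval f g : l2 W f -> l2 W g ->
  wip V (K f) (K g) = kappa * wip W f g.
Proof.
move=> lf lg; rewrite ktrans_adjoint //; last exact: ktrans_l2.
rewrite (_ : K' (K g) = fun n => kappa * g n); last first.
  by apply/funext => n; rewrite ktrans_invl.
by rewrite wipZr // (CrealP (gtr0_real kernel_const_gt0)).
Qed.

End UnitaryKernel.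

(** * Limits of eigenvalues lie in the spectrum *)

Section SpectralTheory.
Context {C : numClosedFieldType} {U : lmodType C}.
Variables (H : set U) (ip : U -> U -> C) (D : set U) (T : U -> U).
Hypothesis ip_ge0 : forall f, H f -> 0 <= ip f f.
Hypothesis ip_eq0 : forall f, H f -> ip f f = 0 -> f = 0.
Hypothesis ipZ : forall (c : C) f, H f -> ip (c *: f) (c *: f) = `|c| ^+ 2 * ip f f.

Lemma ip_norm_gt0 f : H f -> f != 0 -> 0 < ip_norm ip f.
Proof.
move=> Hf f0; rewrite /ip_norm sqrtC_gt0 lt_def ip_ge0 // andbT.
by apply: contra_neq f0 => /ip_eq0 ->.
Qed.

Lemma ip_normZ (c : C) f : H f -> ip_norm ip (c *: f) = `|c| * ip_norm ip f.
Proof.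
move=> Hf; rewrite /ip_norm ipZ // rootCMl ?exprn_ge0 //.
by rewrite sqrCK.
Qed.

(** A resolvent bound [M] at [l0], applied to the eigenvectors, would give [1 <= M |l n - l0|] for
    all [n], which fails in the limit. Constant sequences cover the eigenvalues themselves. *)
Lemma spectrum_eigenvalue_limit (f : nat -> U) (l : nat -> C) (l0 : C) :
  D `<=` H -> (forall n, [/\ D (f n), f n != 0 & T (f n) = l n *: f n]) ->
  l @ \oo --> l0 -> spectrum H ip D T l0.
Proof.
move=> DH hf ll0 [_ [M hM]].
have h n : 1 <= M * `|l n - l0|.
  have [Df f0 Tf] := hf n; have Hf := DH _ Df.
  have := hM _ Df; rewrite Tf -scalerBl ip_normZ // mulrA.
  by rewrite -[X in X <= _]mul1r ler_pM2r // ip_norm_gt0.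
have := seq_cvg_le h (seq_cvg_cst _) (seq_cvgZ M (seq_cvg_norm (seq_cvgB ll0 (seq_cvg_cst l0)))).
by rewrite subrr normr0 mulr0 ler10.
Qed.

End SpectralTheory.

(** * Self-adjoint operators diagonalized by a transform that is unitary up to a scalar *)

Section DiagonalOperator.
Context {C : numClosedFieldType} (cplC : sum_complete C) {U : lmodType C}.
Variables (H : set U) (ip : U -> U -> C) (D : set U) (T : U -> U).
Hypothesis saT : self_adjoint H ip D T.
Hypothesis H_lin : forall (c : C) f g, H f -> H g -> H (c *: f + g).
Variables (K : U -> nat -> C) (V lam : nat -> C) (kappa : C).
Hypotheses (V0 : forall m, 0 < V m) (kappa0 : 0 < kappa).
Hypothesis lam_real : forall m, (lam m)^* = lam m.
Hypothesis K_l2 : forall f, H f -> l2 V (K f).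
Hypothesis K_ip : forall f g, H f -> H g -> wip V (K f) (K g) = kappa * ip f g.
Hypothesis K_surj : forall s, l2 V s -> exists2 f, H f & forall m, K f m = s m.
Hypothesis K_inj : forall f g, H f -> H g -> (forall m, K f m = K g m) -> f = g.
Hypothesis K_lin : forall (c : C) f g m, H f -> H g ->
  K (c *: f + g) m = c * K f m + K g m.
Hypothesis K_T : forall f m, D f -> K (T f) m = lam m * K f m.

Let DH : D `<=` H. Proof. by case: saT => _ []. Qed.
Let TH f : D f -> H (T f). Proof. by move=> Df; case: saT => -[_ _ h _] _ _; apply: h. Qed.

Let KB f l m : D f -> K (T f - l *: f) m = (lam m - l) * K f m.
Proof.
move=> Df; rewrite addrC -scaleNr K_lin ?K_T //; [ring|exact: DH|exact: TH].
Qed.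

(** On the transform side the resolvent is division by [lam m - l], which is bounded; the remaining
    issue is that the function so obtained lies in the domain. *)
Lemma resolvent_set_diag (l M : C) : (forall m, lam m != l) ->
  (forall m, `|(lam m - l)^-1| <= M) -> resolvent_set H ip D T l.
Proof.
move=> ll hM; have M0 : 0 <= M by rewrite (le_trans _ (hM 0%N)).
have lm m : lam m - l != 0 by rewrite subr_eq0.
have HB f : D f -> H (T f - l *: f).
  by move=> Df; rewrite addrC -scaleNr; apply: H_lin; [exact: DH|exact: TH].
split=> [g Hg|].
  have ls : l2 V (fun m => (lam m - l)^-1 * K g m).
    apply: (@asum_leZ _ (M ^+ 2) _ _ _ (K_l2 Hg)) => m.
    rewrite [`|_ * K g m|]normrM exprMn -mulrA [leLHS]normrM ler_wpM2r //.
    by rewrite ger0_norm ?exprn_ge0 // lerXn2r ?nnegrE.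
  have [f Hf Kf] := K_surj ls.
  (* Surjectivity only puts [f] in [H]. Parseval shows that [f] and [l *: f + g] satisfy the adjoint
     relation, and self-adjointness turns this into [D f] and the value of [T f]. *)
  have [Df /esym Tf] : op_graph D T (f, l *: f + g).
    case: saT => _ _ <-; split => [||h Dh] //=; first exact: H_lin.
    have [Hlf Hh HTh] := And3 (H_lin l Hf Hg) (DH Dh) (TH Dh).
    apply: (mulfI (lt0r_neq0 kappa0)); rewrite -!K_ip //.
    congr csum; apply/funext => m; rewrite K_lin // K_T //.
    have -> : K g m = (lam m - l) * K f m by rewrite Kf mulVKf.
    by rewrite -mulrDl subrKC rmorphM /= lam_real; ring.
  exists f; split=> [|f' [Df' Tf']]; first by rewrite Tf addrC addKr.
  apply: K_inj => // [|m]; first exact: DH.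
  by rewrite Kf -Tf' KB // mulKf.
exists M => f Df; have [Hf Hg] := (DH Df, HB f Df).
(* The transform of [f] is that of [T f - l *: f] divided by [lam m - l], so the bound [M] is
   inherited through Parseval. *)
have h : ip f f <= M ^+ 2 * ip (T f - l *: f) (T f - l *: f).
  rewrite -(ler_pM2l kappa0) mulrCA -!K_ip // !wip_selfE -(csumZ cplC); last exact: K_l2 Hg.
  apply: (csum_le cplC) => [m||]; [|exact: K_l2 Hf|exact: asumZ (K_l2 Hg)].
  rewrite KB // mulrA ler_wpM2r ?(ltW (V0 m)) // -{1}(mulKf (lm m) (K f m)).
  by rewrite normrM exprMn ler_wpM2r ?exprn_ge0 // lerXn2r ?nnegrE.
have ipp k : H k -> 0 <= ip k k.
  by move=> Hk; rewrite -(pmulr_rge0 _ kappa0) -K_ip // (wip_ge0 cplC) //; apply: K_l2.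
rewrite /ip_norm -{1}(sqrCK M0) -rootCMl ?exprn_ge0 //.
by rewrite ler_sqrtC // qualifE /= ?mulr_ge0 ?exprn_ge0 // ipp.
Qed.

Lemma diag_transform0 m : K 0 m = 0.
Proof.
have H0 : H 0 by apply: DH; case: saT => -[].
by have := K_lin (-1) m H0 H0; rewrite scaler0 addr0 mulN1r addNr.
Qed.

Lemma eigenvalue_diag l f m : D f -> T f = l *: f -> lam m != l -> K f m = 0.
Proof.
move=> Df Tf ml; have := KB l m Df; rewrite Tf subrr diag_transform0 => /esym/eqP.
by rewrite mulf_eq0 subr_eq0 (negbTE ml) => /eqP.
Qed.

Lemma point_spectrum_diag l : point_spectrum D T l -> exists m, lam m = l.
Proof.
move=> [f [Df Tf] f0]; apply/not_existsP => hl; move/eqP: f0; apply.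
apply: K_inj => [|| m]; [exact: DH|by apply: DH; case: saT => -[]|].
by rewrite diag_transform0 (eigenvalue_diag Df Tf) //; apply/eqP/hl.
Qed.

(** Injectivity of [lam] confines the transform of an eigenvector for [lam m] to the single index
    [m]. *)
Lemma eigenspace_diag f m : injective lam -> D f -> f != 0 -> T f = lam m *: f ->
  op_eigenspace D T (lam m) = [set c *: f | c in [set: C]].
Proof.
move=> lam_inj Df f0 Tf; have H0 : H 0 by apply: DH; case: saT => -[].
have D0 : D 0 by case: saT => -[].
have [DZ TZ] : (forall c, D (c *: f)) /\ (forall c : C, T (c *: f) = c *: T f).
  case: saT => -[_ Dl _ Tl] _ _; split=> c.
    by rewrite -[_ *: _]addr0; apply: Dl.
  rewrite -[c *: f]addr0 Tl //; have := Tl (-1) 0 0 D0 D0.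
  by rewrite scaler0 addr0 scaleN1r addNr => ->; rewrite addr0.
have off g m' : D g -> T g = lam m *: g -> m' != m -> K g m' = 0.
  by move=> Dg Tg mm'; apply: (eigenvalue_diag Dg Tg); rewrite (inj_eq lam_inj).
have Kfm : K f m != 0.
  apply: contra_neq f0 => Kfm; apply: K_inj => // [|m']; first exact: DH.
  by rewrite diag_transform0; have [->//|mm'] := eqVneq m' m; apply: off.
apply/seteqP; split=> [g [Dg Tg]|_ [c _ <-]]; last first.
  by split=> //; rewrite TZ Tf !scalerA mulrC.
exists (K g m / K f m) => //; apply: K_inj => [||m']; [exact/DH/DZ|exact: DH|].
rewrite -[_ *: _]addr0 K_lin ?diag_transform0 ?addr0 //; last exact: DH.
have [->|mm'] := eqVneq m' m; first by rewrite divfK.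
by rewrite (off f m') // (off g m') // mulr0.
Qed.

End DiagonalOperator.

(** * q-series, the grid and the weight *)

Section QSeries.
Context {C : numClosedFieldType} (cplC : sum_complete C).
Variables (q : C) (hq : 0 < q < 1).
Implicit Types (x y z : C).

Let q0 : 0 < q. Proof. by case/andP: hq. Qed.
Let q1 : q < 1. Proof. by case/andP: hq. Qed.
Let qn0 : q != 0. Proof. exact: lt0r_neq0. Qed.

Lemma qexp_cvg0 : (fun n => q ^+ n) @ \oo --> (0 : C).
Proof. by apply: (asum_cvg0 cplC); apply: asum_geometric; rewrite ltW. Qed.

Lemma qexp_lt1 n : q ^+ n.+1 < 1.
Proof. by rewrite exprn_ilt1 // ltW. Qed.

Lemma one_sub_qexp_neq0 n : 1 - q ^+ n.+1 != 0.
Proof. by rewrite lt0r_neq0 // subr_gt0 qexp_lt1. Qed.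

Lemma qpochS x n : qpoch x q n.+1 = qpoch x q n * (1 - x * q ^+ n).
Proof. by rewrite /qpoch big_ord_recr. Qed.

Lemma qpoch0 x : qpoch x q 0 = 1.
Proof. by rewrite /qpoch big_ord0. Qed.

Lemma qpoch_neq0 x n : (forall k, 1 - x * q ^+ k != 0) -> qpoch x q n != 0.
Proof. by move=> h; apply/prodf_neq0 => k _; apply: h. Qed.

Lemma qpochq_neq0 n : qpoch q q n != 0.
Proof. by apply: qpoch_neq0 => k; rewrite -exprS one_sub_qexp_neq0. Qed.

Lemma one_sub_qexp_cvg : (fun n => (1 - q ^+ n.+1)^-1) @ \oo --> (1 : C).
Proof.
rewrite -[X in _ --> X]invr1; apply: seq_cvgV; first exact: oner_neq0.
rewrite -[X in _ --> X]subr0; apply: seq_cvgB; first exact: seq_cvg_cst.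
apply: (seq_cvg_ext _ ((seq_cvg_shift 1 _ _).2 qexp_cvg0)) => n.
by rewrite addn1.
Qed.

(** Coefficients of Euler's expansion of [(y; q)_oo] in powers of [y]. *)
Definition euler_coef n : C := (-1) ^+ n * q ^+ 'C(n, 2) / qpoch q q n.

Definition qprod y : C := csum (fun n => euler_coef n * y ^+ n).

(** Euler's companion series, the expansion of [1 / (y; q)_oo] for [|y| < 1]. *)
Definition qprodV y : C := csum (fun n => (qpoch q q n)^-1 * y ^+ n).

Lemma euler_coefS n : (1 - q ^+ n.+1) * euler_coef n.+1 = - q ^+ n * euler_coef n.
Proof.
rewrite /euler_coef qpochS -exprS binS bin1 [(-1) ^+ _.+1]exprS exprD.
have := qpochq_neq0 n; have := one_sub_qexp_neq0 n.
move: (qpoch q q n) (q ^+ n.+1) => p Q h1 h2.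
rewrite mulrC [p * _]mulrC invfM -mulrA [_^-1 * _]mulrC -!mulrA mulVf // mulr1.
by rewrite !mulN1r; ring.
Qed.

Lemma euler_ratio y n : euler_coef n.+1 * y ^+ n.+1 =
  (- (q ^+ n * y * (1 - q ^+ n.+1)^-1)) * (euler_coef n * y ^+ n).
Proof.
apply: (mulfI (one_sub_qexp_neq0 n)); rewrite mulrA euler_coefS [y ^+ _.+1]exprS.
by have := one_sub_qexp_neq0 n => h; field.
Qed.

Lemma asum_euler y : asum (fun n => euler_coef n * y ^+ n).
Proof.
apply: (asum_ratio (euler_ratio y) _ (l := 0)); last by rewrite normr0.
rewrite -[X in _ --> X]oppr0 -[X in - X](mul0r 1) -(mul0r y).
rewrite -mulN1r; under eq_fun do rewrite -mulN1r.
apply: seq_cvgZ; apply: seq_cvgM one_sub_qexp_cvg.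
exact: seq_cvgM qexp_cvg0 (seq_cvg_cst _).
Qed.

(** Subtracting the series at [q * y] multiplies the [n]-th coefficient by [1 - q^n], which
    [euler_coefS] turns into a shift of the index. *)
Lemma qprod_rec y : qprod y = (1 - y) * qprod (q * y).
Proof.
suff h : qprod y - qprod (q * y) = - y * qprod (q * y).
  by rewrite -[LHS](subrK (qprod (q * y))) h; ring.
have [s1 s2] := (asum_euler y, asum_euler (q * y)).
rewrite /qprod -(csumB cplC s1 s2) (csumS cplC (asumB s1 s2)) -(csumZ cplC _ s2).
rewrite !expr0 subrr add0r; congr csum; apply/funext => n.
have -> : euler_coef n.+1 * y ^+ n.+1 - euler_coef n.+1 * (q * y) ^+ n.+1 =
  (1 - q ^+ n.+1) * euler_coef n.+1 * y ^+ n.+1 by rewrite exprMn; ring.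
by rewrite euler_coefS exprS exprMn; ring.
Qed.

Lemma qprod_iter y n : qprod y = qpoch y q n * qprod (q ^+ n * y).
Proof.
elim: n => [|n ih]; first by rewrite qpoch0 expr0 !mul1r.
by rewrite ih qprod_rec qpochS mulrA exprS -!mulrA [y * _]mulrC.
Qed.

Lemma csum_expr0 (c : nat -> C) : csum (fun n => c n * 0 ^+ n) = c 0%N.
Proof.
by rewrite (@csum1 _ _ 0) ?expr0 ?mulr1 // => n n0; rewrite expr0n (negbTE n0) mulr0.
Qed.

Lemma seq_cvgX (u : nat -> C) (l : C) k : u @ \oo --> l ->
  (fun n => u n ^+ k) @ \oo --> l ^+ k.
Proof.
move=> ul; elim: k => [|k ih].
  by rewrite expr0; apply: (seq_cvg_ext _ (seq_cvg_cst 1)) => n; rewrite expr0.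
rewrite exprS; apply: (seq_cvg_ext _ (seq_cvgM ul ih)) => n; by rewrite exprS.
Qed.

Lemma qprod_cvg1 (y : nat -> C) : y @ \oo --> (0 : C) -> (fun n => qprod (y n)) @ \oo --> (1 : C).
Proof.
move=> y0; have [B hB] := seq_cvg_bounded y0.
have -> : 1 = csum (fun n => euler_coef n * 0 ^+ n) :> C.
  by rewrite csum_expr0 /euler_coef bin0n !expr0 qpoch0 invr1 !mulr1.
apply: (csum_dominated cplC (asum_norm (asum_euler B))) => [N k|k].
  rewrite !normrM ler_wpM2l // !normrX lerXn2r ?nnegrE // (le_trans (hB N)) //.
  by rewrite real_ler_norm // ger0_real // (le_trans _ (hB N)).
by apply: seq_cvgZ; apply: seq_cvgX.
Qed.

Lemma qexpM_cvg0 x : (fun n => q ^+ n * x) @ \oo --> (0 : C).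
Proof. by rewrite -[X in _ --> X](mul0r x); apply: seq_cvgM qexp_cvg0 (seq_cvg_cst _). Qed.

Lemma cvg_of_mul (u v : nat -> C) (c : C) : (forall n, u n * v n = c) ->
  v @ \oo --> (1 : C) -> u @ \oo --> c.
Proof.
move=> uv v1; have [|N hN] := (seq_cvgP _ _).1 v1 (1 / 2); first by rewrite divr_gt0.
have vn0 n : (N <= n)%N -> v n != 0.
  move=> /hN; apply: contraTneq => ->; rewrite subr0 normr1.
  by rewrite lt_geF // ltr_pdivrMr // mul1r ltr1n.
apply: (@seq_cvg_near _ (fun n => c * (v n)^-1) _ _ N).
  by move=> n /vn0 h; rewrite -(uv n) mulfK.
rewrite -[X in _ --> X]mulr1 -[X in _ * X]invr1.
by apply: seq_cvgZ; apply: seq_cvgV => //; apply: oner_neq0.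
Qed.

(** Iterating the functional equation leaves the cofactor [qprod (q^n x)], which tends to 1; no
    theory of infinite products enters. *)
Lemma qpoch_cvg x : qpoch x q @ \oo --> qprod x.
Proof.
apply: (@cvg_of_mul _ (fun n => qprod (q ^+ n * x))) => [n|]; first by rewrite -qprod_iter.
exact/qprod_cvg1/qexpM_cvg0.
Qed.

Lemma qpoch_infE x : qpoch_inf x q = qprod x.
Proof. exact: seq_limE (@qpoch_cvg x). Qed.

Lemma asum_qprodV y : `|y| < 1 -> asum (fun n => (qpoch q q n)^-1 * y ^+ n).
Proof.
move=> y1; apply: (@asum_ratio _ _ (fun n => y * (1 - q ^+ n.+1)^-1) y) => // [n|].
  by rewrite qpochS -exprS [y ^+ _.+1]exprS invfM; ring.
by rewrite -[X in _ --> X]mulr1; apply: seq_cvgZ one_sub_qexp_cvg.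
Qed.

Lemma normqM_lt1 y : `|y| < 1 -> `|q * y| < 1.
Proof.
move=> y1; rewrite normrM gtr0_norm // (le_lt_trans _ y1) //.
by rewrite ler_piMl // ltW.
Qed.

Lemma normqXM_lt1 y n : `|y| < 1 -> `|q ^+ n * y| < 1.
Proof.
by move=> y1; elim: n => [|n ih]; rewrite ?expr0 ?mul1r // exprS -mulrA normqM_lt1.
Qed.

Lemma qprodV_rec y : `|y| < 1 -> (1 - y) * qprodV y = qprodV (q * y).
Proof.
move=> y1; have qy1 := normqM_lt1 y1.
apply/eqP; rewrite mulrBl mul1r subr_eq addrC -subr_eq; apply/eqP.
have [s1 s2] := (asum_qprodV y1, asum_qprodV qy1).
rewrite /qprodV -(csumB cplC s1 s2) (csumS cplC (asumB s1 s2)).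
rewrite !expr0 subrr add0r -(csumZ cplC _ s1); congr csum; apply/funext => n.
rewrite qpochS -exprS exprMn invfM.
have := one_sub_qexp_neq0 n; have := qpochq_neq0 n.
by move: (qpoch q q n) => p h1 h2; rewrite [y ^+ n.+1]exprS; field; rewrite h1 h2.
Qed.

Lemma qprodV_iter y n : `|y| < 1 -> qpoch y q n * qprodV y = qprodV (q ^+ n * y).
Proof.
move=> y1; elim: n => [|n ih]; first by rewrite qpoch0 expr0 !mul1r.
rewrite qpochS mulrAC ih mulrC [y * _]mulrC qprodV_rec ?normqXM_lt1 //.
by rewrite mulrA -exprS.
Qed.

(** As [(y; q)_n] times [qprodV y] equals [qprodV (q^n y)], the product is the limit
    [qprodV 0 = 1]. *)
Lemma qprodVK y : `|y| < 1 -> qprod y * qprodV y = 1.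
Proof.
move=> y1; apply: (@seq_cvg_unique _ (fun n => qpoch y q n * qprodV y)).
  exact: seq_cvgM (@qpoch_cvg y) (seq_cvg_cst _).
have -> : 1 = csum (fun n => (qpoch q q n)^-1 * 0 ^+ n) :> C.
  by rewrite csum_expr0 qpoch0 invr1.
apply: (seq_cvg_ext (u := fun n => qprodV (q ^+ n * y))) => [n|].
  by rewrite qprodV_iter.
have ny : `| `|y| | < 1 by rewrite normr_id.
apply: (csum_dominated cplC (asum_norm (asum_qprodV ny))) => [N k|k].
  rewrite !normrM ler_wpM2l // !normrX normr_id lerXn2r ?nnegrE // normrM.
  by rewrite ler_piMl // normrX gtr0_norm // exprn_ile1 // ltW.
by apply: seq_cvgZ; apply: seq_cvgX; apply: qexpM_cvg0.
Qed.

Lemma qprod_neq0_lt1 y : `|y| < 1 -> qprod y != 0.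
Proof.
move=> y1; apply/eqP => h; have := qprodVK y1; rewrite h mul0r => /esym/eqP.
exact/negP/oner_neq0.
Qed.

(** Finitely many factors, nonzero by hypothesis, are split off until the argument has norm below 1,
    where [qprodV] is an inverse. *)
Lemma qprod_neq0 y : (forall k, 1 - y * q ^+ k != 0) -> qprod y != 0.
Proof.
move=> h; have [|N hN] := (seq_cvgP _ _).1 (@qexpM_cvg0 y) (1 / 2).
  by rewrite divr_gt0.
rewrite (qprod_iter y N) mulf_neq0 ?qpoch_neq0 // qprod_neq0_lt1 //.
have := hN N (leqnn N); rewrite sub0r normrN => /le_lt_trans; apply.
by rewrite ltr_pdivrMr // mul1r ltr1n.
Qed.

(** The factor of index [n] is zero. These zeros are the cancellation behind the growth estimate. *)
Lemma qprod_qexpV n : qprod (q ^- n) = 0.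
Proof.
rewrite (qprod_iter _ n.+1) qpochS mulVf ?subrr ?mulr0 ?mul0r //.
by rewrite expf_neq0.
Qed.

End QSeries.

(** * The grid, its dual and the weight *)

Section Grid.
Context {C : numClosedFieldType} (cplC : sum_complete C).
Implicit Types (q t a b x : C).

(* [(1 + a x) (1 + b x) > 0] on the grid is what the four cases of [parameters]
   have in common; unlike them it is visibly stable under [t -> 1 / (a b t)]. *)
Definition good_parameters q t a b : Prop :=
  [/\ 0 < q < 1, 0 < t, 0 < a * b, (a + b)^* = a + b
    & forall x, grid q t x -> 0 < (1 + a * x) * (1 + b * x)].

(* The three branches [-q^k], [t q^k], [t q^(-k-1)] interleaved. *)
Definition gpt q t (n : nat) : C :=
  let k := (n %/ 3)%N in
  match (n %% 3)%N with
  | 0 => - q ^+ k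
  | 1 => t * q ^+ k
  | _ => t / q ^+ k.+1
  end.

Lemma gpt_mul3 q t k : gpt q t (3 * k)%N = - q ^+ k.
Proof. by rewrite /gpt modnMr mulKn. Qed.

Lemma gpt_mul3S q t k : gpt q t (3 * k).+1 = t * q ^+ k.
Proof. by rewrite /gpt mulnC -addn1 modnMDl divnMDl // addn0. Qed.

Lemma gpt_mul3SS q t k : gpt q t (3 * k).+2 = t / q ^+ k.+1.
Proof. by rewrite /gpt mulnC -addn2 modnMDl divnMDl // addn0. Qed.

Definition gptE := (gpt_mul3, gpt_mul3S, gpt_mul3SS).

Lemma mul3_ind (P : nat -> Prop) : (forall k, P (3 * k)%N) ->
  (forall k, P (3 * k).+1) -> (forall k, P (3 * k).+2) -> forall n, P n.
Proof.
move=> h0 h1 h2 n; rewrite (divn_eq n 3) mulnC.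
have := @ltn_pmod n 3 isT.
by case: (n %% 3)%N => [|[|[|//]]] _; rewrite ?addn0 ?addn1 ?addn2.
Qed.

Lemma grid_gpt q t x : grid q t x <-> exists n, gpt q t n = x.
Proof.
split=> [[[k _ <-]|[[k|k] _ <-]]|[n <-]].
- by exists (3 * k)%N; rewrite gptE.
- by exists (3 * k).+1; rewrite gptE.
- by exists (3 * k).+2; rewrite gptE NegzE -exprnN.
elim/mul3_ind: n => k; rewrite gptE; first by left; exists k.
  by right; exists (Posz k).
by right; exists (Negz k) => //; rewrite NegzE -exprnN.
Qed.

Lemma gpt_gridP q t n : grid q t (gpt q t n).
Proof. by apply/grid_gpt; exists n. Qed.

Variables (q t a b : C).
Hypothesis good : good_parameters q t a b.

Lemma good_q : 0 < q < 1. Proof. by case: good. Qed.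
Lemma good_q_gt0 : 0 < q. Proof. by case/andP: good_q. Qed.
Lemma good_q_lt1 : q < 1. Proof. by case/andP: good_q. Qed.
Lemma good_t_gt0 : 0 < t. Proof. by case: good. Qed.
Lemma good_ab_gt0 : 0 < a * b. Proof. by case: good. Qed.
Lemma good_q_neq0 : q != 0. Proof. by rewrite lt0r_neq0 // good_q_gt0. Qed.
Lemma good_t_neq0 : t != 0. Proof. by rewrite lt0r_neq0 // good_t_gt0. Qed.
Lemma good_qX_gt0 n : 0 < q ^+ n. Proof. by rewrite exprn_gt0 // good_q_gt0. Qed.

Lemma qX_inj : injective (fun k => q ^+ k).
Proof.
have h m n : q ^+ (m + n.+1) != q ^+ m.
  rewrite exprD -[X in _ != X]mulr1 (inj_eq (mulfI (lt0r_neq0 (good_qX_gt0 m)))).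
  by rewrite lt_eqF // exprn_ilt1 ?good_q_lt1 // ltW // good_q_gt0.
move=> m n /= e; case: (ltngtP m n) => // l.
  by have := h m (n - m).-1; rewrite prednK ?subn_gt0 // subnKC ?(ltnW l) // e eqxx.
by have := h n (m - n).-1; rewrite prednK ?subn_gt0 // subnKC ?(ltnW l) // e eqxx.
Qed.

Lemma gpt_inj : injective (gpt q t).
Proof.
have neg k : - q ^+ k < 0 by rewrite oppr_lt0 good_qX_gt0.
have pos k : 0 < t * q ^+ k by rewrite mulr_gt0 ?good_t_gt0 ?good_qX_gt0.
have posV k : 0 < t / q ^+ k by rewrite divr_gt0 ?good_t_gt0 ?good_qX_gt0.
(* The two positive branches have exponents [k >= 0] and [-(j + 1) < 0], hence never meet. *)
have mix k j : t * q ^+ k != t / q ^+ j.+1.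
  rewrite (inj_eq (mulfI good_t_neq0)) -[X in X == _]divr1 -[X in _ == X]mul1r
    eqr_div ?oner_neq0 ?lt0r_neq0 ?good_qX_gt0 //.
  by rewrite mul1r -exprD -(expr0 q) (inj_eq qX_inj) addnS.
have no x y : 0 < x -> y < 0 -> x = y -> False.
  by move=> x0 y0 e; have := lt_trans x0 (eq_ind_r (fun z => z < 0) y0 e); rewrite ltxx.
elim/mul3_ind => k; elim/mul3_ind => j; rewrite !gptE => e.
- by move/oppr_inj/qX_inj: e => ->.
- by case: (no _ _ (pos j) (neg k)).
- by case: (no _ _ (posV j.+1) (neg k)).
- by case: (no _ _ (pos k) (neg j)).
- by move/(mulfI good_t_neq0)/qX_inj: e => ->.
- by move/eqP: e; rewrite (negbTE (mix _ _)).
- by case: (no _ _ (posV k.+1) (neg j)).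
- by move/esym/eqP: e; rewrite (negbTE (mix _ _)).
- by move/(mulfI good_t_neq0)/invr_inj/qX_inj: e => -[->].
Qed.

Lemma grid_real x : grid q t x -> x \is Num.real.
Proof.
move=> /grid_gpt[n <-]; elim/mul3_ind: n => k; rewrite gptE.
- by rewrite rpredN ger0_real // ltW // good_qX_gt0.
- by rewrite ger0_real // ltW // mulr_gt0 ?good_t_gt0 ?good_qX_gt0.
- by rewrite ger0_real // ltW // divr_gt0 ?good_t_gt0 ?good_qX_gt0.
Qed.

Lemma grid_neq0 x : grid q t x -> x != 0.
Proof.
move=> /grid_gpt[n <-]; elim/mul3_ind: n => k; rewrite gptE.
- by rewrite oppr_eq0 lt0r_neq0 // good_qX_gt0.
- by rewrite lt0r_neq0 // mulr_gt0 ?good_t_gt0 ?good_qX_gt0.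
- by rewrite lt0r_neq0 // divr_gt0 ?good_t_gt0 ?good_qX_gt0.
Qed.

Lemma grid_mulq x : grid q t x -> grid q t (q * x).
Proof.
move=> [[k _ <-]|[k _ <-]].
  by left; exists k.+1 => //; rewrite exprS mulrN.
by right; exists (k + 1) => //; rewrite expfzDr ?good_q_neq0 // expr1z; ring.
Qed.

Lemma grid_mulqX x n : grid q t x -> grid q t (q ^+ n * x).
Proof.
move=> gx; elim: n => [|n ih]; first by rewrite expr0 mul1r.
by rewrite exprS -mulrA; apply: grid_mulq.
Qed.

(** The negative branch ends at -1, the only grid point whose outer neighbour is missing; there
    [coef_B] vanishes. *)
Lemma grid_divq x : grid q t x -> x = -1 \/ grid q t (x / q).
Proof.
move=> [[[|k] _ <-]|[k _ <-]]; [by left; rewrite expr0|right..].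
  by left; exists k => //; rewrite exprS mulrC mulrN mulKf ?good_q_neq0.
right; exists (k - 1) => //; rewrite expfzDr ?good_q_neq0 // mulrA; congr (_ * _).
Qed.

Lemma grid_1qx x : grid q t x -> 0 < 1 + q * x.
Proof.
move=> [[k _ <-]|[k _ <-]].
  by rewrite mulrN subr_gt0 -exprS exprn_ilt1 ?good_q_lt1 // ltW // good_q_gt0.
by rewrite ltr_wpDr ?ltr01 // !mulr_ge0 ?exprz_ge0 // ltW // ?good_q_gt0 // good_t_gt0.
Qed.

Lemma grid_ab x : grid q t x -> 0 < (1 + a * x) * (1 + b * x).
Proof. by case: good => _ _ _ _ /(_ x). Qed.

Lemma grid_a_neq0 x : grid q t x -> 1 + a * x != 0.
Proof. by move=> /grid_ab /lt0r_neq0; apply: contraNneq => ->; rewrite mul0r. Qed.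

Lemma grid_b_neq0 x : grid q t x -> 1 + b * x != 0.
Proof. by move=> /grid_ab /lt0r_neq0; apply: contraNneq => ->; rewrite mulr0. Qed.

Lemma grid_negq k : grid q t (- q ^+ k). Proof. by left; exists k. Qed.

Lemma good_a_neq0 : a != 0.
Proof. by have := lt0r_neq0 good_ab_gt0; apply: contraNneq => ->; rewrite mul0r. Qed.
Lemma good_b_neq0 : b != 0.
Proof. by have := lt0r_neq0 good_ab_gt0; apply: contraNneq => ->; rewrite mulr0. Qed.

Lemma good_parameters_dual : good_parameters q (a * b * t)^-1 a b.
Proof.
have h := lt0r_neq0; split; [exact: good_q| |exact: good_ab_gt0|by case: good|].
  by rewrite invr_gt0 mulr_gt0 ?good_ab_gt0 ?good_t_gt0.
move=> x [[k _ <-]|[k _ <-]]; first exact/grid_ab/grid_negq.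
have gk : grid q t (t * q ^ (- k)) by right; exists (- k).
have k0 : 0 < q ^ k by rewrite exprz_gt0 // good_q_gt0.
(* [1 + a q^k / (a b t)] is [q^k / (b t)] times [1 + b t q^(-k)], and symmetrically in [a] and [b]:
   the dual point corresponds to the grid point [t q^(-k)]. *)
have -> : (1 + a * ((a * b * t)^-1 * q ^ k)) * (1 + b * ((a * b * t)^-1 * q ^ k)) =
    ((q ^ k) ^+ 2 / (a * b * t ^+ 2)) * ((1 + a * (t * q ^ (- k))) * (1 + b * (t * q ^ (- k)))).
  rewrite -invr_expz; have := lt0r_neq0 k0; move: (q ^ k) => Q Q0; field.
  by rewrite Q0 good_t_neq0 good_a_neq0 good_b_neq0.
apply: mulr_gt0; last exact: grid_ab.
by apply: divr_gt0; rewrite ?exprn_gt0 // mulr_gt0 ?good_ab_gt0 // exprn_gt0 // good_t_gt0.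
Qed.

Lemma weightE x : weight a b q x =
  qprod q (- (q * x)) / (qprod q (- (a * x)) * qprod q (- (b * x))).
Proof. by rewrite /weight !(qpoch_infE cplC good_q). Qed.

(** The Pearson equation: each of the three infinite products loses its first factor when [x]
    becomes [q * x]. *)
Lemma weight_rec x : grid q t x ->
  weight a b q (q * x) * (1 + q * x) = weight a b q x * ((1 + a * x) * (1 + b * x)).
Proof.
move=> gx; rewrite !weightE.
rewrite (qprod_rec cplC good_q (- (q * x))) (qprod_rec cplC good_q (- (a * x))).
rewrite (qprod_rec cplC good_q (- (b * x))) !mulrN !opprK.
rewrite [a * (q * x)]mulrCA [b * (q * x)]mulrCA.
have := grid_a_neq0 gx; have := grid_b_neq0 gx.
move: (1 + a * x) (1 + b * x) => u v v0 u0.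
have key (G s P Q : C) : G / (P * Q) * s = s * G / (u * P * (v * Q)) * (u * v).
  by rewrite (mulrACA u) (invfM (u * v)); move: (P * Q)^-1 => Z; field; rewrite ?u0 ?v0.
exact: key.
Qed.

Lemma weight_cvg1 (x : nat -> C) : x @ \oo --> (0 : C) ->
  (fun n => weight a b q (x n)) @ \oo --> (1 : C).
Proof.
move=> x0; have h c : (fun n => qprod q (- (c * x n))) @ \oo --> (1 : C).
  apply: (qprod_cvg1 cplC good_q); rewrite -[X in _ --> X]oppr0 -(mulr0 c) -mulNr.
  by apply: (seq_cvg_ext _ (seq_cvgZ (- c) x0)) => n; rewrite mulNr.
rewrite -[X in _ --> X]mulr1 -[X in _ * X]invr1 -[X in _ / X]mulr1.
apply: (seq_cvg_ext (u := fun n => qprod q (- (q * x n)) *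
  (qprod q (- (a * x n)) * qprod q (- (b * x n)))^-1)).
  by move=> n; rewrite weightE.
apply: seq_cvgM (h _) _; apply: seq_cvgV; first by rewrite mulr1 oner_neq0.
exact: seq_cvgM (h _) (h _).
Qed.

Lemma qprod_grid_neq0 (c : C) x : (forall y, grid q t y -> 1 + c * y != 0) ->
  grid q t x -> qprod q (- (c * x)) != 0.
Proof.
move=> h gx; apply: (qprod_neq0 cplC good_q) => k.
by rewrite mulNr opprK -mulrA [x * _]mulrC h //; apply: grid_mulqX.
Qed.

(** Positivity cannot be read off factor by factor when [a] and [b] are complex conjugates.
    Iterating the Pearson equation writes the weight as a limit of finite products of positive
    ratios, since it tends to 1 at 0; it is also nonzero. *)
Lemma weight_gt0 x : grid q t x -> 0 < weight a b q x.
Proof.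
move=> gx; rewrite lt_def; apply/andP; split.
  rewrite weightE mulf_neq0 ?invr_eq0 ?mulf_neq0 //; apply: qprod_grid_neq0 => // y gy.
  - by rewrite lt0r_neq0 // grid_1qx.
  - exact: grid_a_neq0.
  - exact: grid_b_neq0.
pose r n := \prod_(k < n) ((1 + q * (q ^+ k * x)) /
  ((1 + a * (q ^+ k * x)) * (1 + b * (q ^+ k * x)))).
have rE n : r n * weight a b q (q ^+ n * x) = weight a b q x.
  elim: n => [|n ih]; first by rewrite /r big_ord0 expr0 !mul1r.
  have gn := grid_mulqX n gx; have hn := lt0r_neq0 (grid_ab gn).
  rewrite -ih /r big_ord_recr /= -mulrA; congr (_ * _).
  have := weight_rec gn; rewrite mulrA -exprS.
  move: (weight a b q (q ^+ n.+1 * x)) (weight a b q (q ^+ n * x)) hn => U V.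
  move: (_ * _) => p p0 e; apply: (mulIf p0); rewrite -e; move: (1 + _) => s.
  by rewrite mulrAC divfK // mulrC.
apply: (@seq_cvg_ge0 _ r).
  move=> n; apply: prodr_ge0 => k _; have gk := grid_mulqX k gx.
  by rewrite ltW // divr_gt0 ?grid_1qx ?grid_ab.
exact/(cvg_of_mul rE)/weight_cvg1/(qexpM_cvg0 cplC good_q).
Qed.

End Grid.

(** * The difference operator *)

Section Operator.
Context {C : numClosedFieldType} (cplC : sum_complete C).
Variables (q t a b : C).
Hypothesis good : good_parameters q t a b.
Implicit Types (x c : C) (F G : C -> C).

Let q0 : 0 < q := good_q_gt0 good.
Let q1 : q < 1 := good_q_lt1 good.
Let t0 : 0 < t := good_t_gt0 good.
Let qn0 : q != 0 := good_q_neq0 good.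

Lemma one_sub_q_gt0 : 0 < 1 - q. Proof. by rewrite subr_gt0. Qed.
Let omqn0 : 1 - q != 0. Proof. by rewrite lt0r_neq0 // one_sub_q_gt0. Qed.

(** Mass of the point [x] for the weighted Jackson integral; the absolute value occurs because
    [- q^k] is counted with the factor [+ q^k]. *)
Definition msr x : C := (1 - q) * `|x| * weight a b q x.

(** The operator acting on functions on all of [C], so that evaluating at a neighbour requires no
    membership proof. *)
Definition qop F x : C :=
  coef_A a b x * (F (q * x) - F x) + coef_B q x * (F (x / q) - F x).

Lemma msr_gt0 x : grid q t x -> 0 < msr x.
Proof.
move=> gx; apply: mulr_gt0; last exact: (weight_gt0 cplC good gx).
by rewrite mulr_gt0 ?one_sub_q_gt0 // normr_gt0 (grid_neq0 good gx).
Qed.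

Lemma coef_AE x : x != 0 -> coef_A a b x = (1 + a * x) * (1 + b * x) / x ^+ 2.
Proof. by move=> x0; rewrite /coef_A; field; rewrite x0. Qed.

Lemma coef_A_gt0 x : grid q t x -> 0 < coef_A a b x.
Proof.
move=> gx; have xn0 := grid_neq0 good gx; rewrite coef_AE // divr_gt0 ?(grid_ab good) //.
by rewrite lt_def sqrf_eq0 xn0 real_exprn_even_ge0 // (grid_real good gx).
Qed.

Lemma coef_B_m1 : coef_B q (-1) = 0.
Proof. by rewrite /coef_B invrN1 addrN mulr0. Qed.

Lemma coef_B_real x : grid q t x -> (coef_B q x)^* = coef_B q x.
Proof.
move=> gx; apply: CrealP; rewrite rpredM ?rpredD ?rpredV ?rpred1 ?(grid_real good gx) //.
by rewrite rpred_div // ?(grid_real good gx) // ger0_real // ltW.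
Qed.

Lemma coef_A_real x : grid q t x -> (coef_A a b x)^* = coef_A a b x.
Proof. by move=> gx; apply: CrealP; apply: gtr0_real; apply: coef_A_gt0. Qed.

(** Detailed balance: weighted by the masses, the two coefficients linking [x] and [q * x] agree,
    which is the formal symmetry of the operator. It restates the Pearson equation. *)
Lemma msr_balance x : grid q t x ->
  msr (q * x) * coef_B q (q * x) = msr x * coef_A a b x.
Proof.
move=> gx; have xn0 := grid_neq0 good gx; rewrite coef_AE // /msr /coef_B.
rewrite normrM (gtr0_norm q0); have := weight_rec cplC good gx.
move: (weight a b q (q * x)) (weight a b q x) ((1 + a * x) * (1 + b * x)) => u v p e.
transitivity ((1 - q) * `|x| * (u * (1 + q * x)) / x ^+ 2); last by rewrite e; field.
by field; rewrite xn0.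
Qed.

Lemma Lf_conj F x : grid q t x -> (qop F x)^* =
  coef_A a b x * ((F (q * x))^* - (F x)^*) + coef_B q x * ((F (x / q))^* - (F x)^*).
Proof.
move=> gx; rewrite /qop rmorphD (rmorphM _ (coef_A a b x)) (rmorphM _ (coef_B q x)).
by rewrite !rmorphB /= coef_A_real // coef_B_real.
Qed.

(** The discrete Wronskian attached to the edge between [x] and [q * x]. *)
Definition casorati F G x : C :=
  msr x * coef_A a b x * (F (q * x) * (G x)^* - F x * (G (q * x))^*).

(** The Lagrange identity: balance turns the [coef_B] part at [x] into the [coef_A] part at
    [x / q]. *)
Lemma Lf_casorati F G x : grid q t x -> grid q t (x / q) ->
  (qop F x * (G x)^* - F x * (qop G x)^*) * msr x =
  casorati F G x - casorati F G (x / q).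
Proof.
move=> gx gxq; rewrite /casorati -(msr_balance gxq) [q * (x / q)]mulrC divfK //.
by rewrite Lf_conj // /qop; ring.
Qed.

Lemma Lf_casorati_m1 F G : (qop F (-1) * (G (-1))^* - F (-1) * (qop G (-1))^*) * msr (-1) =
  casorati F G (-1).
Proof.
have gm : grid q t (-1) by left; exists 0%N.
by rewrite Lf_conj // /casorati /qop coef_B_m1; ring.
Qed.

Lemma tqX_grid k : grid q t (t * q ^+ k). Proof. by right; exists (Posz k). Qed.
Lemma tqV_grid k : grid q t (t / q ^+ k.+1).
Proof. by right; exists (Negz k) => //; rewrite NegzE -exprnN. Qed.
Lemma nqX_grid k : grid q t (- q ^+ k). Proof. by left; exists k. Qed.

(** Every branch telescopes. The negative one starts at -1 without a boundary term; the outermost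
    point summed is [t / q^(N + 1)], and its neighbour [t / q^(N + 2)] carries the term at
    infinity. *)
Lemma green_partial F G N :
  \sum_(0 <= n < 3 * N.+1) (qop F (gpt q t n) * (G (gpt q t n))^* -
       F (gpt q t n) * (qop G (gpt q t n))^*) * msr (gpt q t n) =
  casorati F G (- q ^+ N) + casorati F G (t * q ^+ N) - casorati F G (t / q ^+ N.+2).
Proof.
have e1 N' : t / q ^+ N'.+1 / q = t / q ^+ N'.+2.
  by rewrite -mulrA -invfM -exprSr.
have e2 N' : t * q ^+ N'.+1 / q = t * q ^+ N'.
  by rewrite exprSr mulrA mulfK.
have e3 N' : - q ^+ N'.+1 / q = - q ^+ N'.
  by rewrite mulNr exprSr mulfK.
rewrite sum_mul3; elim: N => [|N ih].
  rewrite big_nat1 !gptE !expr0 !mulr1 Lf_casorati_m1.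
  rewrite (@Lf_casorati F G t) //; first last.
  - by have := tqV_grid 0.
  - by have := tqX_grid 0; rewrite mulr1.
  rewrite (@Lf_casorati F G (t / q ^+ 1)) //; first last.
  - by rewrite e1; apply: tqV_grid.
  - exact: tqV_grid.
  by rewrite e1 expr1; ring.
rewrite big_nat_recr //= ih !gptE.
rewrite (@Lf_casorati F G (- q ^+ N.+1)); first last.
- by rewrite e3; apply: nqX_grid.
- exact: nqX_grid.
rewrite (@Lf_casorati F G (t * q ^+ N.+1)); first last.
- by rewrite e2; apply: tqX_grid.
- exact: tqX_grid.
rewrite (@Lf_casorati F G (t / q ^+ N.+2)); first last.
- by rewrite e1; apply: tqV_grid.
- exact: tqV_grid.
by rewrite e1 e2 e3; ring.
Qed.

(** * Limits at 0 along a branch *)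

Section Branch.
Variable c : C.
Hypothesis gc : grid q t c.

Lemma branch_grid k : grid q t (c * q ^+ k).
Proof. by rewrite mulrC; apply: (grid_mulqX good). Qed.

Lemma branchS k : c * q ^+ k.+1 = q * (c * q ^+ k).
Proof. by rewrite exprS mulrCA. Qed.

Lemma branchV k : c * q ^+ k.+1 / q = c * q ^+ k.
Proof. by rewrite exprSr mulrA mulfK. Qed.

Lemma branch_cvg0 : (fun k => c * q ^+ k) @ \oo --> (0 : C).
Proof. by rewrite -[X in _ --> X](mulr0 c); apply: seq_cvgZ (qexp_cvg0 cplC (good_q good)). Qed.

Lemma branch_asum (u : nat -> C) B : (forall k, `|u k| <= B) ->
  asum (fun k => u k * (c * q ^+ k)).
Proof.
move=> uB; apply: asum_bound uB _; apply: asumZ; apply: asum_geometric.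
by rewrite ltW.
Qed.

Lemma branch_weight_cvg : (fun k => weight a b q (c * q ^+ k)) @ \oo --> (1 : C).
Proof. exact/(weight_cvg1 cplC good)/branch_cvg0. Qed.

Lemma branch_msr_asum : asum (fun k => msr (c * q ^+ k)).
Proof.
have [B hB] := seq_cvg_bounded branch_weight_cvg.
apply: (@asum_leZ _ (1 - q) _ _ _ (branch_asum hB)) => k.
rewrite /msr 2!normrM normr_id (gtr0_norm one_sub_q_gt0) -mulrA [`|_ * (c * _)|]normrM.
by rewrite [X in _ * X]mulrC.
Qed.

(** Up to the sign of [c], the factor in front once the differences in the Casorati determinant are
    replaced by q-derivatives. Its limit at 0 does not depend on the branch. *)
Definition branch_scale k : C :=
  (1 - q) ^+ 2 * (weight a b q (c * q ^+ k) * ((1 + a * (c * q ^+ k)) * (1 + b * (c * q ^+ k)))).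

Lemma branch_scale_cvg : branch_scale @ \oo --> ((1 - q) ^+ 2 : C).
Proof.
have h d : (fun k => 1 + d * (c * q ^+ k)) @ \oo --> (1 : C).
  rewrite -[X in _ --> X]addr0 -(mulr0 d).
  by apply: seq_cvgD (seq_cvg_cst 1) _; apply: seq_cvgZ branch_cvg0.
rewrite -[X in _ --> X]mulr1 -[X in _ * X]mulr1 -[X in _ * (_ * X)]mulr1.
by apply: seq_cvgZ; apply: seq_cvgM branch_weight_cvg _; apply: seq_cvgM (h a) (h b).
Qed.

Lemma branch_neq0 : c != 0. Proof. exact: (grid_neq0 good gc). Qed.

(** The sign [|c| / c] distinguishes the two sides of 0 and is what makes their boundary terms
    cancel. *)
Lemma branch_scaleE k : msr (c * q ^+ k) * coef_A a b (c * q ^+ k) *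
    ((1 - q) * (c * q ^+ k)) = `|c| / c * branch_scale k.
Proof.
have gk := branch_grid k; have xn0 := grid_neq0 good gk.
rewrite coef_AE // /msr normrM (gtr0_norm (good_qX_gt0 good k)) /branch_scale.
move: (weight _ _ _ _) ((1 + a * _) * _) => u v.
by field; rewrite branch_neq0 lt0r_neq0 // (good_qX_gt0 good).
Qed.

Lemma branch_casorati F G k : casorati F G (c * q ^+ k) =
  - (`|c| / c * branch_scale k) *
  (Dq q F (c * q ^+ k) * (G (c * q ^+ k))^* - F (c * q ^+ k) * (Dq q G (c * q ^+ k))^*).
Proof.
have gk := branch_grid k; rewrite -branch_scaleE /casorati.
have xr := CrealP (grid_real good gk); have qr := CrealP (gtr0_real one_sub_q_gt0).
have xn0 := grid_neq0 good gk; move: (c * q ^+ k) xr xn0 => x xr xn0.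
have h H : H (q * x) = H x - (1 - q) * x * Dq q H x.
  by rewrite /Dq; field; rewrite xn0 omqn0.
rewrite (h F) (h G) rmorphB !rmorphM /= xr qr.
by move: (Dq q F x) (Dq q G x)^* => d e; ring.
Qed.

Definition has_limits F := exists f0 f1 : C,
  (fun k => F (c * q ^+ k)) @ \oo --> f0 /\
  (fun k => Dq q F (c * q ^+ k)) @ \oo --> f1.

Lemma casorati_cvg F G (f0 f1 g0 g1 : C) :
  (fun k => F (c * q ^+ k)) @ \oo --> f0 ->
  (fun k => Dq q F (c * q ^+ k)) @ \oo --> f1 ->
  (fun k => G (c * q ^+ k)) @ \oo --> g0 ->
  (fun k => Dq q G (c * q ^+ k)) @ \oo --> g1 ->
  (fun k => casorati F G (c * q ^+ k)) @ \oo -->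
    - (`|c| / c * (1 - q) ^+ 2) * (f1 * g0^* - f0 * g1^*).
Proof.
move=> F0 F1 G0 G1; apply: (seq_cvg_ext (fun k => esym (branch_casorati F G k))).
apply: seq_cvgM; last first.
  by apply: seq_cvgB; [apply: seq_cvgM F1 (seq_cvg_conj G0)|apply: seq_cvgM F0 (seq_cvg_conj G1)].
rewrite -mulNr; apply: (seq_cvg_ext _ (seq_cvgZ (- (`|c| / c)) branch_scale_cvg)) => k.
by rewrite mulNr.
Qed.

Lemma telescope_cvg (y u : nat -> C) : (forall k, y k.+1 = y k - u k) -> asum u ->
  exists l : C, y @ \oo --> l.
Proof.
move=> yu su; exists (y 0%N - csum u).
apply: (seq_cvg_ext _ (seq_cvgB (seq_cvg_cst (y 0%N)) (csum_cvg cplC su))) => k.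
rewrite /series /=; elim: k => [|k ih]; first by rewrite big_nil subr0.
by rewrite yu -ih big_nat_recr //= opprD addrA.
Qed.

(** By balance, [y] drops by [qop F * msr] at each step, which is summable because [qop F] is square
    summable and the total mass near 0 is finite. So [y] converges, hence so does [Dq q F], and then
    [F], whose increments have become geometrically small. *)
Lemma limits_exist F : asum (fun k => `|qop F (c * q ^+ k)| ^+ 2 * msr (c * q ^+ k)) ->
  has_limits F.
Proof.
move=> sL; pose y x := msr x * coef_A a b x * (F x - F (q * x)).
have [l yl] : exists l : C, (fun k => y (c * q ^+ k)) @ \oo --> l.
  apply: (@telescope_cvg _ (fun k => qop F (c * q ^+ k.+1) * msr (c * q ^+ k.+1))) => [k|].
    have gk := branch_grid k; rewrite /y -(msr_balance gk) -(branchS k) /qop.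
    by rewrite branchV; ring.
  have h := asumD branch_msr_asum sL.
  suff : asum (fun k => qop F (c * q ^+ k) * msr (c * q ^+ k)).
    move=> [B hB]; exists B => n; apply: le_trans (hB n.+1).
    by rewrite big_nat_recl //= lerDr.
  apply: asum_le h => k; have m0 := msr_gt0 (branch_grid k).
  rewrite normrM (gtr0_norm m0) -[X in X + _]mul1r -mulrDl ler_wpM2r ?(ltW m0) //.
  by rewrite addrC -[X in X <= _]mulr1 -[X in _ + X](expr1n _ 2) mul_le_sqrD.
have D1 : (fun k => Dq q F (c * q ^+ k)) @ \oo --> l * (`|c| / c * (1 - q) ^+ 2)^-1.
  apply: (@seq_cvg_ext _ (fun k => y (c * q ^+ k) * (`|c| / c * branch_scale k)^-1)).
    move=> k; rewrite -branch_scaleE /y /Dq.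
    have m0 := lt0r_neq0 (msr_gt0 (branch_grid k)).
    have a0 := lt0r_neq0 (coef_A_gt0 (branch_grid k)).
    have xn0 := grid_neq0 good (branch_grid k).
    move: (c * q ^+ k) m0 a0 xn0 => x; move: (msr x) (coef_A a b x) => m A m0 a0 xn0.
    by field; rewrite m0 a0 xn0 omqn0.
  apply: seq_cvgM yl _; apply: seq_cvgV.
    by rewrite !mulf_neq0 ?invr_eq0 ?normr_eq0 ?branch_neq0 ?expf_neq0 ?omqn0.
  exact/seq_cvgZ/branch_scale_cvg.
have [B hB] := seq_cvg_bounded D1.
have [l' Fl] : exists l' : C, (fun k => F (c * q ^+ k)) @ \oo --> l'.
  apply: (@telescope_cvg _ (fun k => (1 - q) * (Dq q F (c * q ^+ k) * (c * q ^+ k)))) => [k|].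
    rewrite branchS /Dq; have xn0 := grid_neq0 good (branch_grid k).
    by move: (c * q ^+ k) xn0 => x xn0; field; rewrite omqn0 xn0.
  exact/asumZ/branch_asum.
by exists l', (l * (`|c| / c * (1 - q) ^+ 2)^-1).
Qed.

End Branch.

Lemma qVt_cvg0 : (fun k => (t / q ^+ k.+1)^-1) @ \oo --> (0 : C).
Proof.
have := (seq_cvg_shift 1 _ _).2 (seq_cvgZ t^-1 (qexp_cvg0 cplC (good_q good))).
by rewrite mulr0; apply: seq_cvg_ext => k; rewrite addn1 invfM invrK.
Qed.

Lemma coef_A_cvg : (fun k => coef_A a b (t / q ^+ k.+1)) @ \oo --> a * b.
Proof.
rewrite -[X in X * _]addr0 -[X in _ * X]addr0.
by apply: seq_cvgM; apply: seq_cvgD (seq_cvg_cst _) qVt_cvg0.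
Qed.

Lemma coef_B_cvg : (fun k => coef_B q (t / q ^+ k.+1)) @ \oo --> (0 : C).
Proof.
rewrite -[X in _ --> X](mul0r (1 + 0)) -[X in X * (_ + _)](mulr0 q).
apply: seq_cvgM; first by apply: seq_cvgZ; apply: qVt_cvg0.
exact: seq_cvgD (seq_cvg_cst _) qVt_cvg0.
Qed.

Definition grid_mass n : C := msr (gpt q t n).

Lemma W_gt0 n : 0 < grid_mass n. Proof. exact/msr_gt0/gpt_gridP. Qed.

Definition inL2 F := l2 grid_mass (fun n => F (gpt q t n)).

Lemma inL2P F : inL2 F <->
  [/\ asum (fun k => `|F (- q ^+ k)| ^+ 2 * msr (- q ^+ k)),
      asum (fun k => `|F (t * q ^+ k)| ^+ 2 * msr (t * q ^+ k)) &
      asum (fun k => `|F (t / q ^+ k.+1)| ^+ 2 * msr (t / q ^+ k.+1))].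
Proof.
split=> [/asum_mul3[h1 h2 h3]|[h1 h2 h3]]; [split|apply/asum_mul3; split].
- by apply: (eq_asum _ h1) => k; rewrite /grid_mass gptE.
- by apply: (eq_asum _ h2) => k; rewrite /grid_mass gptE.
- by apply: (eq_asum _ h3) => k; rewrite /grid_mass gptE.
- by apply: (eq_asum _ h1) => k; rewrite /grid_mass gptE.
- by apply: (eq_asum _ h2) => k; rewrite /grid_mass gptE.
- by apply: (eq_asum _ h3) => k; rewrite /grid_mass gptE.
Qed.

Definition tame F : Prop :=
  [/\ exists B, forall k, `|F (- q ^+ k)| <= B,
      exists B, forall k, `|F (t * q ^+ k)| <= B &
      exists B r, 0 <= r /\ forall k, `|F (t / q ^+ k.+1)| <= B * r ^+ k].

(** By balance the edge carries either one mass times [coef_A], bounded at infinity, or the other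
    mass times [coef_B], which tends to 0. Choosing the expression that fits each square dominates
    the determinant by terms of convergent norms. *)
Lemma casorati_inf_cvg0 F G : inL2 F -> inL2 G ->
  (fun k => casorati F G (t / q ^+ k.+2)) @ \oo --> (0 : C).
Proof.
move=> /inL2P[_ _ /(asum_cvg0 cplC) F0] /inL2P[_ _ /(asum_cvg0 cplC) G0].
pose x k := t / q ^+ k.+1.
have qx k : q * x k.+1 = x k.
  by rewrite /x [q ^+ k.+2]exprS invfM mulrCA mulVKf.
have gx k : grid q t (x k) := tqV_grid k.
pose bnd k := coef_B q (x k) * (`|F (x k)| ^+ 2 * msr (x k) + `|G (x k)| ^+ 2 * msr (x k))
  + coef_A a b (x k.+1) * (`|F (x k.+1)| ^+ 2 * msr (x k.+1)
                           + `|G (x k.+1)| ^+ 2 * msr (x k.+1)).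
have h : bnd @ \oo --> (0 : C).
  have FG0 := seq_cvgD F0 G0; rewrite addr0 in FG0.
  have FG1 := (seq_cvg_shift 1 _ _).2 FG0; have A1 := (seq_cvg_shift 1 _ _).2 coef_A_cvg.
  have := seq_cvgD (seq_cvgM coef_B_cvg FG0) (seq_cvgM A1 FG1).
  by rewrite !mulr0 addr0; apply: seq_cvg_ext => k; rewrite /bnd addn1.
apply: seq_squeeze0 h => k; rewrite -[t / _]/(x k.+1) /casorati.
have p0 : 0 < msr (x k.+1) * coef_A a b (x k.+1) by rewrite mulr_gt0 ?msr_gt0 ?coef_A_gt0.
have pE := msr_balance (gx k.+1); rewrite qx in pE.
rewrite normrM (gtr0_norm p0) qx.
apply: (@le_trans _ _ (msr (x k.+1) * coef_A a b (x k.+1) *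
  (`|F (x k)| ^+ 2 + `|G (x k)| ^+ 2 + (`|F (x k.+1)| ^+ 2 + `|G (x k.+1)| ^+ 2)))).
  rewrite ler_wpM2l ?(ltW p0) //; apply: le_trans (ler_normB _ _) _.
  rewrite !normrM !norm_conjC; apply: (le_trans (lerD (mul_le_sqrD _ _) (mul_le_sqrD _ _))) => //.
  by rewrite le_eqVlt; apply/orP; left; apply/eqP; ring.
rewrite mulrDr -{1}pE /bnd le_eqVlt; apply/orP; left; apply/eqP; ring.
Qed.

(** At infinity the ratio of consecutive masses is a quotient of [coef_B] by [coef_A] and tends to
    0, so the masses absorb any geometric growth; near 0 the total mass is finite. *)
Lemma tame_inL2 F : tame F -> inL2 F.
Proof.
have near (c B : C) : (forall k, `|F (c * q ^+ k)| <= B) ->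
    asum (fun k => `|F (c * q ^+ k)| ^+ 2 * msr (c * q ^+ k)).
  move=> hB.
  apply: (@asum_bound _ _ _ (B ^+ 2) _ (branch_msr_asum c)) => k.
  by rewrite normrX normr_id lerXn2r ?nnegrE // (le_trans _ (hB k)).
move=> [[B1 h1] [B2 h2] [B3 [r [r0 h3]]]]; apply/inL2P; split.
- have := @near (-1) B1; under eq_fun do rewrite mulN1r; apply => k.
  by rewrite mulN1r.
- exact: near h2.
pose x k := t / q ^+ k.+1.
have qx k : q * x k.+1 = x k.
  by rewrite /x [q ^+ k.+2]exprS invfM mulrCA mulVKf.
have gx k : grid q t (x k) := tqV_grid k.
have s : asum (fun k => (r ^+ k) ^+ 2 * msr (x k)).
  apply: (@asum_ratio _ _ (fun k => r ^+ 2 * (coef_B q (x k) * (coef_A a b (x k.+1))^-1)) 0).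
  - move=> k; have := msr_balance (gx k.+1); rewrite qx.
    have := lt0r_neq0 (coef_A_gt0 (gx k.+1)).
    move: (msr (x k.+1)) (coef_A a b (x k.+1)) (msr (x k)) (coef_B q (x k)) => m A n B A0 e.
    move: (r ^+ k) (r ^+ k.+1) (exprS r k) => R _ ->; apply: (mulIf A0).
    transitivity (r ^+ 2 * R ^+ 2 * (m * A)); first by ring.
    by rewrite -e; field; rewrite A0.
  - rewrite -[X in _ --> X](mulr0 (r ^+ 2)); apply: seq_cvgZ.
    rewrite -[X in _ --> X](mul0r (a * b)^-1); apply: seq_cvgM coef_B_cvg _.
    apply: seq_cvgV; first exact: lt0r_neq0 (good_ab_gt0 good).
    have := (seq_cvg_shift 1 _ _).2 coef_A_cvg.
    by apply: seq_cvg_ext => k; rewrite addn1.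
  - by rewrite normr0.
apply: (@asum_leZ _ (B3 ^+ 2) _ _ _ s) => k; have m0 := msr_gt0 (gx k).
rewrite -/(x k) (normrM (`|F (x k)| ^+ 2)) (normrM ((r ^+ k) ^+ 2)) !(gtr0_norm m0).
rewrite (mulrA (B3 ^+ 2)) ler_wpM2r ?(ltW m0) //.
rewrite normrX normr_id [`|_ ^+ 2|]ger0_norm ?exprn_ge0 // -exprMn.
by rewrite lerXn2r ?nnegrE // (le_trans _ (h3 k)).
Qed.

End Operator.

(** * Green's formula and the boundary conditions at 0 *)

Section Green.
Context {C : numClosedFieldType} (cplC : sum_complete C).
Variables (q t a b : C).
Hypothesis good : good_parameters q t a b.
Implicit Types (x c : C) (F G : C -> C).

Local Notation inL2 := (inL2 q t a b).
Local Notation Lf := (qop q a b).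
Local Notation W := (grid_mass q t a b).
Local Notation tame := (tame q t).

Definition grid_ip F G : C := wip W (fun n => F (gpt q t n)) (fun n => G (gpt q t n)).

Definition domf F : Prop :=
  [/\ inL2 F, inL2 (Lf F), same_limit_at0 q t F & same_limit_at0 q t (Dq q F)].

Lemma same_limit_at0P F : same_limit_at0 q t F <->
  exists l : C, (fun k => F (- q ^+ k)) @ \oo --> l /\ (fun k => F (t * q ^+ k)) @ \oo --> l.
Proof.
split=> [[h1 h2 e]|[l [h1 h2]]].
  by exists (limn (along_neg q F)); split; [exact: h1|rewrite e; exact: h2].
split; [exact: (cvgP _ h1)|exact: (cvgP _ h2)|].
by rewrite (seq_limE h1 : limn (along_neg q F) = l) (seq_limE h2 : limn (along_pos q t F) = l).
Qed.

Lemma green_limit F G (f0 f1 g0 g1 f0' f1' g0' g1' : C) :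
  inL2 F -> inL2 G -> inL2 (Lf F) -> inL2 (Lf G) ->
  (fun k => F (- q ^+ k)) @ \oo --> f0 -> (fun k => Dq q F (- q ^+ k)) @ \oo --> f1 ->
  (fun k => G (- q ^+ k)) @ \oo --> g0 -> (fun k => Dq q G (- q ^+ k)) @ \oo --> g1 ->
  (fun k => F (t * q ^+ k)) @ \oo --> f0' -> (fun k => Dq q F (t * q ^+ k)) @ \oo --> f1' ->
  (fun k => G (t * q ^+ k)) @ \oo --> g0' -> (fun k => Dq q G (t * q ^+ k)) @ \oo --> g1' ->
  grid_ip (Lf F) G - grid_ip F (Lf G) =
    (1 - q) ^+ 2 * ((f1 * g0^* - f0 * g1^*) - (f1' * g0'^* - f0' * g1'^*)).
Proof.
move=> lF lG lLF lLG F0 F1 G0 G1 F0' F1' G0' G1'.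
have W0 := W_gt0 cplC good.
have s1 := wip_asum W0 lLF lG; have s2 := wip_asum W0 lF lLG.
rewrite /grid_ip /wip -(csumB cplC s1 s2); set u := fun n => _ - _.
have su : asum u by apply: asumB.
(* Only partial sums over complete blocks of three telescope; this subsequence suffices because the
   whole series converges. *)
apply: (seq_cvg_unique (@seq_cvg_subseq _ _ _ (fun N => 3 * N.+1)%N _ (csum_cvg cplC su))).
  by move=> n; rewrite (leq_trans (leqnSn n)) // leq_pmull.
have eN k : - q ^+ k = -1 * q ^+ k by rewrite mulN1r.
have gm : grid q t (-1) by left; exists 0%N.
have gt : grid q t t by have := tqX_grid q t 0; rewrite mulr1.
have E H : (fun k => H (- q ^+ k)) = (fun k => H (-1 * q ^+ k)) :> (nat -> C).
  by apply/funext => k; rewrite eN.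
rewrite E in F0; rewrite E in F1; rewrite E in G0; rewrite E in G1.
have := seq_cvgB (seq_cvgD (casorati_cvg cplC good gm F0 F1 G0 G1)
  (casorati_cvg cplC good gt F0' F1' G0' G1')) (casorati_inf_cvg0 cplC good lF lG).
rewrite normrN1 invrN1 (gtr0_norm (good_t_gt0 good)) divff ?(good_t_neq0 good) //.
rewrite !mul1r mulN1r opprK subr0.
have -> : (1 - q) ^+ 2 * (f1 * g0^* - f0 * g1^*) +
   - (1 - q) ^+ 2 * (f1' * g0'^* - f0' * g1'^*) =
   (1 - q) ^+ 2 * ((f1 * g0^* - f0 * g1^*) - (f1' * g0'^* - f0' * g1'^*)) by ring.
apply: seq_cvg_ext => N /=; rewrite -eN -(green_partial cplC good) /series /=.
by apply: eq_bigr => n _; rewrite /u mulrBl.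
Qed.

Lemma Lf_symmetric F G : domf F -> domf G -> grid_ip (Lf F) G = grid_ip F (Lf G).
Proof.
move=> [lF lLF /same_limit_at0P[f0 [F0 F0']] /same_limit_at0P[f1 [F1 F1']]].
move=> [lG lLG /same_limit_at0P[g0 [G0 G0']] /same_limit_at0P[g1 [G1 G1']]].
apply/eqP; rewrite -subr_eq0.
by rewrite (green_limit lF lG lLF lLG F0 F1 G0 G1 F0' F1' G0' G1') subrr mulr0.
Qed.

Lemma inL2_limits c G : (c = -1 \/ c = t) -> inL2 (Lf G) -> has_limits q c G.
Proof.
move=> hc /inL2P[s1 s2 _].
have gm : grid q t (-1) by left; exists 0%N.
have gt : grid q t t by have := tqX_grid q t 0; rewrite mulr1.
case: hc => ->; apply: (limits_exist cplC good) => //.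
by apply: (eq_asum _ s1) => k; rewrite mulN1r.
Qed.

Lemma cvg_negq (H : C -> C) (l : C) :
  (fun k => H (-1 * q ^+ k)) @ \oo --> l -> (fun k => H (- q ^+ k)) @ \oo --> l.
Proof. by apply: seq_cvg_ext => k; rewrite mulN1r. Qed.

(** The test functions have value and q-derivative (1, 0) and (1, 1) at 0: the first equates the two
    one-sided q-derivatives of [G], after which the second equates its values. *)
Lemma symmetric_same_limits G : inL2 G -> inL2 (Lf G) ->
  (forall F, domf F -> grid_ip (Lf F) G = grid_ip F (Lf G)) ->
  domf (fun=> 1) -> domf (fun x => x + 1) -> domf G.
Proof.
move=> lG lLG hsym d1 dx.
have [g0 [g1 [/cvg_negq G0 /cvg_negq G1]]] := @inL2_limits (-1) G (or_introl erefl) lLG.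
have [g0' [g1' [G0' G1']]] := @inL2_limits t G (or_intror erefl) lLG.
have q2 : (1 - q) ^+ 2 != 0 by rewrite expf_neq0 // lt0r_neq0 // (one_sub_q_gt0 good).
have test F (f0 f1 : C) : domf F ->
    (fun k => F (- q ^+ k)) @ \oo --> f0 -> (fun k => Dq q F (- q ^+ k)) @ \oo --> f1 ->
    (fun k => F (t * q ^+ k)) @ \oo --> f0 -> (fun k => Dq q F (t * q ^+ k)) @ \oo --> f1 ->
    f1 * g0^* - f0 * g1^* = f1 * g0'^* - f0 * g1'^*.
  move=> dF F0 F1 F0' F1'; have [lF lLF _ _] := dF.
  have := green_limit lF lG lLF lLG F0 F1 G0 G1 F0' F1' G0' G1'.
  rewrite hsym // subrr => /esym/eqP; rewrite mulf_eq0 (negbTE q2) /= subr_eq0.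
  by move/eqP.
have Dq1 x : Dq q (fun=> 1) x = 0 by rewrite /Dq subrr mul0r.
have Dqx x : x != 0 -> Dq q (fun x => x + 1) x = 1.
  move=> x0; rewrite /Dq; have q1 := lt0r_neq0 (one_sub_q_gt0 good); field.
  by rewrite x0.
have nq k : - q ^+ k != 0 := grid_neq0 good (nqX_grid q t k).
have tq k : t * q ^+ k != 0 := grid_neq0 good (tqX_grid q t k).
have e1 : g1 = g1'.
  have := test (fun=> 1) 1 0 d1 (seq_cvg_cst _)
    (seq_cvg_ext (fun k => esym (Dq1 _)) (seq_cvg_cst _)) (seq_cvg_cst _)
    (seq_cvg_ext (fun k => esym (Dq1 _)) (seq_cvg_cst _)).
  by rewrite !mul0r !mul1r !sub0r => /oppr_inj/(can_inj conjCK).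
have e0 : g0 = g0'.
  have h c (d : C) : (fun k => c * q ^+ k + d) @ \oo --> d.
    rewrite -[X in _ --> X]add0r -(mulr0 c).
    exact: seq_cvgD (seq_cvgZ c (qexp_cvg0 cplC (good_q good))) (seq_cvg_cst d).
  have := test (fun x => x + 1) 1 1 dx
    (seq_cvg_ext _ (h (-1) 1)) (seq_cvg_ext (fun k => esym (Dqx _ (nq k))) (seq_cvg_cst _))
    (h t 1) (seq_cvg_ext (fun k => esym (Dqx _ (tq k))) (seq_cvg_cst _)).
  rewrite !mul1r e1 => /(_ _)/addIr/(can_inj conjCK); apply => k.
  by rewrite mulN1r.
split=> //; apply/same_limit_at0P; first by exists g0; rewrite {2}e0.
by exists g1; rewrite {2}e1.
Qed.

End Green.

(** * The q-Meixner functions *)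

Section MeixnerSeries.
Context {C : numClosedFieldType} (cplC : sum_complete C).
Variables (q t a b : C).
Hypothesis good : good_parameters q t a b.
Implicit Types (x y g : C).

Let hq : 0 < q < 1 := good_q good.
Let q0 : 0 < q := good_q_gt0 good.
Let q1 : q < 1 := good_q_lt1 good.
Let qn0 : q != 0 := good_q_neq0 good.

Local Notation Lf := (qop q a b).

(* [(-1/x; q)_n x^n], extended to [x = 0]. *)
Definition shpow n x : C := \prod_(k < n) (x + q ^+ k).

Lemma shpow0 x : shpow 0 x = 1. Proof. by rewrite /shpow big_ord0. Qed.

Lemma shpowS n x : shpow n.+1 x = (x + q ^+ n) * shpow n x.
Proof. by rewrite /shpow big_ord_recr mulrC. Qed.

(** Since [q x + q^k = q (x + q^(k - 1))], all factors but the one with [k = 0] are old ones up to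
    [q]. *)
Lemma shpow_q n x : shpow n.+1 (q * x) = q ^+ n * (q * x + 1) * shpow n x.
Proof.
elim: n => [|n ih]; first by rewrite shpowS !shpow0 expr0 !mulr1 mul1r.
by rewrite shpowS ih shpowS !exprS; ring.
Qed.

Lemma shpow_diff n x : shpow n.+1 x - shpow n.+1 (q * x) = (1 - q ^+ n.+1) * x * shpow n x.
Proof. by rewrite shpow_q shpowS exprS; ring. Qed.

Lemma shpow_m1 n : shpow n.+1 (-1) = 0.
Proof.
elim: n => [|n ih]; first by rewrite shpowS expr0 addNr mul0r.
by rewrite shpowS ih mulr0.
Qed.

Lemma shpowE n x : x != 0 -> qpoch (- x^-1) q n * x ^+ n = shpow n x.
Proof.
move=> x0; elim: n => [|n ih]; first by rewrite qpoch0 shpow0 expr0 mulr1.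
rewrite qpochS shpowS -ih exprS.
have -> : x + q ^+ n = x * (1 - - x^-1 * q ^+ n) by rewrite mulNr opprK; field.
by ring.
Qed.

Lemma shpow_cvg (x : nat -> C) (l : C) n : x @ \oo --> l ->
  (fun k => shpow n (x k)) @ \oo --> shpow n l.
Proof.
move=> xl; elim: n => [|n ih].
  by rewrite shpow0; apply: (seq_cvg_ext _ (seq_cvg_cst 1)) => k; rewrite shpow0.
rewrite shpowS; apply: (seq_cvg_ext _ (seq_cvgM (seq_cvgD xl (seq_cvg_cst (q ^+ n))) ih)).
by move=> k; rewrite shpowS.
Qed.

Lemma shpow_norm_le n x (B : C) : `|x| <= B -> `|shpow n x| <= shpow n B.
Proof.
move=> xB; elim: n => [|n ih]; first by rewrite !shpow0 normr1.
rewrite !shpowS normrM ler_pM // (le_trans (ler_normD _ _)) // lerD //.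
by rewrite gtr0_norm // (good_qX_gt0 good).
Qed.

(** What remains of the 2phi2 coefficient once [x^n] and [gamma^n] have been absorbed into two
    shifted powers; this form makes the symmetry in [gamma] and [x] visible. *)
Definition mcoef n : C :=
  (-1) ^+ n * q ^+ 'C(n, 2) * (a * b) ^+ n / (qpoch q q n * qpoch a q n * qpoch b q n).

Lemma oma_neq0 n : 1 - a * q ^+ n != 0.
Proof. by have := grid_a_neq0 good (nqX_grid q t n); rewrite mulrN. Qed.

Lemma omb_neq0 n : 1 - b * q ^+ n != 0.
Proof. by have := grid_b_neq0 good (nqX_grid q t n); rewrite mulrN. Qed.

Definition mratio n : C :=
  - (q ^+ n * (a * b) * ((1 - a * q ^+ n)^-1 * (1 - b * q ^+ n)^-1)).

Lemma mcoefS n : (1 - q ^+ n.+1) * mcoef n.+1 = mratio n * mcoef n.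
Proof.
rewrite /mcoef /mratio !qpochS -exprS binS bin1 [(-1) ^+ _.+1]exprS.
rewrite [(a * b) ^+ _.+1]exprS exprD !invfM.
have := one_sub_qexp_neq0 hq n; have := oma_neq0 n; have := omb_neq0 n.
move: (qpoch q q n)^-1 (qpoch a q n)^-1 (qpoch b q n)^-1 (1 - q ^+ n.+1) => u v w Q.
move: (1 - a * q ^+ n) (1 - b * q ^+ n) => A B B0 A0 Q0.
by field; rewrite Q0 A0 B0.
Qed.

Lemma mratio_cvg : mratio @ \oo --> (0 : C).
Proof.
have h c : (forall n, 1 - c * q ^+ n != 0) ->
    (fun n => (1 - c * q ^+ n)^-1) @ \oo --> (1 : C).
  move=> c0; rewrite -[X in _ --> X]invr1; apply: seq_cvgV; first exact: oner_neq0.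
  rewrite -[X in _ --> X]subr0 -[X in _ - X](mulr0 c).
  by apply: seq_cvgB (seq_cvg_cst _) _; apply: seq_cvgZ (qexp_cvg0 cplC hq).
have := seq_cvgZ (-1) (seq_cvgM (seq_cvgM (qexp_cvg0 cplC hq) (seq_cvg_cst (a * b)))
  (seq_cvgM (h a oma_neq0) (h b omb_neq0))).
by rewrite !mul0r mulr0; apply: seq_cvg_ext => n; rewrite mulN1r.
Qed.

Lemma asum_meixner g x : asum (fun n => mcoef n * shpow n g * shpow n x).
Proof.
apply: (@asum_ratio _ _ (fun n => mratio n * (1 - q ^+ n.+1)^-1 *
    ((g + q ^+ n) * (x + q ^+ n))) 0); last by rewrite normr0.
  move=> n; rewrite !shpowS; apply: (mulfI (one_sub_qexp_neq0 hq n)).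
  transitivity ((1 - q ^+ n.+1) * mcoef n.+1 *
    ((g + q ^+ n) * shpow n g * ((x + q ^+ n) * shpow n x))); first by ring.
  rewrite mcoefS; have Q0 := one_sub_qexp_neq0 hq n.
  by move: (1 - q ^+ n.+1) (mratio n) Q0 => Q r Q0; field.
have h y : (fun n => y + q ^+ n) @ \oo --> y.
  by rewrite -[X in _ --> X]addr0; apply: seq_cvgD (seq_cvg_cst _) (qexp_cvg0 cplC hq).
have := seq_cvgM (seq_cvgM mratio_cvg (one_sub_qexp_cvg cplC hq)) (seq_cvgM (h g) (h x)).
by rewrite !mul0r.
Qed.

(** In contrast to the 2phi2 form, this one extends continuously to [x = 0], where the boundary
    conditions are taken. *)
Definition mseries g x : C := csum (fun n => mcoef n * shpow n g * shpow n x).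

Lemma meixnerC g x : mseries g x = mseries x g.
Proof. by congr csum; apply/funext => n; rewrite mulrAC. Qed.

Lemma qMeixnerE g x : g != 0 -> x != 0 -> qMeixner a b q g x = mseries g x.
Proof.
move=> g0 x0; congr (limn (series _)); apply/funext => n.
rewrite -(shpowE n g0) -(shpowE n x0) /mcoef !exprMn; ring.
Qed.

Lemma meixner_m1 g : mseries g (-1) = 1.
Proof.
rewrite /mseries (@csum1 _ _ 0) => [|[//|n] _]; last by rewrite shpow_m1 mulr0.
by rewrite !shpow0 /mcoef !expr0 !qpoch0 !mulr1 invr1 mulr1.
Qed.

Lemma mcoef_real n : (mcoef n)^* = mcoef n.
Proof.
have [_ _ ab0 /CrealP abr _] := good; have qr : q \is Num.real by apply: gtr0_real.
have abrr : a * b \is Num.real by apply: gtr0_real.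
have h : qpoch q q n * qpoch a q n * qpoch b q n \is Num.real.
  rewrite -mulrA rpredM //.
    by rewrite rpred_prod // => k _; rewrite rpredB ?rpred1 ?rpredM ?rpredX.
  (* [a] and [b] may be non-real, so their factors are paired: each pair involves only the real
     numbers [a + b] and [a * b]. *)
  rewrite /qpoch -big_split rpred_prod // => k _ /=.
  have -> : (1 - a * q ^+ k) * (1 - b * q ^+ k) =
      1 - (a + b) * q ^+ k + (a * b) * (q ^+ k) ^+ 2 by ring.
  by rewrite rpredD ?rpredB ?rpred1 // rpredM ?rpredX.
by apply/CrealP; rewrite rpred_div // !rpredM ?rpredX ?rpredN ?rpred1.
Qed.

Lemma shpow_real n x : x^* = x -> (shpow n x)^* = shpow n x.
Proof.
move=> xr; rewrite rmorph_prod; apply: eq_bigr => k _.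
by rewrite rmorphD rmorphXn /= xr (CrealP (gtr0_real q0)).
Qed.

Lemma meixner_real g x : g^* = g -> x^* = x -> (mseries g x)^* = mseries g x.
Proof.
move=> gr xr; rewrite -(csum_conj cplC (asum_meixner g x)); congr csum.
apply/funext => n; rewrite (rmorphM _ (mcoef n * shpow n g)) (rmorphM _ (mcoef n)) /=.
by rewrite mcoef_real !shpow_real.
Qed.

Lemma Lf_shpow0 x : Lf (shpow 0) x = 0.
Proof. by rewrite /qop !shpow0 !subrr !mulr0 addr0. Qed.

(** On shifted powers the operator is lower bidiagonal, with [mu (- q^(n + 1))] on the diagonal. *)
Lemma Lf_shpowS n x : x != 0 -> Lf (shpow n.+1) x =
  - (a * b) * (1 - q ^+ n.+1) * shpow n.+1 x +
  (1 - q ^+ n.+1) * (1 - a * q ^+ n) * (1 - b * q ^+ n) / q ^+ n * shpow n x.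
Proof.
move=> x0; have Qn0 : q ^+ n != 0 by rewrite expf_neq0.
have e1 : shpow n.+1 (q * x) - shpow n.+1 x = - ((1 - q ^+ n.+1) * x * shpow n x).
  by rewrite -shpow_diff opprB.
have e2 : shpow n.+1 (x / q) - shpow n.+1 x = (1 - q ^+ n.+1) * (x / q) * shpow n (x / q).
  by rewrite -shpow_diff [q * (x / q)]mulrC divfK.
have e3 : q ^+ n * (x + 1) * shpow n (x / q) = (x + q ^+ n) * shpow n x.
  have := shpow_q n (x / q); rewrite [q * (x / q)]mulrC divfK // => <-.
  by rewrite shpowS.
rewrite /qop e1 e2 shpowS (coef_AE _ _ x0).
have -> : coef_B q x * ((1 - q ^+ n.+1) * (x / q) * shpow n (x / q)) =
   (1 - q ^+ n.+1) / (x * q ^+ n) * (q ^+ n * (x + 1) * shpow n (x / q)).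
  rewrite /coef_B; move: (1 - q ^+ n.+1) (shpow n (x / q)) (q ^+ n) Qn0 => Q P R R0.
  by field; rewrite x0 R0 qn0.
rewrite e3; move: (1 - q ^+ n.+1) (shpow n x) (q ^+ n) Qn0 => Q P R R0.
by field; rewrite x0 R0.
Qed.

(** By [mcoefS] the lower-degree part of term [n + 1] has coefficient [- a b (g + q^n)]; with the
    diagonal part [- a b (1 - q^n)] of term [n] it adds up to [- a b (1 + g)]. *)
Lemma meixner_eigen g x : x != 0 -> Lf (mseries g) x = mu a b g * mseries g x.
Proof.
move=> x0; pose c n := mcoef n * shpow n g.
have sP y : asum (fun n => c n * shpow n y) := asum_meixner g y.
pose v n := c n * Lf (shpow n) x.
have vE : Lf (mseries g) x = csum v.
  have d y z (e : C) : e * (mseries g y - mseries g z) =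
      csum (fun n => e * (c n * shpow n y - c n * shpow n z)).
    by rewrite (csumZ cplC _ (asumB (sP y) (sP z))) (csumB cplC (sP y) (sP z)).
  rewrite /qop !d -(csumD cplC); [|exact: asumZ (asumB _ _)|exact: asumZ (asumB _ _)].
  by congr csum; apply/funext => n; rewrite /v /qop; ring.
pose s n := - (a * b) * ((1 - q ^+ n) * (c n * shpow n x)).
(* The lower-degree part, kept at its original index; it is 0 at index 0 because constants are
   annihilated. *)
pose w n := if n is m.+1 then - (a * b) * (g + q ^+ m) * (c m * shpow m x) else 0.
have vsw n : v n = s n + w n.
  case: n => [|n]; rewrite /v /s /w; first by rewrite Lf_shpow0 expr0 subrr mul0r !mulr0 addr0.
  rewrite Lf_shpowS // mulrDr; congr (_ + _); first by ring.
  have := mcoefS n; rewrite /c /mratio shpowS.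
  have := one_sub_qexp_neq0 hq n; have := oma_neq0 n; have := omb_neq0 n.
  have Qn0 : q ^+ n != 0 by rewrite expf_neq0.
  move: (mcoef n.+1) (mcoef n) (1 - q ^+ n.+1) (shpow n x) (shpow n g).
  move=> c1 c0 Q X G B0 A0 Q0 e.
  transitivity ((Q * c1) * ((g + q ^+ n) * G *
     ((1 - a * q ^+ n) * (1 - b * q ^+ n) / q ^+ n * X))); first by ring.
  by rewrite e; field; rewrite A0 B0 Qn0.
have qb (B : C) n : `|B + q ^+ n| <= `|B| + 1.
  by rewrite (le_trans (ler_normD _ _)) // lerD2l gtr0_norm ?(good_qX_gt0 good) // exprn_ile1 // ltW.
have ss : asum s.
  apply: asumZ; apply: (@asum_bound _ _ _ (`|1| + 1) _ (sP x)) => n.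
  rewrite (le_trans (ler_normB _ _)) // lerD2l gtr0_norm ?(good_qX_gt0 good) //.
  by rewrite exprn_ile1 // ltW.
have sw1 : asum (fun n => w n.+1).
  apply: (@asum_bound _ _ _ (`|- (a * b)| * (`|g| + 1)) _ (sP x)) => n.
  by rewrite normrM ler_wpM2l // qb.
have sw : asum w by apply: (@asum_shift _ 1); apply: (eq_asum _ sw1) => n; rewrite addn1.
rewrite vE (_ : v = fun n => s n + w n); last exact/funext.
rewrite (csumD cplC ss sw) (csumS cplC sw) add0r -(csumD cplC ss sw1).
rewrite -(csumZ cplC _ (sP x)); congr csum; apply/funext => n.
by rewrite /s /w /mu; ring.
Qed.

Lemma shpow_series_cvg (e : nat -> C) (x : nat -> C) :
  (forall B, asum (fun n => e n * shpow n B)) -> x @ \oo --> (0 : C) ->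
  (fun k => csum (fun n => e n * shpow n (x k))) @ \oo --> csum (fun n => e n * shpow n 0).
Proof.
move=> se xc; have [B hB] := seq_cvg_bounded xc.
apply: (csum_dominated cplC (asum_norm (se B))) => [N k|k].
  rewrite !normrM ler_wpM2l // (le_trans (shpow_norm_le k (hB N))) // real_ler_norm //.
  by rewrite ger0_real // (le_trans _ (shpow_norm_le k (hB N))).
by apply: seq_cvgZ; apply: shpow_cvg.
Qed.

Lemma meixner_cvg0 g (x : nat -> C) : x @ \oo --> (0 : C) ->
  (fun k => mseries g (x k)) @ \oo --> mseries g 0.
Proof. exact: shpow_series_cvg (asum_meixner g). Qed.

(** The termwise q-derivative of [mseries g]; its value at 0 is the common limit of the
    q-derivatives from both sides. *)
Definition dmeixner g x : C :=
  csum (fun n => (1 - q)^-1 * (1 - q ^+ n.+1) * (mcoef n.+1 * shpow n.+1 g) * shpow n x).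

Lemma asum_dmeixner g x :
  asum (fun n => (1 - q)^-1 * (1 - q ^+ n.+1) * (mcoef n.+1 * shpow n.+1 g) * shpow n x).
Proof.
have [B hB] := seq_cvg_bounded mratio_cvg.
have h n : `|(1 - q)^-1 * (g + q ^+ n) * mratio n| <= `|(1 - q)^-1| * (`|g| + 1) * B.
  rewrite !normrM ler_pM ?mulr_ge0 // ler_wpM2l // (le_trans (ler_normD _ _)) // lerD2l.
  by rewrite gtr0_norm ?(good_qX_gt0 good) // exprn_ile1 // ltW.
apply: (eq_asum _ (asum_bound h (asum_meixner g x))) => n.
rewrite shpowS; have := mcoefS n; move: (mcoef n.+1) (mcoef n) => c1 c0 e.
transitivity ((1 - q)^-1 * (g + q ^+ n) * shpow n g * shpow n x * (mratio n * c0)).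
  by ring.
by rewrite -e; ring.
Qed.

Lemma Dq_meixner g x : x != 0 -> Dq q (mseries g) x = dmeixner g x.
Proof.
move=> x0; have oq : 1 - q != 0 by rewrite lt0r_neq0 // subr_gt0.
have [s1 s2] := (asum_meixner g x, asum_meixner g (q * x)).
rewrite /Dq /mseries -(csumB cplC s1 s2) (csumS cplC (asumB s1 s2)) !shpow0 subrr add0r.
rewrite mulrC -(csumZ cplC); last first.
  have [B hB] := asumB s1 s2; exists B => n; apply: le_trans (hB n.+1).
  by rewrite [leRHS]big_nat_recl //= lerDr.
congr csum; apply/funext => n; rewrite -mulrBr shpow_diff invfM.
by move: (1 - q ^+ n.+1) => Q; field; rewrite oq x0.
Qed.

Lemma dmeixner_cvg0 g (x : nat -> C) : x @ \oo --> (0 : C) -> (forall k, x k != 0) ->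
  (fun k => Dq q (mseries g) (x k)) @ \oo --> dmeixner g 0.
Proof.
move=> xc x0; apply: (seq_cvg_ext (u := fun k => dmeixner g (x k))).
  by move=> k; rewrite Dq_meixner.
exact: shpow_series_cvg (asum_dmeixner g) xc.
Qed.

Let negc : (fun k => - q ^+ k) @ \oo --> (0 : C).
Proof.
rewrite -[X in _ --> X](mulr0 (-1)).
by apply: (seq_cvg_ext _ (seq_cvgZ (-1) (qexp_cvg0 cplC hq))) => k; rewrite mulN1r.
Qed.

Let posc : (fun k => t * q ^+ k) @ \oo --> (0 : C).
Proof. by rewrite -[X in _ --> X](mulr0 t); apply: seq_cvgZ (qexp_cvg0 cplC hq). Qed.

Lemma meixner_same_limit g : same_limit_at0 q t (mseries g).
Proof.
by apply/same_limit_at0P; exists (mseries g 0); split; apply: meixner_cvg0.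
Qed.

Lemma Dq_meixner_same_limit g : same_limit_at0 q t (Dq q (mseries g)).
Proof.
apply/same_limit_at0P; exists (dmeixner g 0).
split; apply: dmeixner_cvg0 => // k; apply: (grid_neq0 good).
- exact: nqX_grid.
- exact: tqX_grid.
Qed.

Definition far (F : C -> C) : Prop :=
  exists B r, 0 <= r /\ forall k, `|F (t / q ^+ k.+1)| <= B * r ^+ k.

Lemma meixner_tame g : far (mseries g) -> tame q t (mseries g).
Proof.
by split=> //; apply: seq_cvg_bounded; apply: meixner_cvg0.
Qed.

Lemma tame_domf g : far (mseries g) -> domf q t a b (mseries g).
Proof.
move=> /meixner_tame/(tame_inL2 cplC good) lF; split=> //.
- have := l2Z (mu a b g) lF; apply: eq_asum => n.
  by rewrite -meixner_eigen // (grid_neq0 good (gpt_gridP q t n)).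
- exact: meixner_same_limit.
- exact: Dq_meixner_same_limit.
Qed.

Lemma far_lin (c : C) F G : far F -> far G -> far (fun x => c * F x + G x).
Proof.
move=> [B [r [r0 hF]]] [B' [r' [r0' hG]]].
exists (`|c| * `|B| + `|B'|), (r + r'); split=> [|k]; first exact: addr_ge0.
have h D s s' : 0 <= s -> s <= s' -> D * s ^+ k \is Num.real ->
    D * s ^+ k <= `|D| * s' ^+ k.
  move=> s0 ss Dr; apply: (le_trans (real_ler_norm Dr)).
  rewrite normrM (ger0_norm (exprn_ge0 k s0)) ler_wpM2l //.
  by rewrite lerXn2r ?nnegrE // (le_trans s0).
rewrite (le_trans (ler_normD _ _)) // mulrDl lerD // ?normrM -?mulrA ?ler_wpM2l //.
  apply: (le_trans (hF k)); apply: h => //; first by rewrite lerDl.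
  by rewrite ger0_real // (le_trans _ (hF k)).
apply: (le_trans (hG k)); apply: h => //; first by rewrite lerDr.
by rewrite ger0_real // (le_trans _ (hG k)).
Qed.

Lemma far_mulx F : far F -> far (fun x => x * F x).
Proof.
move=> [B [r [r0 hF]]]; exists (t / q * B), (r / q); split=> [|k].
  by rewrite divr_ge0 // ltW.
have tk : 0 < t / q ^+ k.+1 by rewrite divr_gt0 ?(good_t_gt0 good) ?(good_qX_gt0 good).
rewrite normrM (gtr0_norm tk); apply: le_trans (ler_wpM2l (ltW tk) (hF k)) _.
rewrite le_eqVlt; apply/orP; left; apply/eqP; rewrite exprMn exprS exprVn.
by field; rewrite qn0 expf_neq0.
Qed.

Lemma far_ext F G : (forall x, x != 0 -> F x = G x) -> far F -> far G.
Proof.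
move=> FG [B [r [r0 hF]]]; exists B, r; split=> // k.
by rewrite -FG // (grid_neq0 good (tqV_grid q t k)).
Qed.

Lemma far_zero : far (fun=> 0).
Proof. by exists 0, 0; split=> // k; rewrite normr0 mul0r. Qed.

Lemma far_one : far (fun=> 1).
Proof. by exists 1, 1; split=> // k; rewrite normr1 expr1n mulr1. Qed.

(** By symmetry the eigenvalue equation also holds in [g], with eigenvalue [mu x]. Solved for the
    value at [q * g], it involves [x] times the value at [g], the value at [g], and the one at
    [g / q] with a factor [coef_B], which vanishes for [g = -1]. *)
Lemma far_meixner_step g : g != 0 -> coef_A a b g != 0 ->
  far (mseries g) -> (coef_B q g != 0 -> far (mseries (g / q))) ->
  far (mseries (q * g)).
Proof.
move=> g0 A0 fg fgq; set A := coef_A a b g in A0 *; set B := coef_B q g in fgq *.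
pose c1 := 1 - (a * b - B) / A.
have fB : far (fun x => (- (B / A)) * mseries (g / q) x + 0).
  have [->|Bn0] := eqVneq B 0.
    by apply: far_ext far_zero => x _; rewrite mul0r oppr0 mul0r addr0.
  exact: far_lin (fgq Bn0) far_zero.
have := far_lin (- (a * b) / A) (far_mulx fg) (far_lin c1 fg fB).
apply: far_ext => x x0; have := meixner_eigen x g0; rewrite /qop.
rewrite -/A -/B !(meixnerC x) /mu => e; rewrite /c1.
apply: (mulfI A0); rewrite -[in RHS](subrK (mseries g x) (mseries (q * g) x)) [in RHS]mulrDr.
rewrite -[A * (_ - _)](addrK (B * (mseries (g / q) x - mseries g x))) e.
by field.
Qed.

End MeixnerSeries.

(** * Growth of the eigenfunctions at infinity *)

Section Growth.
Context {C : numClosedFieldType} (cplC : sum_complete C).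
Variables (q t a b : C).
Hypothesis good : good_parameters q t a b.
Implicit Types (x y g z : C) (F : nat -> C).

Let hq : 0 < q < 1 := good_q good.
Let q0 : 0 < q := good_q_gt0 good.
Let q1 : q < 1 := good_q_lt1 good.
Let qn0 : q != 0 := good_q_neq0 good.
Let t0 : 0 < t := good_t_gt0 good.

Local Notation meixner := (mseries q a b).
Local Notation far := (far q t).

Definition euler_sum z F : C := csum (fun n => euler_coef q n * z ^+ n * F n).

Definition ebound : C := csum (fun n => `|euler_coef q n|).

(* The Euler sum [sum_n e_n q^(i n) = (q^i; q)_oo] vanishes for [i <= 0], so
   that it is bounded in [i] although its terms are huge for [i -> -oo].
   [esum_bounded] is the class of weights [F] for which this cancellation
   persists; it is stable under multiplication by power series in [q^n]. *)
Definition esum_bounded F (K : C) : Prop :=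
  (exists M, forall n, `|F n| <= M) /\ forall i : int, `|euler_sum (q ^ i) F| <= K.

Lemma asum_euler_coef : asum (euler_coef q).
Proof.
by apply: (eq_asum _ (asum_euler cplC hq 1)) => n; rewrite expr1n mulr1.
Qed.

Lemma asum_esum z F M : (forall n, `|F n| <= M) ->
  asum (fun n => euler_coef q n * z ^+ n * F n).
Proof.
move=> FM; apply: (eq_asum _ (asum_bound FM (asum_euler cplC hq z))) => n.
by rewrite mulrC.
Qed.

Lemma qprod_norm_le y : `|y| <= 1 -> `|qprod q y| <= ebound.
Proof.
move=> y1; apply: le_trans (csum_norm_le cplC (asum_euler cplC hq y)) _.
apply: (csum_le cplC) => [n||].
- by rewrite normrM normrX ler_piMr // exprn_ile1.
- exact/asum_norm/(asum_euler cplC hq).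
- exact/asum_norm/asum_euler_coef.
Qed.

(** For [i < 0] Euler's product vanishes, and for [i >= 0] its argument has norm at most 1. *)
Lemma esum_bounded1 : esum_bounded (fun=> 1) ebound.
Proof.
split=> [|i]; first by exists 1 => n; rewrite normr1.
have -> : euler_sum (q ^ i) (fun=> 1) = qprod q (q ^ i).
  by congr csum; apply/funext => n; rewrite mulr1.
case: i => [k|k].
  by apply: qprod_norm_le; rewrite normrX gtr0_norm // exprn_ile1 // ltW.
rewrite NegzE -exprnN (qprod_qexpV cplC hq) normr0.
by apply: (csum_ge0 cplC) => [n|]; [exact: normr_ge0|exact/asum_norm/asum_euler_coef].
Qed.

(** The factor [(q^n)^j] only turns [q^i] into [q^(i + j)], where the bound [K] holds as well, and
    the coefficients are summable. Finite sections of the power series come before the limit,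
    because for them the sums can be exchanged freely. *)
Lemma esum_boundedM F K (c : nat -> C) : esum_bounded F K -> asum c ->
  esum_bounded (fun n => csum (fun j => c j * (q ^+ n) ^+ j) * F n)
    (csum (fun j => `|c j|) * K).
Proof.
move=> [[M FM] FK] sc.
have qn_le n j : `|(q ^+ n) ^+ j| <= 1.
  by rewrite !normrX gtr0_norm // !exprn_ile1 // ?exprn_ge0 // ltW.
have scn n : asum (fun j => c j * (q ^+ n) ^+ j).
  by apply: (eq_asum _ (asum_bound (qn_le n) sc)) => j; rewrite mulrC.
have snc := asum_norm sc.
have part J n : `|\sum_(0 <= j < J) c j * (q ^+ n) ^+ j| <= csum (fun j => `|c j|).
  apply: le_trans (ler_norm_sum _ _ _) _.
  apply: le_trans (csum_ge_partial cplC J _ snc) => //; apply: ler_sum => j _.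
  by rewrite normrM ler_piMr.
have lim n : (fun J => \sum_(0 <= j < J) c j * (q ^+ n) ^+ j) @ \oo -->
    csum (fun j => c j * (q ^+ n) ^+ j) by apply: csum_cvg.
have bnd n : `|csum (fun j => c j * (q ^+ n) ^+ j)| <= csum (fun j => `|c j|).
  by apply: (seq_cvg_le_cst _ (seq_cvg_norm (lim n))) => J; apply: part.
split; first by exists (csum (fun j => `|c j|) * M) => n; rewrite normrM ler_pM.
move=> i; pose FJ J n := (\sum_(0 <= j < J) c j * (q ^+ n) ^+ j) * F n.
have K0 : 0 <= K by apply: le_trans (FK 0).
have FJb J n : `|FJ J n| <= csum (fun j => `|c j|) * M by rewrite normrM ler_pM.
have limE : (fun J => euler_sum (q ^ i) (FJ J)) @ \oo -->
    euler_sum (q ^ i) (fun n => csum (fun j => c j * (q ^+ n) ^+ j) * F n).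
  have sb := asumZ (csum (fun j => `|c j|) * M) (asum_norm (asum_euler cplC hq (q ^ i))).
  apply: (csum_dominated cplC sb) => [J n|n].
    by rewrite normrM [leRHS]mulrC ler_wpM2l.
  by apply: seq_cvgZ; apply: seq_cvgM (seq_cvg_cst _); apply: lim.
apply: (seq_cvg_le_cst _ (seq_cvg_norm limE)) => J.
have -> : euler_sum (q ^ i) (FJ J) = \sum_(0 <= j < J) c j * euler_sum (q ^ (i + j)) F.
  have sF j := asum_esum (q ^ (i + Posz j)) FM.
  transitivity (csum (fun n => \sum_(0 <= j < J)
      c j * (euler_coef q n * (q ^ (i + Posz j)) ^+ n * F n))).
    congr csum; apply/funext => n; rewrite /FJ mulr_suml mulr_sumr.
    apply: eq_bigr => j _; rewrite expfzDr // exprMn -[q ^ Posz j]/(q ^+ j).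
    by rewrite -exprM mulnC exprM; ring.
  rewrite (csum_sum cplC) => [|j]; last exact: asumZ.
  by apply: eq_bigr => j _; rewrite (csumZ cplC _ (sF j)).
apply: le_trans (ler_norm_sum _ _ _) _.
apply: (@le_trans _ _ ((\sum_(0 <= j < J) `|c j|) * K)).
  by rewrite mulr_suml; apply: ler_sum => j _; rewrite normrM ler_wpM2l.
by rewrite ler_wpM2r // csum_ge_partial.
Qed.

Definition qprodV_bound y : C := csum (fun j => `|(qpoch q q j)^-1 * y ^+ j|).

Lemma esum_bounded_qprodV F K y : `|y| < 1 -> esum_bounded F K ->
  esum_bounded (fun n => qprodV q (q ^+ n * y) * F n) (qprodV_bound y * K).
Proof.
move=> y1 h; have := esum_boundedM h (asum_qprodV cplC hq y1).
congr esum_bounded; apply/funext => n; congr (_ * _); congr csum; apply/funext => j.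
by rewrite exprMn -mulrA [y ^+ j * _]mulrC.
Qed.

Lemma esum_bounded_qprod F K y : esum_bounded F K -> exists K',
  esum_bounded (fun n => qprod q (q ^+ n * y) * F n) K'.
Proof.
move=> h; have h' := esum_boundedM h (asum_euler cplC hq y).
exists (csum (fun j => `|euler_coef q j * y ^+ j|) * K); move: h'; congr esum_bounded.
apply/funext => n; congr (_ * _); congr csum; apply/funext => j.
by rewrite exprMn -mulrA [y ^+ j * _]mulrC.
Qed.

(** The part depending on [n] after each [(c; q)_n] has been written as [(c; q)_oo / (c q^n; q)_oo].
    The final [1] is the weight of [esum_bounded1], from which the product is built up. *)
Definition eweight u v n : C := qprodV q (q ^+ n * u) *
  (qprodV q (q ^+ n * v) * (qprod q (q ^+ n * b) * (qprod q (q ^+ n * a) * 1))).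

Lemma qprodV_bound_ge0 y : `|y| < 1 -> 0 <= qprodV_bound y.
Proof. by move=> y1; apply: (csum_ge0 cplC) => //; apply/asum_norm/asum_qprodV. Qed.

Lemma qprodV_bound_le y y' : `|y| <= `|y'| -> `|y'| < 1 ->
  qprodV_bound y <= qprodV_bound y'.
Proof.
move=> yy y1; apply: (csum_le cplC) => [n||].
- by rewrite !normrM ler_wpM2l // !normrX lerXn2r ?nnegrE.
- by apply/asum_norm/asum_qprodV => //; apply: le_lt_trans y1.
- exact/asum_norm/asum_qprodV.
Qed.

(** [K] does not depend on [u] and [v], so the estimate stays uniform while [u = - 1 / x] varies. *)
Lemma eweight_bounded : exists2 K, 0 <= K & forall u v, `|u| < 1 -> `|v| < 1 ->
  esum_bounded (eweight u v) (qprodV_bound u * (qprodV_bound v * K)).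
Proof.
have [K1 h1] := esum_bounded_qprod a esum_bounded1.
have [K2 h2] := esum_bounded_qprod b h1.
exists K2 => [|u v u1 v1]; first by case: h2 => _ /(_ 0); apply: le_trans.
exact: esum_bounded_qprodV u1 (esum_bounded_qprodV v1 h2).
Qed.

Lemma meixner_esum g x : `|- g^-1| < 1 -> `|- x^-1| < 1 -> g != 0 -> x != 0 ->
  meixner g x =
  qprod q (- x^-1) * (qprod q (- g^-1) / (qprod q a * qprod q b)) *
  euler_sum (a * b * (g * x)) (eweight (- x^-1) (- g^-1)).
Proof.
move=> g1 x1 g0 x0.
have inv y n : `|y| < 1 -> qpoch y q n = qprod q y * qprodV q (q ^+ n * y).
  move=> y1; rewrite -(qprodV_iter cplC hq n y1) mulrCA (qprodVK cplC hq y1).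
  by rewrite mulr1.
have pinv c n : (forall k, 1 - c * q ^+ k != 0) ->
    (qpoch c q n)^-1 = qprod q (q ^+ n * c) / qprod q c.
  move=> c0; rewrite (qprod_iter cplC hq c n) invfM mulrCA.
  rewrite mulfV ?mulr1 //; apply: (qprod_neq0 cplC hq) => k.
  by rewrite [q ^+ n * c]mulrC -mulrA -exprD.
have a0 := oma_neq0 good; have b0 := omb_neq0 good.
have [K _ /(_ _ _ x1 g1)[[M hM] _]] := eweight_bounded.
rewrite /euler_sum -(csumZ cplC _ (asum_esum _ hM)); congr csum; apply/funext => n.
rewrite -(shpowE q n g0) -(shpowE q n x0) /mcoef (inv (- g^-1)) //.
rewrite (inv (- x^-1)) // !invfM (pinv a n a0) (pinv b n b0) /eweight /euler_coef.
by rewrite !exprMn; ring.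
Qed.

(** For [g > 1] and large [x] both [- 1 / g] and [- 1 / x] have norm below 1 and can enter through
    [qprodV]; the eigenfunction is then even bounded. *)
Lemma far_meixner_base (i : int) : let g := (a * b * t)^-1 * q ^ i in
  1 < g -> far (meixner g).
Proof.
move=> g g1; have g0 : g != 0 by rewrite lt0r_neq0 // (lt_trans ltr01).
have gV : `|- g^-1| < 1.
  by rewrite normrN gtr0_norm ?invr_gt0 ?(lt_trans ltr01) // invf_lt1 // (lt_trans ltr01).
have [N hN] : exists N, q ^+ N < t.
  have [|N hN] := (seq_cvgP _ _).1 (qexp_cvg0 cplC hq) (t / 2); first by rewrite divr_gt0.
  exists N; have := hN N (leqnn N); rewrite sub0r normrN gtr0_norm ?(good_qX_gt0 good) //.
  move=> /le_lt_trans; apply; rewrite ltr_pdivrMr // ltr_pMr // ltr1n.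
  done.
(* Dominates [1 / x] at all outer points with [k >= N], which makes the bound uniform. *)
pose u0 := q ^+ N / t.
have u01 : `|u0| < 1.
  by rewrite gtr0_norm ?divr_gt0 ?(good_qX_gt0 good) // ltr_pdivrMr // mul1r.
have [K K0 hK] := eweight_bounded.
pose V := `|qprod q (- g^-1) / (qprod q a * qprod q b)|.
pose B := ebound * V * (qprodV_bound u0 * (qprodV_bound (- g^-1) * K)).
have [B' hB'] : exists B', forall k, `|meixner g (t / q ^+ k.+1)| <= B'.
  apply: (@ev_bounded _ _ N B) => k Nk; set x := t / q ^+ k.+1.
  have x0 : x != 0 by rewrite mulf_neq0 ?invr_eq0 ?lt0r_neq0 ?(good_qX_gt0 good).
  have xu : `|- x^-1| <= u0.
    have -> : x^-1 = q ^+ k.+1 / t by rewrite invfM invrK mulrC.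
    rewrite normrN gtr0_norm ?divr_gt0 ?(good_qX_gt0 good) // ler_pM2r ?invr_gt0 //.
    rewrite -(subnK (leqW Nk)) exprD ler_piMl ?(ltW (good_qX_gt0 good _)) //.
    by rewrite exprn_ile1 // ltW.
  have u0p : 0 <= u0 by rewrite (le_trans _ xu).
  have x1 : `|- x^-1| < 1 by rewrite (le_lt_trans xu) // -(ger0_norm u0p).
  have [_ hb] := hK _ _ x1 gV.
  rewrite meixner_esum //.
  (* On the grid and its dual [a b g x] is an integral power of [q], so the zeros of [(q^i; q)_oo]
     come into play. *)
  have -> : a * b * (g * x) = q ^ (i - Posz k.+1).
    rewrite expfzDr // /g /x -[q ^ (- _)]invr_expz -[q ^ Posz _]/(q ^+ _).
    have abn := lt0r_neq0 (good_ab_gt0 good); move: (a * b) abn => p p0.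
    have Q0 := lt0r_neq0 (good_qX_gt0 good k.+1); move: (q ^ i) (q ^+ k.+1) Q0 => Q R R0.
    by field; rewrite p0 R0 lt0r_neq0.
  rewrite normrM ler_pM //; first by rewrite normrM ler_wpM2r // qprod_norm_le // ltW.
  apply: (le_trans (hb _)); rewrite ler_wpM2r ?mulr_ge0 ?qprodV_bound_ge0 //.
  by rewrite qprodV_bound_le // (ger0_norm u0p).
by exists B', 1; split=> // k; rewrite expr1n mulr1.
Qed.

Lemma pos_dual_grid (i : int) : 0 < (a * b * t)^-1 * q ^ i.
Proof.
apply: mulr_gt0; last by rewrite exprz_gt0.
by rewrite invr_gt0 mulr_gt0 ?(good_ab_gt0 good).
Qed.

(** The recurrence starts from the constant function at [g = -1], where it takes no second initial
    value. *)
Lemma far_meixner_neg k : far (meixner (- q ^+ k)).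
Proof.
have f1 : far (meixner (- q ^+ 0)).
  by apply: (far_ext good _ (far_one q t)) => x _; rewrite expr0 meixnerC meixner_m1.
have gd := good_parameters_dual good.
suff : far (meixner (- q ^+ k)) /\ far (meixner (- q ^+ k.+1)) by case.
elim: k => [|k [ih1 ih2]].
  split=> //; rewrite exprS -mulrN; apply: (far_meixner_step cplC good) => //.
  - exact: (grid_neq0 good (nqX_grid q t _)).
  - exact: lt0r_neq0 (coef_A_gt0 good (nqX_grid q t _)).
  - by rewrite expr0 coef_B_m1 eqxx.
split=> //; rewrite exprS -mulrN; apply: (far_meixner_step cplC good) => //.
- exact: (grid_neq0 good (nqX_grid q t _)).
- exact: lt0r_neq0 (coef_A_gt0 good (nqX_grid q t _)).
by move=> _; rewrite exprSr mulNr mulfK.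
Qed.

Lemma far_meixner_pos (i : int) : far (meixner ((a * b * t)^-1 * q ^ i)).
Proof.
set g := _ * _; have g0 : 0 < g by apply: pos_dual_grid.
have gd := good_parameters_dual good.
have [N hN] : exists N, q ^+ N < g.
  have [|N hN] := (seq_cvgP _ _).1 (qexp_cvg0 cplC hq) (g / 2); first by rewrite divr_gt0.
  exists N; have := hN N (leqnn N); rewrite sub0r normrN gtr0_norm ?(good_qX_gt0 good) //.
  move=> /le_lt_trans; apply; rewrite ltr_pdivrMr // ltr_pMr // ltr1n.
  done.
(* [h] starts [N + 1] steps above [g], far enough for both initial values [h 0] and [h 1] to exceed
   1; the recurrence then descends to [g]. *)
pose h n := (a * b * t)^-1 * q ^ (i - Posz N.+1 + Posz n).
have hS n : h n.+1 = q * h n.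
  by rewrite /h -[n.+1]addn1 PoszD addrA expfzDr // expr1z mulrA mulrC.
have h0 n : 0 < h n by apply: pos_dual_grid.
have hN1 : h N.+1 = g by rewrite /h subrK.
have hX n : h n = q ^+ n * h 0%N.
  by elim: n => [|n ih]; rewrite ?expr0 ?mul1r // hS ih exprS mulrA.
have h1 : 1 < h 1%N.
  by rewrite -(ltr_pM2l (good_qX_gt0 good N)) mulr1 hS mulrA -exprSr -hX hN1.
have h00 : 1 < h 0%N.
  by apply: lt_le_trans h1 _; rewrite hS ler_piMl ?(ltW (h0 _)) // ltW.
have gh n : grid q (a * b * t)^-1 (h n) by right; exists (i - Posz N.+1 + Posz n).
suff h2 n : far (meixner (h n)) /\ far (meixner (h n.+1)) by rewrite -hN1; case: (h2 N).
elim: n => [|n [ih1 ih2]]; first by split; apply: far_meixner_base.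
split=> //; rewrite (hS n.+1); apply: (far_meixner_step cplC good) => //.
- exact: lt0r_neq0.
- exact: lt0r_neq0 (coef_A_gt0 gd (gh _)).
by move=> _; rewrite (hS n) mulrC mulKf.
Qed.

Lemma far_meixner g : grid q (a * b * t)^-1 g -> far (meixner g).
Proof.
by move=> [[k _ <-]|[i _ <-]]; [apply: far_meixner_neg|apply: far_meixner_pos].
Qed.

End Growth.

(** * Orthogonality and norms of the eigenfunctions *)

Section Rows.
Context {C : numClosedFieldType} (cplC : sum_complete C).
Variables (q t a b : C).
Hypothesis good : good_parameters q t a b.
Implicit Types (x g : C).

Local Notation t' := (a * b * t)^-1.
Local Notation meixner := (mseries q a b).
Local Notation W := (grid_mass q t a b).
Local Notation gip := (grid_ip q t a b).

Let good' : good_parameters q t' a b := good_parameters_dual good.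
Let W0 : forall n, 0 < W n := W_gt0 cplC good.

Lemma meixner_domf g : grid q t' g -> domf q t a b (meixner g).
Proof. by move=> gg; apply: (tame_domf cplC good); apply: (far_meixner cplC good). Qed.

Lemma meixner_inL2 g : grid q t' g -> inL2 q t a b (meixner g).
Proof. by case/meixner_domf. Qed.

Lemma mu_real g : g \is Num.real -> (mu a b g)^* = mu a b g.
Proof.
move=> gr; apply/CrealP; rewrite rpredM ?rpredN ?rpredD ?rpred1 //.
exact: gtr0_real (good_ab_gt0 good).
Qed.

Lemma mu_inj : injective (mu a b).
Proof.
move=> g g' /mulfI h; apply: (addrI 1); apply: h.
by rewrite oppr_eq0 lt0r_neq0 // (good_ab_gt0 good).
Qed.

Lemma gip_mu g g' : grid q t' g -> grid q t' g' ->
  mu a b g * gip (meixner g) (meixner g') = (mu a b g')^* * gip (meixner g) (meixner g').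
Proof.
move=> gg gg'; have [dg dg'] := (meixner_domf gg, meixner_domf gg').
have [lg _ _ _] := dg; have [lg' _ _ _] := dg'.
have := Lf_symmetric cplC good dg dg'; rewrite /grid_ip.
have E h : (fun n => qop q a b (meixner h) (gpt q t n)) =
    fun n => mu a b h * meixner h (gpt q t n).
  apply/funext => n; rewrite (meixner_eigen cplC good) //.
  exact: (grid_neq0 good (gpt_gridP q t n)).
by rewrite !E (wipZl cplC W0) // (wipZr cplC W0).
Qed.

Lemma meixner_orth g g' : grid q t' g -> grid q t' g' -> g != g' ->
  gip (meixner g) (meixner g') = 0.
Proof.
move=> gg gg' ne; have := gip_mu gg gg'.
rewrite (mu_real (grid_real good' gg')) => /eqP.
rewrite -subr_eq0 -mulrBl mulf_eq0 subr_eq0 (inj_eq mu_inj) (negbTE ne) /=.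
by move/eqP.
Qed.

Lemma qmul_neq (x : C) n : x != 0 -> x != q ^+ n.+1 * x.
Proof.
move=> x0; rewrite -[X in X != _]mul1r (inj_eq (mulIf x0)) gt_eqF //.
by rewrite (qexp_lt1 (good_q good)).
Qed.

(* The norms are found from the dual equation, as the recurrence coefficients
   of an orthogonal system determine the ratio of consecutive norms. *)
Lemma meixner_norm_ratio g : grid q t' g ->
  msr q a b (q * g) * gip (meixner (q * g)) (meixner (q * g)) =
  msr q a b g * gip (meixner g) (meixner g).
Proof.
move=> gg; have gqg := grid_mulq good' gg; have gqqg := grid_mulq good' gqg.
have g0 := grid_neq0 good' gg; have qg0 := grid_neq0 good' gqg.
have dual h n : h != 0 -> mu a b (gpt q t n) * meixner h (gpt q t n) =
    coef_A a b h * meixner (q * h) (gpt q t n) +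
    ((- coef_A a b h - coef_B q h) * meixner h (gpt q t n) +
     coef_B q h * meixner (h / q) (gpt q t n)).
  move=> h0; have := meixner_eigen cplC good (gpt q t n) h0.
  by rewrite (meixnerC q a b h) => <-; rewrite /qop !(meixnerC q a b (gpt q t n)); ring.
(* [G] stands for the eigenfunction at [g / q]. For [g = -1] that point is off the dual grid, and
   since its coefficient is 0 the zero function takes its place. *)
have [G [lG GqG BG]] : exists G : nat -> C, [/\ l2 W G,
    wip W G (fun n => meixner (q * g) (gpt q t n)) = 0 &
    forall n, coef_B q g * meixner (g / q) (gpt q t n) = coef_B q g * G n].
  case: (grid_divq good' gg) => [->|ggq].
    exists (fun=> 0); split; first by apply: (@l2_fin _ _ _ 0).
      by rewrite /wip (@csum_fin _ _ 0) ?big_nil // => n _; rewrite !mul0r.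
    by move=> n; rewrite coef_B_m1 !mul0r.
  exists (fun n => meixner (g / q) (gpt q t n)); split=> //; first exact: meixner_inL2.
  apply: meixner_orth => //; have gq0 := grid_neq0 good' ggq.
  have := qmul_neq 1 gq0; rewrite [q ^+ 2 * _]mulrC expr2 mulrA divfK ?(good_q_neq0 good) //.
  by rewrite [g * q]mulrC.
have lg := meixner_inL2 gg; have lqg := meixner_inL2 gqg; have lqqg := meixner_inL2 gqqg.
set f := fun n => meixner g (gpt q t n); set f1 := fun n => meixner (q * g) (gpt q t n).
set f2 := fun n => meixner (q * (q * g)) (gpt q t n).
have o01 : wip W f f1 = 0.
  by apply: meixner_orth => //; have := qmul_neq 0 g0; rewrite expr1.
have o02 : wip W f f2 = 0.
  by apply: meixner_orth => //; have := qmul_neq 1 g0; rewrite expr2 -mulrA.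
have e1 : wip W (fun n => mu a b (gpt q t n) * f n) f1 = coef_A a b g * wip W f1 f1.
  have -> : (fun n => mu a b (gpt q t n) * f n) = fun n => coef_A a b g * f1 n +
     ((- coef_A a b g - coef_B q g) * f n + coef_B q g * G n).
    by apply/funext => n; rewrite -BG /f dual.
  have lBG := l2Z (coef_B q g) lG.
  rewrite (wip_linl cplC W0) //; last exact: (l2_lin W0).
  by rewrite (wip_linl cplC W0) // (wipZl cplC W0) // GqG o01 !mulr0 !addr0.
have e2 : wip W f (fun n => mu a b (gpt q t n) * f1 n) = coef_B q (q * g) * wip W f f.
  have -> : (fun n => mu a b (gpt q t n) * f1 n) = fun n => coef_A a b (q * g) * f2 n +
     ((- coef_A a b (q * g) - coef_B q (q * g)) * f1 n + coef_B q (q * g) * f n).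
    apply/funext => n; rewrite /f1 dual //.
    by rewrite [q * g / q]mulrAC divff ?(good_q_neq0 good) // mul1r.
  have lBG := l2Z (coef_B q (q * g)) lg.
  rewrite (wip_linr cplC W0) //; last exact: (l2_lin W0).
  rewrite (wip_linr cplC W0) // (wipZr cplC W0) // o02 o01 !mulr0 !add0r.
  by rewrite (coef_B_real good').
(* Multiplication by the real function [mu] is symmetric; its matrix entry between [g] and [q * g],
   computed on either side, compares the two norms. *)
have e3 : wip W (fun n => mu a b (gpt q t n) * f n) f1 =
    wip W f (fun n => mu a b (gpt q t n) * f1 n).
  congr csum; apply/funext => n; rewrite rmorphM /= mu_real; first by ring.
  exact: (grid_real good (gpt_gridP q t n)).
apply: (mulfI (lt0r_neq0 (coef_A_gt0 good' gg))); rewrite [LHS]mulrCA -[X in _ * X]e1 e3 e2.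
by rewrite mulrA (msr_balance cplC good' gg) mulrAC mulrC mulrA.
Qed.

(** Norm times dual mass is invariant under [g -> q g], and up to this the dual grid consists of -1
    and [t']; so two values bound all. Their equality is left to [row_const]. *)
Lemma meixner_norm_bounded : exists kmax, forall m,
  gip (meixner (gpt q t' m)) (meixner (gpt q t' m)) * msr q a b (gpt q t' m) <= kmax.
Proof.
pose N g := msr q a b g * gip (meixner g) (meixner g).
have N0 g : grid q t' g -> 0 <= N g.
  move=> gg; apply: mulr_ge0; first exact: ltW (msr_gt0 cplC good' gg).
  by apply: (wip_ge0 cplC W0); apply: meixner_inL2.
have step g : grid q t' g -> N (q * g) = N g by apply: meixner_norm_ratio.
have iter g n : grid q t' g -> N (q ^+ n * g) = N g.
  move=> gg; elim: n => [|n ih]; first by rewrite expr0 mul1r.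
  by rewrite exprS -mulrA step //; apply: (grid_mulqX good').
have gm : grid q t' (-1) by left; exists 0%N.
have gt : grid q t' t' by have := tqX_grid q t' 0; rewrite mulr1.
exists (N (-1) + N t') => m; rewrite mulrC -[X in X <= _]/(N _); elim/mul3_ind: m => k; rewrite gptE.
- by rewrite -[- q ^+ k]mulrN1 iter // lerDl N0.
- by rewrite mulrC iter // lerDr N0.
have gk := tqV_grid q t' k; have := iter _ k.+1 gk.
by rewrite mulrC divfK ?lt0r_neq0 ?(good_qX_gt0 good) // => ->; rewrite lerDr N0.
Qed.

End Rows.

(** * The kernel on the grid and its dual *)

Section MeixnerKernel.
Context {C : numClosedFieldType} (cplC : sum_complete C).
Variables (q t a b : C).
Hypothesis good : good_parameters q t a b.

Local Notation t' := (a * b * t)^-1.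
Local Notation W := (grid_mass q t a b).
Local Notation V := (grid_mass q t' a b).

Let good' : good_parameters q t' a b := good_parameters_dual good.

Definition mkernel m n : C := mseries q a b (gpt q t' m) (gpt q t n).

(** Duality is an involution, so facts about columns are facts about rows of the dual problem. *)
Lemma dual_dual : (a * b * t')^-1 = t.
Proof. by rewrite invfM invrK mulKf // lt0r_neq0 // (good_ab_gt0 good). Qed.

Lemma mkernel_real m n : (mkernel m n)^* = mkernel m n.
Proof.
apply: (meixner_real cplC good); apply: CrealP.
  exact: (grid_real good' (gpt_gridP q t' m)).
exact: (grid_real good (gpt_gridP q t n)).
Qed.

Lemma mkernel_rowl2 m : l2 W (mkernel m).
Proof. exact: (meixner_inL2 cplC good (gpt_gridP q t' m)). Qed.

Lemma mkernel_colE n : mkernel^~ n = fun m => mseries q a b (gpt q t n) (gpt q t' m).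
Proof. by apply/funext => m; rewrite /mkernel meixnerC. Qed.

Lemma mkernel_coll2 n : l2 V (mkernel^~ n).
Proof.
rewrite mkernel_colE; apply: (meixner_inL2 cplC good').
by rewrite dual_dual; apply: gpt_gridP.
Qed.

Lemma mkernel_row_orth m m' : m != m' -> wip W (mkernel m) (mkernel m') = 0.
Proof.
move=> ne; apply: (meixner_orth cplC good); [exact: gpt_gridP|exact: gpt_gridP|].
by rewrite (inj_eq (gpt_inj good')).
Qed.

Lemma mkernel_col_orth n n' : n != n' -> wip V (mkernel^~ n) (mkernel^~ n') = 0.
Proof.
move=> ne; rewrite !mkernel_colE; apply: (meixner_orth cplC good').
- by rewrite dual_dual; apply: gpt_gridP.
- by rewrite dual_dual; apply: gpt_gridP.
by rewrite (inj_eq (gpt_inj good)).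
Qed.

Lemma mkernel_row_le : exists kV, forall m, wip W (mkernel m) (mkernel m) * V m <= kV.
Proof. exact: (meixner_norm_bounded cplC good). Qed.

Lemma mkernel_col_le : exists kW, forall n,
  wip V (mkernel^~ n) (mkernel^~ n) * W n <= kW.
Proof.
have [k hk] := meixner_norm_bounded cplC good'; exists k => n.
by rewrite !mkernel_colE; have := hk n; rewrite dual_dual.
Qed.

Lemma mkernel_row0 n : mkernel 0 n = 1.
Proof. by rewrite /mkernel (gpt_mul3 q t' 0) expr0 meixnerC meixner_m1. Qed.

Lemma mkernel_col0 m : mkernel m 0 = 1.
Proof. by rewrite /mkernel (gpt_mul3 q t 0) expr0 meixner_m1. Qed.

End MeixnerKernel.

Lemma cvg_series_ge0 {C : numClosedFieldType} (cplC : sum_complete C) (u : nat -> C) :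
  (forall n, 0 <= u n) -> cvgn (series u) <-> asum u.
Proof.
move=> u0; split=> [h|]; last exact: cplC.
have [B hB] := seq_cvg_bounded h; exists B => n; apply: le_trans (hB n).
rewrite /series /= ger0_norm ?sumr_ge0 //.
by apply: ler_sum => k _; rewrite ger0_norm.
Qed.

(** * Self-adjointness and spectrum *)

Section GridFunctions.
Context {C : numClosedFieldType} (cplC : sum_complete C).
Variables (q t a b : C).
Hypothesis good : good_parameters q t a b.
Implicit Types (x : C) (F G : C -> C) (f g : Fq q t).

Local Notation W := (grid_mass q t a b).
Local Notation Lf := (qop q a b).
Local Notation gip := (grid_ip q t a b).
Local Notation inL2 := (inL2 q t a b).
Local Notation domf := (domf q t a b).
Local Notation ext := (valL_ 0).

Let W0 : forall n, 0 < W n := W_gt0 cplC good.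

Lemma ext_val f (x : grid q t) : ext f (val x) = f x.
Proof. exact: (congr1 (@^~ x) (valLK 0 f)). Qed.

Definition on_grid F : Fq q t := fun y : grid q t => F (val y).

Lemma ext_res F x : grid q t x -> ext (on_grid F) x = F x.
Proof. by move=> gx; rewrite -[x]/(val (SigSub (mem_set gx))) ext_val. Qed.

Lemma ext_lin (c : C) f g x : grid q t x -> ext (c *: f + g) x = c * ext f x + ext g x.
Proof. by move=> gx; rewrite -[x]/(val (SigSub (mem_set gx))) !ext_val. Qed.

Lemma ext_inj f g : (forall n, ext f (gpt q t n) = ext g (gpt q t n)) -> f = g.
Proof.
move=> h; apply/funext => x; have /grid_gpt[n xn] := set_mem (valP x).
by rewrite -(ext_val f) -(ext_val g) -xn.
Qed.

(** At [x = -1] the point [x / q] is off the grid, but there [coef_B] vanishes. *)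
Lemma Lf_ext F G x : (forall y, grid q t y -> F y = G y) -> grid q t x -> Lf F x = Lf G x.
Proof.
move=> FG gx; rewrite /qop (FG _ gx) (FG _ (grid_mulq good gx)).
case: (grid_divq good gx) => [->|gxq]; first by rewrite coef_B_m1 !mul0r.
by rewrite (FG _ gxq).
Qed.

Lemma ext_L f x : grid q t x -> ext (L q t a b f) x = Lf (ext f) x.
Proof.
move=> gx; rewrite -[x]/(val (SigSub (mem_set gx))) ext_val /L /qop.
by rewrite -(ext_val f).
Qed.

Lemma inL2_ext F G : (forall y, grid q t y -> F y = G y) -> inL2 F -> inL2 G.
Proof.
by move=> FG; apply: eq_asum => n; rewrite FG //; apply: gpt_gridP.
Qed.

Lemma same_limit_ext F G : (forall y, grid q t y -> F y = G y) ->
  same_limit_at0 q t F -> same_limit_at0 q t G.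
Proof.
move=> FG /same_limit_at0P[l [h1 h2]]; apply/same_limit_at0P; exists l; split.
  by apply: (seq_cvg_ext _ h1) => k; rewrite FG //; apply: nqX_grid.
by apply: (seq_cvg_ext _ h2) => k; rewrite FG //; apply: tqX_grid.
Qed.

Lemma domf_ext F G : (forall y, grid q t y -> F y = G y) -> domf F -> domf G.
Proof.
move=> FG [h1 h2 h3 h4]; split.
- exact: inL2_ext FG h1.
- by apply: inL2_ext h2 => y gy; apply: Lf_ext.
- exact: same_limit_ext FG h3.
- apply: same_limit_ext h4 => y gy; rewrite /Dq FG // FG //.
  exact: (grid_mulq good).
Qed.

Lemma gip_ext F G F' G' : (forall y, grid q t y -> F y = F' y) ->
  (forall y, grid q t y -> G y = G' y) -> gip F G = gip F' G'.
Proof.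
move=> FF GG; congr csum; apply/funext => n.
by rewrite FF ?GG //; apply: gpt_gridP.
Qed.

Lemma HtP f : Ht q t a b f <-> inL2 (ext f).
Proof.
have q0 := good_q_gt0 good; have t0 := good_t_gt0 good.
have o0 := one_sub_q_gt0 good; have on0 := lt0r_neq0 o0.
pose u x := `|ext f x| ^+ 2 * weight a b q x.
have u0 x : grid q t x -> 0 <= u x.
  by move=> gx; rewrite mulr_ge0 ?exprn_ge0 // ltW // (weight_gt0 cplC good).
have key (v w : nat -> C) : (forall k, w k = (1 - q) * v k) -> asum v <-> asum w.
  move=> e; split=> [/(asumZ (1 - q))|/(asumZ (1 - q)^-1)]; apply: eq_asum => k.
    by rewrite e.
  by rewrite e mulKf.
have n0 k : 0 <= u (- q ^+ k) * q ^+ k.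
  by rewrite mulr_ge0 ?u0 ?(ltW (good_qX_gt0 good _)) //; left; exists k.
have p0 (k : int) : 0 <= u (t * q ^ k) * (t * q ^ k).
  apply: mulr_ge0; first by apply: u0; right; exists k.
  by rewrite mulr_ge0 ?exprz_ge0 // ltW.
have c1 := cvg_series_ge0 cplC n0.
have c2 := cvg_series_ge0 cplC (fun n => p0 (Posz n)).
have c3 := cvg_series_ge0 cplC (fun n => p0 (Negz n)).
have k1 : asum (fun k => u (- q ^+ k) * q ^+ k) <->
    asum (fun k => `|ext f (- q ^+ k)| ^+ 2 * msr q a b (- q ^+ k)).
  by apply: key => k; rewrite /u /msr normrN (gtr0_norm (good_qX_gt0 good k)); ring.
have k2 : asum (fun k : nat => u (t * q ^ Posz k) * (t * q ^ Posz k)) <->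
    asum (fun k => `|ext f (t * q ^+ k)| ^+ 2 * msr q a b (t * q ^+ k)).
  apply: key => k; rewrite /u /msr -[q ^ Posz k]/(q ^+ k).
  by rewrite (gtr0_norm (mulr_gt0 t0 (good_qX_gt0 good k))); ring.
have k3 : asum (fun k : nat => u (t * q ^ Negz k) * (t * q ^ Negz k)) <->
    asum (fun k => `|ext f (t / q ^+ k.+1)| ^+ 2 * msr q a b (t / q ^+ k.+1)).
  apply: key => k; rewrite /u /msr NegzE -exprnN.
  by rewrite (gtr0_norm (divr_gt0 t0 (good_qX_gt0 good k.+1))); ring.
rewrite inL2P; split=> [[/c1/k1 h1 [/c2/k2 h2 /c3/k3 h3]]|[/k1/c1 h1 /k2/c2 h2 /k3/c3 h3]] //.
Qed.

Lemma innerE f g : Ht q t a b f -> Ht q t a b g -> inner q t a b f g = gip (ext f) (ext g).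
Proof.
move=> /HtP lf /HtP lg; have t0 := good_t_gt0 good; have on0 := lt0r_neq0 (one_sub_q_gt0 good).
have s := wip_asum W0 lf lg; rewrite /grid_ip /wip (csum_mul3 cplC s).
have [s1 s2 s3] := (asum_mul3 _).1 s; rewrite /inner /jackson /sumZ mulrDr addrA.
have key (v w : nat -> C) : asum w -> (forall k, w k = (1 - q) * v k) ->
    (1 - q) * limn (series v) = csum w.
  move=> sw e; have sv : asum v.
    by apply: (eq_asum _ (asumZ (1 - q)^-1 sw)) => k; rewrite e mulKf.
  rewrite -[limn _]/(csum v) -(csumZ cplC _ sv); congr csum; apply/funext => k.
  by rewrite e.
congr (_ + _ + _); apply: key => // k; rewrite gptE /grid_mass /msr ?gptE.
- by rewrite normrN (gtr0_norm (good_qX_gt0 good k)); ring.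
- by rewrite (gtr0_norm (mulr_gt0 t0 (good_qX_gt0 good k))) -[q ^ Posz k]/(q ^+ k); ring.
- by rewrite (gtr0_norm (divr_gt0 t0 (good_qX_gt0 good k.+1))) NegzE -exprnN; ring.
Qed.

Lemma domLP f : domL q t a b f <-> domf (ext f).
Proof.
have e := @ext_L f; have e' y (gy : grid q t y) := esym (e y gy).
by split=> -[/HtP h1]; [move=> /HtP/(inL2_ext e)|move=> /(inL2_ext e')/HtP].
Qed.

Lemma Ht_lin (c : C) f g : Ht q t a b f -> Ht q t a b g -> Ht q t a b (c *: f + g).
Proof.
move=> /HtP lf /HtP lg; apply/HtP; apply: (eq_asum _ (l2_lin W0 c lf lg)) => n.
by rewrite ext_lin //; apply: gpt_gridP.
Qed.

Lemma res_Ht F : inL2 F -> Ht q t a b (on_grid F).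
Proof. by move=> h; apply/HtP; apply: inL2_ext h => y gy; rewrite ext_res. Qed.

Lemma res_domL F : domf F -> domL q t a b (on_grid F).
Proof. by move=> h; apply/domLP; apply: domf_ext h => y gy; rewrite ext_res. Qed.

(** Turns a sequence on the enumeration into a function on [C], with default value 0 off the grid;
    [gpt_inj] makes the chosen index immaterial. *)
Definition interp (s : nat -> C) : C -> C := fun x =>
  match pselect (exists n, gpt q t n = x) with
  | left h => s (projT1 (cid h))
  | right _ => 0
  end.

Lemma interpE s n : interp s (gpt q t n) = s n.
Proof.
rewrite /interp; case: pselect => [h|[]]; last by exists n.
by congr s; apply: (gpt_inj good); apply: (projT2 (cid h)).
Qed.

(** Neighbours within a branch are three indices apart. The offset 3 skips the first point of each
    branch, which has a neighbour on another branch or off the grid. *)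
Lemma gpt_neighbours n : exists m m',
  [/\ q * gpt q t n.+3 = gpt q t m, gpt q t n.+3 / q = gpt q t m', (n <= m)%N & (n <= m')%N].
Proof.
have qn0 := good_q_neq0 good.
have qV k : q * (t / q ^+ k.+1) = t / q ^+ k by rewrite exprS invfM mulrCA mulVKf.
elim/mul3_ind: n => k.
- exists (3 * k.+2)%N, (3 * k)%N.
  rewrite -[(3 * k).+3](_ : 3 * k.+1 = _)%N; last by rewrite mulnS addnC !addnS addn0.
  rewrite !gptE; split=> //; first by rewrite [q ^+ k.+2]exprS mulrN.
    by rewrite exprSr mulNr mulfK.
  by rewrite leq_mul2l leqW ?leqW ?orbT.
- exists (3 * k.+2).+1, (3 * k).+1.
  rewrite -[(3 * k).+4](_ : (3 * k.+1).+1 = _)%N; last by rewrite mulnS addnC !addnS addn0.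
  rewrite !gptE; split=> //; first by rewrite [q ^+ k.+2]exprS mulrCA.
    by rewrite exprSr mulrA mulfK.
  by rewrite ltnS leq_mul2l leqW ?leqW ?orbT.
exists (3 * k).+2, (3 * k.+2).+2.
rewrite -[(3 * k).+2.+3](_ : (3 * k.+1).+2 = _)%N; last by rewrite mulnS addnC !addnS addn0.
rewrite !gptE; split=> //; try exact: qV.
  by rewrite -mulrA -invfM -exprSr.
by rewrite !ltnS leq_mul2l leqW ?leqW ?orbT.
Qed.

(** * Finitely supported functions *)

Section FiniteSupport.
Variables (F : C -> C) (N : nat).
Hypothesis FN : forall n, (N <= n)%N -> F (gpt q t n) = 0.

Lemma Lf_fin n : (N + 3 <= n)%N -> Lf F (gpt q t n) = 0.
Proof.
move=> nN; have := gpt_neighbours (n - 3).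
have n3 : (n - 3).+3 = n by rewrite -addn3 subnK // (leq_trans _ nN) // leq_addl.
rewrite n3 => -[m [m' [e e' hm hm']]].
have Nn3 : (N <= n - 3)%N by rewrite leq_subRL ?(leq_trans _ nN) ?leq_addl // addnC.
have Nn : (N <= n)%N by rewrite (leq_trans _ nN) // leq_addr.
have [Nm Nm'] := (leq_trans Nn3 hm, leq_trans Nn3 hm').
by rewrite /qop e e' !FN // subrr !mulr0 addr0.
Qed.

Lemma fin_domf : domf F.
Proof.
have lim0 (u : nat -> C) : (forall k, (N <= k)%N -> u k = 0) -> u @ \oo --> (0 : C).
  by move=> h; apply: (@seq_cvg_near _ (fun=> 0) _ _ N) (seq_cvg_cst _) => k /h ->.
have le3 k j : (N <= k)%N -> (N <= 3 * k + j)%N.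
  by move=> h; rewrite (leq_trans h) // (leq_trans _ (leq_addr _ _)) // leq_pmull.
have F0 k : (N <= k)%N -> F (- q ^+ k) = 0.
  by move=> h; have := FN (le3 k 0 h); rewrite addn0 gptE.
have F1 k : (N <= k)%N -> F (t * q ^+ k) = 0.
  by move=> h; have := FN (le3 k 1 h); rewrite addn1 gptE.
split; [exact: l2_fin FN|by apply: l2_fin Lf_fin| |];
  apply/same_limit_at0P; exists 0; split; apply: lim0 => k Nk.
- exact: F0.
- exact: F1.
- by rewrite /Dq F0 // mulrN -exprS F0 ?leqW // subrr mul0r.
- by rewrite /Dq F1 // mulrCA -exprS F1 ?leqW // subrr mul0r.
Qed.

(** [G] is arbitrary: far out, every boundary term of Green's formula contains a vanishing value of
    [F]. So point masses can test [G] before its image is known to be square integrable. *)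
Lemma fin_symmetric G : gip (Lf F) G = gip F (Lf G).
Proof.
pose M := (3 * (N + 3).+1)%N.
have MN n : (M <= n)%N -> (N + 3 <= n)%N.
  by apply: leq_trans; rewrite (leq_trans (leqnSn _)) // leq_pmull.
rewrite /grid_ip /wip (@csum_fin _ _ M) => [|n /MN h]; last by rewrite Lf_fin // !mul0r.
rewrite (@csum_fin _ _ M) => [|n /MN h]; last first.
  by rewrite FN ?mul0r // (leq_trans _ h) // leq_addr.
apply/eqP; rewrite -subr_eq0 -sumrB; under eq_bigr do rewrite -mulrBl.
rewrite (green_partial cplC good) /casorati.
have le3 k j : (N <= k)%N -> (N <= 3 * k + j)%N.
  by move=> h; rewrite (leq_trans h) // (leq_trans _ (leq_addr _ _)) // leq_pmull.
have F0 k : (N <= k)%N -> F (- q ^+ k) = 0.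
  by move=> h; have := FN (le3 k 0 h); rewrite addn0 gptE.
have F1 k : (N <= k)%N -> F (t * q ^+ k) = 0.
  by move=> h; have := FN (le3 k 1 h); rewrite addn1 gptE.
have F2 k : (N <= k)%N -> F (t / q ^+ k.+1) = 0.
  by move=> h; have := FN (le3 k 2 h); rewrite addn2 gptE.
have qn0 := good_q_neq0 good.
have -> : q * (t / q ^+ (N + 3).+2) = t / q ^+ (N + 3).+1.
  by rewrite [q ^+ _.+2]exprS invfM mulrCA mulVKf.
have hN j : (N <= N + j)%N by rewrite leq_addr.
have -> : q * - q ^+ (N + 3) = - q ^+ (N + 3).+1 by rewrite mulrN exprS.
have -> : q * (t * q ^+ (N + 3)) = t * q ^+ (N + 3).+1 by rewrite mulrCA exprS.
have hN1 j : (N <= (N + j).+1)%N by rewrite leqW.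
by rewrite !F0 // !F1 // !F2 // !mul0r !subrr !mulr0 addr0 subrr.
Qed.

End FiniteSupport.

End GridFunctions.

(** * The q-Meixner transform and the spectral decomposition *)

Section MeixnerSpectrum.
Context {C : numClosedFieldType} (cplC : sum_complete C).
Variables (q t a b : C).
Hypothesis good : good_parameters q t a b.
Implicit Types (x : C) (F G : C -> C) (f g : Fq q t).

Local Notation t' := (a * b * t)^-1.
Local Notation W := (grid_mass q t a b).
Local Notation V := (grid_mass q t' a b).
Local Notation Lf := (qop q a b).
Local Notation gip := (grid_ip q t a b).
Local Notation inL2 := (inL2 q t a b).
Local Notation domf := (domf q t a b).
Local Notation ext := (valL_ 0).
Local Notation H := (Ht q t a b).
Local Notation ip := (inner q t a b).
Local Notation T := (L q t a b).
Local Notation D := (domL q t a b).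
Local Notation phi := (phi_fun q t a b).
Local Notation meixner := (mseries q a b).

Let W0 : forall n, 0 < W n := W_gt0 cplC good.
Let good' : good_parameters q t' a b := good_parameters_dual good.
Let V0 : forall n, 0 < V n := W_gt0 cplC good'.

Let gm1 : grid q t' (-1). Proof. by left; exists 0%N. Qed.

Lemma domf_meixner (g : C) : grid q t' g -> domf (meixner g).
Proof. exact: (meixner_domf cplC good). Qed.

Lemma domf1 : domf (fun=> 1).
Proof.
apply: (domf_ext good _ (domf_meixner gm1)) => y _.
by rewrite meixnerC meixner_m1.
Qed.

Lemma domf_lin (c : C) F G : domf F -> domf G -> domf (fun x => c * F x + G x).
Proof.
move=> [lF lLF /same_limit_at0P[f0 [F0 F0']] /same_limit_at0P[f1 [F1 F1']]].
move=> [lG lLG /same_limit_at0P[g0 [G0 G0']] /same_limit_at0P[g1 [G1 G1']]].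
have DqE x : Dq q (fun x => c * F x + G x) x = c * Dq q F x + Dq q G x.
  by rewrite /Dq mulrA -mulrDl; congr (_ / _); ring.
split; first exact: (l2_lin W0).
- apply: (eq_asum _ (l2_lin W0 c lLF lLG)) => n; congr (`|_| ^+ 2 * _).
  by rewrite /qop; ring.
- apply/same_limit_at0P; exists (c * f0 + g0); split.
    exact: seq_cvgD (seq_cvgZ c F0) G0.
  exact: seq_cvgD (seq_cvgZ c F0') G0'.
- apply/same_limit_at0P; exists (c * f1 + g1); split.
    by apply: (seq_cvg_ext _ (seq_cvgD (seq_cvgZ c F1) G1)) => k; rewrite DqE.
  by apply: (seq_cvg_ext _ (seq_cvgD (seq_cvgZ c F1') G1')) => k; rewrite DqE.
Qed.

(* The eigenfunction for [gamma = -q] is a polynomial of degree one. *)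
Lemma domf_x : domf (fun x => x + 1).
Proof.
have gq : grid q t' (- q) by left; exists 1%N; rewrite ?expr1.
have mcoef0 : mcoef q a b 0 = 1 by rewrite /mcoef !expr0 !qpoch0 !mulr1 invr1 mulr1.
pose c1 := mcoef q a b 1 * shpow q 1 (- q).
have c10 : c1 != 0.
  have e : (1 - q ^+ 1) * mcoef q a b 1 != 0.
    rewrite (mcoefS good) mcoef0 mulr1 oppr_eq0 mulf_neq0 //.
      by rewrite expr0 mul1r lt0r_neq0 // (good_ab_gt0 good).
    by rewrite mulf_neq0 // invr_eq0 ?(oma_neq0 good) ?(omb_neq0 good).
  rewrite mulf_neq0 //; first by apply: contraNneq e => ->; rewrite mulr0.
  by rewrite shpowS shpow0 mulr1 expr0 addrC lt0r_neq0 // (one_sub_q_gt0 good).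
have mE y : meixner (- q) y = 1 + c1 * (y + 1).
  have h n : (2 <= n)%N -> mcoef q a b n * shpow q n (- q) * shpow q n y = 0.
    case: n => [|[|n]] // _; suff -> : shpow q n.+2 (- q) = 0 by rewrite mulr0 mul0r.
    elim: n => [|n ih]; first by rewrite shpowS expr1 addNr mul0r.
    by rewrite shpowS ih mulr0.
  rewrite /mseries (csum_fin h) !big_nat_recr //= big_nil add0r !shpow0.
  by rewrite mcoef0 !mulr1; congr (_ + _ * _); rewrite shpowS shpow0 mulr1 expr0.
have := domf_lin (- c1^-1) domf1 (domf_lin (c1^-1 - 1) (domf_meixner gq) (domf_meixner gq)).
apply: (domf_ext good) => y _; rewrite !mE; field.
by rewrite c10.
Qed.

Lemma domL_Ht : D `<=` H.
Proof. by move=> f []. Qed.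

Lemma linear_L : linear_operator H D T.
Proof.
have Df0 : domf (fun=> 0).
  by apply: (@fin_domf _ _ _ _ _ good _ 0).
split.
- apply/(domLP cplC good); apply: (domf_ext good _ Df0) => y gy.
  by rewrite -[y]/(val (SigSub (mem_set gy))) ext_val.
- move=> c f g /(domLP cplC good) df /(domLP cplC good) dg; apply/(domLP cplC good).
  by apply: (domf_ext good _ (domf_lin c df dg)) => y gy; rewrite ext_lin.
- by move=> f [].
move=> c f g df dg; apply: ext_inj => n; have gn := gpt_gridP q t n.
rewrite ext_lin // !ext_L // (Lf_ext good (ext_lin c f g) gn).
by rewrite /qop; ring.
Qed.

Lemma ip_selfE f : H f -> ip f f = wip W (fun n => ext f (gpt q t n)) (fun n => ext f (gpt q t n)).
Proof. by move=> Hf; rewrite (innerE cplC good). Qed.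

Lemma dense_domL : dense_in H ip D.
Proof.
split=> [|f Hf e e0]; first exact: domL_Ht.
have lf := (HtP cplC good f).1 Hf.
have e2 : 0 < (e / 2) ^+ 2 by rewrite exprn_gt0 // divr_gt0.
have [N /(_ N (leqnn N)) hN] := (seq_cvgP _ _).1 (tail_cvg0 cplC W0 lf) _ e2.
pose s := truncate N (fun n => ext f (gpt q t n)).
have Dg : D (on_grid (interp q t s) : Fq q t).
  apply: (res_domL cplC good); apply: (@fin_domf _ _ _ _ _ good _ N) => n Nn.
  by rewrite (interpE good) /s /truncate ltnNge Nn.
exists (on_grid (interp q t s)) => //; have Hg := domL_Ht Dg.
have Hfg : H (f - on_grid (interp q t s)).
  by rewrite addrC -scaleN1r; apply: (Ht_lin cplC good).
have e3 : ip_norm ip (f - on_grid (interp q t s)) <= e / 2.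
  have e20 : 0 <= e / 2 by rewrite divr_ge0 // ltW.
  rewrite /ip_norm -(sqrCK e20) ler_sqrtC ?qualifE /= ?ip_selfE ?(ltW e2) //; last first.
    by apply: (wip_ge0 cplC W0); apply/(HtP cplC good).
  rewrite sub0r normrN in hN; apply: le_trans hN; rewrite ger0_norm; last first.
    by apply: (wip_ge0 cplC W0); apply: (l2B W0) => //; apply: l2_trunc.
  rewrite le_eqVlt; apply/orP; left; apply/eqP; congr wip; apply/funext => n;
    rewrite -[f - _]addrC -scaleN1r ext_lin ?mulN1r; try exact: gpt_gridP;
    by rewrite ext_res ?(interpE good) 1?addrC //; apply: gpt_gridP.
by rewrite (le_lt_trans e3) // ltr_pdivrMr // ltr_pMr // ltr1n.
Qed.

Lemma delta_fin n m : (n.+1 <= m)%N ->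
  interp q t (fun k => (k == n)%:R : C) (gpt q t m) = 0.
Proof. by move=> nm; rewrite (interpE good) gtn_eqF. Qed.

Lemma gip_delta n G : gip (interp q t (fun k => (k == n)%:R : C)) G =
  (G (gpt q t n))^* * W n.
Proof.
rewrite /grid_ip /wip (@csum1 _ _ n) => [|m mn]; rewrite (interpE good).
  by rewrite eqxx mul1r.
by rewrite (negbTE mn) !mul0r.
Qed.

Theorem self_adjoint_L : self_adjoint H ip D T.
Proof.
split; [exact: linear_L|exact: dense_domL|].
apply/seteqP; split=> -[g h] /=; last first.
  move=> [/= Dg ->]; split=> /=; [exact: domL_Ht|by case: Dg|move=> f Df].
  have HTf : H (T f) by case: Df.
  have HTg : H (T g) by case: Dg.
  rewrite !(innerE cplC good) //; try exact: domL_Ht.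
  rewrite (gip_ext a b (fun y gy => ext_L a b f gy) (fun y gy => erefl (ext g y))).
  rewrite (gip_ext a b (fun y gy => erefl (ext f y)) (fun y gy => ext_L a b g gy)).
  by apply: (Lf_symmetric cplC good); apply/(domLP cplC good).
move=> [/= Hg Hh hyp].
have lg := (HtP cplC good g).1 Hg; have lh := (HtP cplC good h).1 Hh.
(* The adjoint relation is carried over from grid functions to functions on [C], for which Green's
   formula is stated. *)
have hypF F : domf F -> gip (Lf F) (ext g) = gip F (ext h).
  move=> dF; have Dr := res_domL cplC good dF; have := hyp _ Dr.
  rewrite !(innerE cplC good) //; [|exact: domL_Ht|by case: Dr].
  rewrite (gip_ext a b (F' := Lf F) (G' := ext g)) //; last first.
    move=> y gy; rewrite ext_L //; apply: (Lf_ext good) => // z gz.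
    by rewrite ext_res.
  have -> : gip (ext (on_grid F : Fq q t)) (ext h) = gip F (ext h).
    by apply: gip_ext => // y gy; rewrite ext_res.
  by [].
have Lgh y : grid q t y -> Lf (ext g) y = ext h y.
  (* A point mass at [n] reads off the conjugate of a value, so the adjoint relation becomes a
     pointwise equation. *)
  move=> /grid_gpt[n <-]; pose d := interp q t (fun k => (k == n)%:R : C).
  have := hypF d (fin_domf good (@delta_fin n)).
  rewrite (fin_symmetric cplC good (@delta_fin n)) !gip_delta.
  by move/(mulIf (lt0r_neq0 (W0 n)))/(can_inj conjCK).
have lLg : inL2 (Lf (ext g)) by apply: inL2_ext lh => y gy; rewrite Lgh.
have dg : domf (ext g).
  apply: (symmetric_same_limits cplC good) => //; [|exact: domf1|exact: domf_x].
  move=> F dF; rewrite hypF //; apply: gip_ext => // y gy.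
  by rewrite Lgh.
have Dg : D g by apply/(domLP cplC good).
split=> //=; apply: ext_inj => n; rewrite ext_L ?Lgh //; exact: gpt_gridP.
Qed.

(** The q-Meixner transform: inner products of [f] with the eigenfunctions, indexed by the dual
    grid. *)
Definition ftrans f : nat -> C := ktrans (mkernel q t a b) W (fun n => ext f (gpt q t n)).

Definition evalue m : C := mu a b (gpt q t' m).

Definition kconst : C := kernel_const W V (mkernel q t a b).

Let kreal := mkernel_real cplC good.
Let krow2 := mkernel_rowl2 cplC good.
Let kcol2 := mkernel_coll2 cplC good.
Let korow := mkernel_row_orth cplC good.
Let kocol := mkernel_col_orth cplC good.
Let krow0 := mkernel_row0 q t a b.
Let kcol0 := mkernel_col0 q t a b.

Lemma kconst_gt0 : 0 < kconst.
Proof. exact: (kernel_const_gt0 cplC W0 V0 krow2 krow0). Qed.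

Lemma ftransE f m : ftrans f m = gip (ext f) (meixner (gpt q t' m)).
Proof. by rewrite /ftrans (ktransE _ kreal). Qed.

Lemma ftrans_l2 f : H f -> l2 V (ftrans f).
Proof.
move=> /(HtP cplC good) lf; have [kW hW] := mkernel_col_le cplC good.
exact: (ktrans_l2 cplC W0 V0 kreal krow2 kcol2 kocol hW).
Qed.

Lemma ftrans_ip f g : H f -> H g -> wip V (ftrans f) (ftrans g) = kconst * ip f g.
Proof.
move=> Hf Hg; rewrite (innerE cplC good) //.
have [kW hW] := mkernel_col_le cplC good; have [kV hV] := mkernel_row_le cplC good.
have [lf lg] := ((HtP cplC good f).1 Hf, (HtP cplC good g).1 Hg).
exact: (ktrans_parseval cplC W0 V0 kreal krow2 kcol2 kocol korow hW hV krow0 lf lg).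
Qed.

Lemma ftrans_lin (c : C) f g m : H f -> H g ->
  ftrans (c *: f + g) m = c * ftrans f m + ftrans g m.
Proof.
move=> /(HtP cplC good) lf /(HtP cplC good) lg.
rewrite -(ktrans_lin cplC W0 kreal krow2 c m lf lg); congr csum.
by apply/funext => n; rewrite ext_lin //; apply: gpt_gridP.
Qed.

(** Completeness of the eigenfunctions: the adjoint kernel inverts the transform up to [kconst],
    which rests on orthogonality of the columns. *)
Lemma ftrans_inj f g : H f -> H g -> (forall m, ftrans f m = ftrans g m) -> f = g.
Proof.
move=> /(HtP cplC good) lf /(HtP cplC good) lg e; apply: ext_inj => n.
have [kW hW] := mkernel_col_le cplC good; have [kV hV] := mkernel_row_le cplC good.
have inv (F : nat -> C) :=
  @ktrans_invl _ cplC _ _ _ W0 V0 kreal krow2 kcol2 kocol korow _ hW krow0 F n.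
apply: (mulfI (lt0r_neq0 kconst_gt0)); rewrite -(inv _ lf) -(inv _ lg).
by congr csum; apply/funext => m; congr (_ * _ * _); apply: e.
Qed.

(** The preimage is the adjoint transform of [s] divided by [kconst]; this rests on orthogonality of
    the rows. *)
Lemma ftrans_surj s : l2 V s -> exists2 f, H f & forall m, ftrans f m = s m.
Proof.
move=> ls; have [kV hV] := mkernel_row_le cplC good.
pose f0 := ktrans (fun n m => mkernel q t a b m n) V s.
have l0 : l2 W f0 by apply: (ktrans_l2' cplC W0 V0 kreal krow2 kcol2 korow hV).
have l1 := l2Z kconst^-1 l0.
exists (on_grid (interp q t (fun n => kconst^-1 * f0 n))) => [|m].
  apply: (res_Ht cplC good); apply: eq_asum l1 => n.
  by rewrite (interpE good).
rewrite /ftrans -[RHS](mulKf (lt0r_neq0 kconst_gt0)).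
have [kW hW] := mkernel_col_le cplC good.
rewrite -(ktrans_invr cplC W0 V0 kreal krow2 kcol2 kocol korow hW hV krow0 kcol0 m ls).
rewrite (ktransE _ kreal) [in RHS](ktransE _ kreal) -(wipZl cplC W0) //; congr wip.
apply/funext => n; rewrite ext_res; last exact: gpt_gridP.
by rewrite (interpE good).
Qed.

Lemma ftrans_L f m : D f -> ftrans (T f) m = evalue m * ftrans f m.
Proof.
move=> Df; have df := (domLP cplC good f).1 Df; rewrite !ftransE.
have gm := gpt_gridP q t' m; have dm := meixner_domf cplC good gm.
have [lf _ _ _] := df; have [lm _ _ _] := dm.
rewrite (gip_ext a b (fun y gy => ext_L a b f gy) (fun y _ => erefl (meixner _ y))).
rewrite (Lf_symmetric cplC good df dm) -[evalue m]conjCK.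
rewrite /evalue (mu_real good (grid_real good' gm)) -(wipZr cplC W0) //.
congr wip; apply/funext => n.
by rewrite (meixner_eigen cplC good) // (grid_neq0 good (gpt_gridP q t n)).
Qed.

Lemma evalue_real m : (evalue m)^* = evalue m.
Proof. exact: (mu_real good (grid_real good' (gpt_gridP q t' m))). Qed.

Lemma evalue_inj : injective evalue.
Proof. by move=> m n /(mu_inj good)/(gpt_inj good'). Qed.

Let sa := self_adjoint_L.
Let Hlin := fun c f g => @Ht_lin _ cplC _ _ _ _ good c f g.

Lemma ext_scale (c : C) f x : grid q t x -> ext (c *: f) x = c * ext f x.
Proof. by move=> gx; rewrite -[x]/(val (SigSub (mem_set gx))) !ext_val. Qed.

Lemma phi_ext (g : C) x : g != 0 -> grid q t x -> ext (phi g) x = meixner g x.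
Proof.
move=> g0 gx; rewrite -[x]/(val (SigSub (mem_set gx))) ext_val /phi_fun.
by rewrite qMeixnerE // (grid_neq0 good gx).
Qed.

Lemma phi_eigen (g : C) : grid q t' g ->
  [/\ D (phi g), phi g != 0 & T (phi g) = mu a b g *: phi g].
Proof.
move=> gg; have g0 := grid_neq0 good' gg; have pE := phi_ext g0; split.
- apply/(domLP cplC good); apply: (domf_ext good _ (meixner_domf cplC good gg)) => y gy.
  by rewrite pE.
- have gm : grid q t (-1) by left; exists 0%N.
  apply/eqP => e; have := pE _ gm; rewrite e meixner_m1.
  rewrite -[-1]/(val (SigSub (mem_set gm))) ext_val => /esym/eqP.
  exact/negP/oner_neq0.
apply: ext_inj => n; have gn := gpt_gridP q t n.
rewrite ext_L // (Lf_ext good pE gn) (meixner_eigen cplC good) ?(grid_neq0 good gn) //.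
by rewrite ext_scale // pE.
Qed.

Lemma ip_ge0_Ht f : H f -> 0 <= ip f f.
Proof.
by move=> Hf; rewrite (innerE cplC good) //; apply: (wip_ge0 cplC W0); apply/(HtP cplC good).
Qed.

Lemma ip_eq0_Ht f : H f -> ip f f = 0 -> f = 0.
Proof.
move=> Hf; rewrite (innerE cplC good) // => /(wip_eq0 cplC W0 ((HtP cplC good f).1 Hf)) e.
apply: ext_inj => n; rewrite e; have gn := gpt_gridP q t n.
by rewrite -[gpt q t n]/(val (SigSub (mem_set gn))) ext_val.
Qed.

Lemma ipZ_Ht (c : C) f : H f -> ip (c *: f) (c *: f) = `|c| ^+ 2 * ip f f.
Proof.
move=> Hf; have [D0 _ _ _] := linear_L; have H0 := domL_Ht D0.
have Hc : H (c *: f) by rewrite -[c *: f]addr0; apply: Hlin.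
have lf := (HtP cplC good f).1 Hf.
rewrite !(innerE cplC good) // normCK -mulrA.
have e (y : C) : grid q t y -> ext (c *: f) y = c * ext f y by apply: ext_scale.
rewrite (gip_ext a b e e) /grid_ip (wipZl cplC W0) //; last exact: l2Z.
by rewrite (wipZr cplC W0).
Qed.

Lemma spectrum_eigen (g : C) : grid q t' g -> spectrum H ip D T (mu a b g).
Proof.
move=> gg; have [Dg g0 Tg] := phi_eigen gg.
apply: (@spectrum_eigenvalue_limit _ _ _ _ _ _ ip_ge0_Ht ip_eq0_Ht ipZ_Ht
  (fun=> phi g) (fun=> mu a b g)) => //; first exact: domL_Ht.
exact: seq_cvg_cst.
Qed.

(** 0 is off the dual grid but is the limit of its points [- q^n], so [mu 0] is a limit of
    eigenvalues. *)
Lemma spectrum_mu0 : spectrum H ip D T (mu a b 0).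
Proof.
apply: (@spectrum_eigenvalue_limit _ _ _ _ _ _ ip_ge0_Ht ip_eq0_Ht ipZ_Ht
  (fun n => phi (- q ^+ n)) (fun n => mu a b (- q ^+ n))) => [|n|]; first exact: domL_Ht.
  exact: phi_eigen (nqX_grid q t' n).
have := seq_cvgZ (- (a * b)) (seq_cvgB (seq_cvg_cst 1) (qexp_cvg0 cplC (good_q good))).
by rewrite /mu subr0 addr0.
Qed.

(** Two branches of the dual grid tend to 0 and the third to infinity, so a nonzero [z] off the grid
    keeps a positive distance from it. *)
Lemma resolvent_mu (z : C) : z != 0 -> ~ grid q t' z -> resolvent_set H ip D T (mu a b z).
Proof.
move=> z0 zg; have abn := lt0r_neq0 (good_ab_gt0 good).
have zm m : gpt q t' m - z != 0.
  by rewrite subr_eq0; apply: contra_notN zg => /eqP <-; apply: gpt_gridP.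
have [M hM] : exists M, forall m, `|(gpt q t' m - z)^-1| <= M.
  have cz u : (fun k => u * q ^+ k - z) @ \oo --> - z.
    rewrite -[X in _ --> X]add0r -(mulr0 u).
    exact: seq_cvgB (seq_cvgZ u (qexp_cvg0 cplC (good_q good))) (seq_cvg_cst z).
  have nz0 : - z != 0 by rewrite oppr_eq0.
  have [B1 h1] := seq_cvg_bounded (seq_cvgV nz0 (cz (-1))).
  have [B2 h2] := seq_cvg_bounded (seq_cvgV nz0 (cz t')).
  have t'0 : t' != 0 := good_t_neq0 good'.
  have q1 := (seq_cvg_shift 1 _ _).2 (qexp_cvg0 cplC (good_q good)).
  (* On the unbounded branch the inverse is rewritten as [q^(k + 1) / (t' - z q^(k + 1))], a
     convergent and hence bounded sequence. *)
  have c2 : (fun k => t' - z * q ^+ (k + 1)) @ \oo --> t'.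
    by have := seq_cvgB (seq_cvg_cst t') (seq_cvgZ z q1); rewrite mulr0 subr0.
  have c3 := seq_cvgM q1 (seq_cvgV t'0 c2).
  have [B3 h3] := seq_cvg_bounded c3.
  have B10 : 0 <= B1 by apply: le_trans (h1 0%N).
  have B20 : 0 <= B2 by apply: le_trans (h2 0%N).
  have B30 : 0 <= B3 by apply: le_trans (h3 0%N).
  exists (B1 + B2 + B3); elim/mul3_ind => k; rewrite gptE.
  - by have := h1 k; rewrite mulN1r => /le_trans; apply; rewrite -addrA lerDl addr_ge0.
  - by have := h2 k => /le_trans; apply; rewrite addrAC lerDr addr_ge0.
  have := h3 k; rewrite addn1 => h; apply: le_trans (le_trans h _); last first.
    by rewrite lerDr addr_ge0.
  rewrite le_eqVlt; apply/orP; left; apply/eqP; congr `|_|.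
  have Q0 := lt0r_neq0 (good_qX_gt0 good k.+1).
  have -> : t' - z * q ^+ k.+1 = (t' / q ^+ k.+1 - z) * q ^+ k.+1.
    by rewrite mulrBl divfK.
  by move: (_ - z) => u; rewrite invfM mulrCA mulfV // mulr1.
apply: (@resolvent_set_diag _ cplC _ _ _ _ _ sa Hlin ftrans V evalue kconst V0 kconst_gt0
  evalue_real ftrans_l2 ftrans_ip ftrans_surj ftrans_inj ftrans_lin ftrans_L _
  (`|(a * b)^-1| * M)) => m.
  by rewrite (inj_eq (mu_inj good)) -subr_eq0.
have -> : evalue m - mu a b z = - ((a * b) * (gpt q t' m - z)).
  by rewrite /evalue /mu; ring.
by rewrite invrN normrN invfM normrM ler_wpM2l.
Qed.

Lemma spectrum_L : spectrum H ip D T = [set mu a b 0] `|` mu a b @` grid q t'.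
Proof.
apply/seteqP; split=> [l hl|_ [->|[g gg <-]]]; [|exact: spectrum_mu0|exact: spectrum_eigen].
have abn := lt0r_neq0 (good_ab_gt0 good); pose z := - l / (a * b) - 1.
have lz : l = mu a b z by rewrite /mu /z subrKC mulNr mulrC divfK // opprK.
apply: contrapT => /not_orP[l0 lg]; apply: hl; rewrite lz; apply: resolvent_mu.
  by apply/eqP => e; apply: l0; rewrite /= lz e.
by move=> gz; apply: lg; exists z.
Qed.

Lemma point_spectrum_L : point_spectrum D T = mu a b @` grid q t'.
Proof.
apply/seteqP; split=> [l hl|_ [g gg <-]]; last first.
  by have [Dg g0 Tg] := phi_eigen gg; exists (phi g).
have [m <-] := point_spectrum_diag sa ftrans_inj ftrans_lin ftrans_L hl.
by exists (gpt q t' m) => //; apply: gpt_gridP.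
Qed.

Lemma eigenspace_L (g : C) : grid q t' g ->
  op_eigenspace D T (mu a b g) = [set c *: phi g | c in [set: C]].
Proof.
move=> gg; have [Dg g0 Tg] := phi_eigen gg; have /grid_gpt[m mg] := gg.
rewrite -mg in Dg g0 Tg *.
exact: (eigenspace_diag sa ftrans_inj ftrans_lin ftrans_L evalue_inj Dg g0 Tg).
Qed.

End MeixnerSpectrum.

(** Real and imaginary parts are dominated by the norm, so their series converge absolutely in
    [R]. *)
Lemma sum_complete_complex (R : realType) : sum_complete R[i].
Proof.
move=> u [B hB]; pose Re := @complex.Re R; pose Im := @complex.Im R.
have ReD x y : Re (x + y) = Re x + Re y by case: x y => [? ?] [].
have ImD x y : Im (x + y) = Im x + Im y by case: x y => [? ?] [].
have ReS (v : nat -> R[i]) n : Re (\sum_(0 <= k < n) v k) = \sum_(0 <= k < n) Re (v k).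
  by elim: n => [|n ih]; rewrite ?big_nil // !big_nat_recr //= ReD ih.
have ImS (v : nat -> R[i]) n : Im (\sum_(0 <= k < n) v k) = \sum_(0 <= k < n) Im (v k).
  by elim: n => [|n ih]; rewrite ?big_nil // !big_nat_recr //= ImD ih.
have cvgR (v : nat -> R) : (forall k, (`|v k|%:C)%C <= `|u k|) -> cvgn (series v).
  move=> vu; apply: normed_cvg; apply: nondecreasing_is_cvgn.
    by apply: nondecreasing_series => n _ _; apply: normr_ge0.
  exists (Re B) => _ [n _ <-]; rewrite /series /=.
  suff : (\sum_(0 <= k < n) `|v k|)%:C%C <= B by rewrite lecE /= => /andP[].
  apply: le_trans (hB n); rewrite rmorph_sum /=; apply: ler_sum => k _; exact: vu.
have sRe : cvgn (series (Re \o u)) by apply: cvgR => k; apply: normc_ge_Re.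
have normIm z : (`|Im z|%:C)%C <= `|z|.
  by rewrite normc_def lecR -sqrtr_sqr ler_wsqrtr // lerDr sqr_ge0.
have sIm : cvgn (series (Im \o u)) by apply: cvgR => k; apply: normIm.
set x := limn (series (Re \o u)) in sRe *; set y := limn (series (Im \o u)) in sIm *.
apply/cvg_ex; exists (x +i* y)%C; apply/seq_cvgP => e e0.
(* A positive element of [R[i]] is real, so the estimate can be made in [R]. *)
have eR : e = ((Re e)%:C)%C.
  by rewrite [LHS]complexE ger0_Im ?mulr0 ?addr0 // ltW.
have e0R : 0 < Re e / 2 by rewrite divr_gt0 // -ltcR -eR.
have [N1 _ h1] := (cvgrPdist_le _ _).1 sRe _ e0R.
have [N2 _ h2] := (cvgrPdist_le _ _).1 sIm _ e0R.
exists (maxn N1 N2) => n; rewrite geq_max => /andP[/h1 h1n /h2 h2n].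
have hRe : Re ((x +i* y)%C - series u n) = x - series (Re \o u) n.
  by rewrite /series /= -ReS; case: (\sum_(0 <= k < n) u k).
have hIm : Im ((x +i* y)%C - series u n) = y - series (Im \o u) n.
  by rewrite /series /= -ImS; case: (\sum_(0 <= k < n) u k).
rewrite normc_def -/(Re _) -/(Im _) hRe hIm eR lecR.
move: (x - _) (y - _) h1n h2n => X Y hX hY.
apply: (@le_trans _ _ (`|X| + `|Y|)); last by rewrite [leRHS]splitr lerD.
have XY0 : 0 <= `|X| + `|Y| by rewrite addr_ge0.
rewrite -[leRHS](ger0_norm XY0) -sqrtr_sqr ler_wsqrtr // sqrrD !real_normK ?num_real //.
by rewrite addrAC lerDl mulrn_wge0 // mulr_ge0.
Qed.

(** * From the four parameter conditions to positivity on the grid *)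

Section GoodParameters.
Context {C : numClosedFieldType}.
Variables (q t a b : C).

Lemma good_of_parameters : 0 < q < 1 -> parameters q t a b -> good_parameters q t a b.
Proof.
move=> hq [t0 hp]; have [q0 q1] := andP hq.
have qX0 n : 0 < q ^+ n by rewrite exprn_gt0.
have qz0 (j : int) : 0 < q ^ j by rewrite exprz_gt0.
have qz1 (j : int) : 0 <= j -> q ^ j <= 1.
  by case: j => // n _; rewrite exprn_ile1 // ltW.
(* [c q^j] lies strictly between the consecutive powers [q^(j + k0)] and [q^(j + k0 - 1)], so its
   side of 1 depends on [j + k0] alone and is shared by all [c] in the interval. *)
have sep (k0 j : int) (c : C) : q ^ k0 < c < q ^ (k0 - 1) ->
    (1 <= j + k0 -> 0 < 1 - c * q ^ j) /\ (j + k0 <= 0 -> 1 - c * q ^ j < 0).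
  move=> /andP[c1 c2]; split=> jk; rewrite ?subr_gt0 ?subr_lt0.
    apply: (@lt_le_trans _ _ (q ^ (k0 - 1) * q ^ j)); first by rewrite ltr_pM2r.
    rewrite -expfzDr ?lt0r_neq0 // qz1 //.
    have -> : k0 - 1 + j = j + k0 - 1 by ring.
    by rewrite subr_ge0.
  apply: (@le_lt_trans _ _ (q ^ k0 * q ^ j)); last by rewrite ltr_pM2r.
  rewrite -expfzDr ?lt0r_neq0 // -[k0 + j]opprK -invr_expz invf_ge1 //.
  by rewrite qz1 // oppr_ge0 addrC.
have sep2 (k0 j : int) (c d : C) : q ^ k0 < c < q ^ (k0 - 1) ->
    q ^ k0 < d < q ^ (k0 - 1) -> 0 < (1 - c * q ^ j) * (1 - d * q ^ j).
  move=> /(sep k0 j)[c1 c2] /(sep k0 j)[d1 d2]; have [jk|jk] := leP 1 (j + k0).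
    by rewrite mulr_gt0 ?c1 ?d1.
  have jk' : j + k0 <= 0 by rewrite -ltzD1.
  by rewrite nmulr_lgt0 ?d2 ?c2.
have gx x : grid q t x -> x \is Num.real.
  move=> [[k _ <-]|[k _ <-]]; first by rewrite rpredN gtr0_real.
  by rewrite gtr0_real // mulr_gt0.
have pos c d x : 0 < c -> 0 < d -> 0 < x -> 0 < (1 + c * x) * (1 + d * x).
  by move=> c0 d0 x0; rewrite mulr_gt0 // ltr_wpDr // mulr_ge0 // ltW.
case: hp => [[ab /negP aR]|[/andP[a0 a1] /andP[b0 b1]]|[k0 [_ ha hb]]|[k0 [ha hb]]].
(* Conjugate parameters: the product is [|1 + a x|^2], and it is nonzero because [x] is real and [a]
   is not. *)
- have an0 : a != 0 by apply/eqP => a0; apply: aR; rewrite a0 rpred0.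
  have bE : b = a^* by rewrite ab conjCK.
  split=> //; first by rewrite bE -normCK exprn_gt0 // normr_gt0.
    by rewrite rmorphD /= -ab bE addrC.
  move=> x /gx xr; have -> : 1 + b * x = (1 + a * x)^*.
    by rewrite rmorphD rmorphM rmorph1 /= (CrealP xr) bE.
  rewrite -normCK exprn_gt0 // normr_gt0 addrC addr_eq0; apply/eqP => ax.
  have x0 : x != 0.
    by apply/eqP => x0; move/eqP: ax; rewrite x0 mulr0 eq_sym oppr_eq0 oner_eq0.
  by apply: aR; rewrite -(mulfK x0 a) ax rpred_div // rpredN rpred1.
- split=> //; first exact: mulr_gt0.
    by apply/CrealP; rewrite gtr0_real // addr_gt0.
  move=> x [[k _ <-]|[k _ <-]]; last by apply: pos => //; rewrite mulr_gt0.
  have h c : 0 < c -> c < 1 -> 0 < 1 + c * - q ^+ k.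
    move=> c0 c1; rewrite mulrN subr_gt0 (le_lt_trans _ c1) //.
    by rewrite ler_piMr ?(ltW c0) // exprn_ile1 // ltW.
  by rewrite mulr_gt0 ?h.
- have a0 : 0 < a by case/andP: ha => + _; apply: lt_trans.
  have b0 : 0 < b by case/andP: hb => + _; apply: lt_trans.
  split=> //; first exact: mulr_gt0.
    by apply/CrealP; rewrite gtr0_real // addr_gt0.
  move=> x [[k _ <-]|[k _ <-]]; last by apply: pos => //; rewrite mulr_gt0.
  by have := sep2 k0 (Posz k) a b ha hb; rewrite !mulrN.
(* Negative parameters: both factors are positive on the negative branch, and on the positive one
   the separation applies to [- (a * t)] and [- (b * t)]. *)
have a0 : a < 0.
  by have : 0 < - (a * t) by [case/andP: ha => + _; apply: lt_trans]; rewrite oppr_gt0 pmulr_llt0.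
have b0 : b < 0.
  by have : 0 < - (b * t) by [case/andP: hb => + _; apply: lt_trans]; rewrite oppr_gt0 pmulr_llt0.
split=> //; first by rewrite nmulr_rgt0.
  by apply/CrealP; rewrite rpredD ?ltr0_real.
move=> x [[k _ <-]|[k _ <-]].
  have h c : c < 0 -> 0 < 1 + c * - q ^+ k.
    by move=> c0; rewrite ltr_wpDr // mulrN -mulNr mulr_ge0 ?(ltW (qX0 k)) // oppr_ge0 ltW.
  by rewrite mulr_gt0 ?h.
by have := sep2 k0 k _ _ ha hb; rewrite !mulNr !opprK -!mulrA.
Qed.

End GoodParameters.

Theorem theorem3p1 (R : realType) (q0 t0 : R) (a b : R[i])
    (hq : 0 < q0 < 1) (hpar : parameters q0%:C%C t0%:C%C a b) :
  let q := q0%:C%C in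
  let t := t0%:C%C in
  let H := Ht q t a b in
  let ip := inner q t a b in
  let T := L q t a b in
  let D := domL q t a b in
  let phi := phi_fun q t a b in
  [/\ self_adjoint H ip D T,
      spectrum H ip D T =
        [set - (a * b)]
        `|` [set - (a * b) * (1 - q ^+ k) | k in [set: nat]]
        `|` [set - (a * b) * (1 + q ^ k / (a * b * t)) | k in [set: int]],
      spectrum H ip D T =
        [set mu a b 0] `|` mu a b @` negqN q
                       `|` mu a b @` cqZ (a * b * t)^-1 q,
      point_spectrum D T =
        mu a b @` negqN q `|` mu a b @` cqZ (a * b * t)^-1 q &
      forall gamma : R[i], (negqN q `|` cqZ (a * b * t)^-1 q) gamma ->
        [/\ D (phi gamma),
            phi gamma != 0,
            T (phi gamma) = mu a b gamma *: phi gamma &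
            op_eigenspace D T (mu a b gamma) =
              [set c *: phi gamma | c in [set: R[i]]]]].
Proof.
move=> q t H ip T D phi; have cplC := sum_complete_complex (R := R).
have hqC : 0 < q < 1 by rewrite -[0]/(0%:C%C) -[1]/(1%:C%C) !ltcR.
have good := good_of_parameters hqC hpar.
have spE := spectrum_L cplC good; rewrite image_setU setUA in spE.
split.
- exact: self_adjoint_L.
- rewrite spE; congr (_ `|` _ `|` _).
  + by rewrite /mu addr0 mulr1.
  + by rewrite /negqN image_comp.
  + rewrite /cqZ image_comp; congr (_ @` _); apply/funext => k /=.
    by rewrite /mu [_^-1 * _]mulrC.
- exact: spE.
- by rewrite -image_setU; apply: point_spectrum_L.
move=> g gg; have [Dg g0 Tg] := phi_eigen cplC good gg; split=> //.
exact: eigenspace_L.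
Qed.
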